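(* Let $M$ be a non-compact Riemann surface and $f:M\to\mathbb{CP}^2$ a conformal immersion without complex points. Then there exists a global lift $\mathfrak f:M\to S^5$ of $f$, i.e. a smooth map with $f=\pi\circ\mathfrak f$.
   Context: $\pi:S^5\to\mathbb{CP}^2$ is the Hopf fibration from the unit sphere $S^5\subset\mathbb C^3$; $\mathbb{CP}^2$ carries the Fubini-Study metric. A point $p\in M$ is a complex point of $f$ if the tangent plane $df(T_pM)$ is a complex line in $T_{f(p)}\mathbb{CP}^2$. *)

(* Defs.v *)
From HB Require Import structures.
From mathcomp Require Import all_boot all_order all_algebra.
From mathcomp Require Import complex.
From mathcomp Require Import all_classical all_reals all_analysis.
Set Implicit Arguments.
Unset Strict Implicit.
Unset Printing Implicit Defensive.
Import Order.TTheory GRing.Theory Num.Theory.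
Import numFieldNormedType.Exports.
Local Open Scope classical_set_scope.
Local Open Scope ring_scope.
Local Open Scope complex_scope.

(* The topology of C = R[i] given by the modulus, and C as a normed space over
   itself. *)
HB.instance Definition _ (R : realType) := NormedModule.copy R[i] R[i]^o.

(* The line t |-> z + t v, with t real. *)
Definition real_line (R : realType) (z v : R[i]) (t : R) : R[i] :=
  z + t%:C * v.

Definition real_dir_derive (R : realType) (u : R[i] -> R) (v z : R[i]) : R :=
  derive1 (u \o real_line z v) 0.

(* [Ck n U u]: all partial derivatives of u of order <= n, with respect to x
   (v = 1) and y (v = 'i), exist and are continuous on the open set U. *)
Fixpoint Ck (R : realType) (n : nat) (U : set R[i]) (u : R[i] -> R) : Prop :=
  (forall z, U z -> {for z, continuous u}) /\
  (if n is m.+1 then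
     forall v : R[i], v = 1 \/ v = 'i ->
       (forall z, U z -> derivable (u \o real_line z v) 0 1) /\
       Ck m U (fun z => real_dir_derive u v z)
   else True).

Definition smooth_vec (R : realType) (n : nat) (U : set R[i])
    (F : R[i] -> 'rV[R[i]]_n) : Prop :=
  forall (j : 'I_n) (k : nat),
    Ck k U (fun z => complex.Re (F z 0 j)) /\
    Ck k U (fun z => complex.Im (F z 0 j)).

(* The real differential of F at z, applied to the tangent vector v. *)
Definition real_diff (R : realType) (n : nat) (F : R[i] -> 'rV[R[i]]_n)
    (z v : R[i]) : 'rV[R[i]]_n :=
  \row_j (real_dir_derive (fun w => complex.Re (F w 0 j)) v z
          +i* real_dir_derive (fun w => complex.Im (F w 0 j)) v z).

(* A homeomorphism from the open set [chart_dom] onto an open subset of C, with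
   inverse [chart_inv]; the values of [chart_map] and [chart_inv] outside these
   open sets are irrelevant. *)
Record chart (R : realType) (T : topologicalType) := Chart {
  chart_dom : set T;
  chart_map : T -> R[i];
  chart_inv : R[i] -> T;
  chart_dom_open : open chart_dom;
  chart_map_open : open (chart_map @` chart_dom);
  chart_mapK : forall p, chart_dom p -> chart_inv (chart_map p) = p;
  chart_map_continuous :
    forall p, chart_dom p -> {for p, continuous chart_map};
  chart_inv_continuous :
    forall z, (chart_map @` chart_dom) z -> {for z, continuous chart_inv} }.

(* The transition maps are complex differentiable on their open domain:
   [derivable] is here taken over the field R[i].  Manifolds are second
   countable by convention; for Riemann surfaces this is automatic (Rado). *)
Record riemannSurface (R : realType) := RiemannSurface {
  surface :> topologicalType;
  atlas : set (chart R surface);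
  surface_hausdorff : hausdorff_space surface;
  surface_second_countable : @second_countable surface;
  surface_connected : connected [set: surface];
  atlas_cover : forall p : surface, exists2 c, atlas c & chart_dom c p;
  atlas_holomorphic : forall c d, atlas c -> atlas d ->
    forall p, chart_dom c p -> chart_dom d p ->
      derivable (chart_map d \o chart_inv c : R[i] -> R[i]) (chart_map c p) 1 }.

(* Smoothness on the open set W of a map with values in C^n. *)
Definition smooth_on (R : realType) (M : riemannSurface R) (n : nat)
    (W : set M) (g : M -> 'rV[R[i]]_n) : Prop :=
  forall c, @atlas R M c ->
    smooth_vec (chart_map c @` (W `&` chart_dom c)) (g \o chart_inv c).

Definition sphere5 (R : realType) : Type :=
  {z : 'rV[R[i]]_3 | dotmx z z == 1}.

(* Points of CP^2 are the complex lines of C^3. *)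
Definition CP2 (R : realType) : Type :=
  {L : {vspace 'rV[R[i]]_3} | \dim L == 1%N}.

Lemma dim_sphere5_line (R : realType) (z : sphere5 R) :
  \dim <[val z]>%VS == 1%N.
Proof.
rewrite dim_vline; have [z0|] := eqVneq (val z) 0 => //; have := valP z.
by rewrite /= z0 linear0l eq_sym oner_eq0.
Qed.

Definition hopf (R : realType) (z : sphere5 R) : CP2 R :=
  Sub <[val z]>%VS (dim_sphere5_line z).

(* A nonzero vector of the line L. *)
Definition line_vector (R : realType) (L : CP2 R) : 'rV[R[i]]_3 :=
  vpick (val L).

(* The affine chart U_j = {[z] | z_j != 0}, [z] |-> z / z_j, of CP^2, with
   values in the affine plane {z | z_j = 1} of C^3.  Neither definition depends
   on the choice made by line_vector. *)
Definition affine_dom (R : realType) (j : 'I_3) : set (CP2 R) :=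
  [set L | line_vector L 0 j != 0].

Definition affine_coord (R : realType) (j : 'I_3) (L : CP2 R) :
    'rV[R[i]]_3 :=
  (line_vector L 0 j)^-1 *: line_vector L.

(* The tangent space of CP^2 at [z] is C^3 / C z, i.e. its elements are the
   images of vectors v under the differential at z of C^3 \ {0} -> CP^2.  The
   horizontal lift of the tangent vector represented by v to z / |z| in S^5 is,
   up to a phase, (horizontal z v) / |z|; the Fubini-Study metric is the one for
   which the Hopf fibration is a Riemannian submersion. *)
Definition horizontal (R : realType) (z v : 'rV[R[i]]_3) : 'rV[R[i]]_3 :=
  v - (dotmx v z / dotmx z z) *: z.

Definition fubini_study (R : realType) (z v w : 'rV[R[i]]_3) : R :=
  complex.Re (dotmx (horizontal z v) (horizontal z w) / dotmx z z).

Definition smooth_to_CP2 (R : realType) (M : riemannSurface R)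
    (f : M -> CP2 R) : Prop :=
  forall j : 'I_3, open (f @^-1` affine_dom j) /\
    smooth_on (f @^-1` affine_dom j) (affine_coord j \o f).

(* df at p, read in the chart c at p and the affine chart j at f p.  It takes
   its values in the plane {v | v_j = 0}, the complex vector space of tangent
   vectors of the affine chart, which is identified with the tangent space of
   CP^2 at f p, complex structure included. *)
Definition diff_to_CP2 (R : realType) (M : riemannSurface R)
    (f : M -> CP2 R) (c : chart R M) (j : 'I_3) (p : M) :
    R[i] -> 'rV[R[i]]_3 :=
  real_diff (affine_coord j \o f \o chart_inv c) (chart_map c p).

(* The charts c at p and j at f p; by the chain rule the properties of df
   below do not depend on this choice. *)
Definition charts_at (R : realType) (M : riemannSurface R)
    (f : M -> CP2 R) (p : M) (c : chart R M) (j : 'I_3) : Prop :=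
  [/\ @atlas R M c, chart_dom c p & affine_dom j (f p)].

(* The second clause says that df is injective, the third one that the
   pull-back of the Fubini-Study metric is a positive multiple of |dz|^2 in
   every holomorphic coordinate z of M. *)
Definition conformal_immersion (R : realType) (M : riemannSurface R)
    (f : M -> CP2 R) : Prop :=
  [/\ smooth_to_CP2 f,
      forall p c j, charts_at f p c j ->
        forall v, diff_to_CP2 f c j p v = 0 -> v = 0
    & forall p c j, charts_at f p c j ->
        exists2 l : R, 0 < l & forall v w,
          fubini_study (affine_coord j (f p))
            (diff_to_CP2 f c j p v) (diff_to_CP2 f c j p w)
          = l * complex.Re (v * w^*) ].

(* The tangent plane df(T_p M) is the complex line spanned by some u != 0. *)
Definition complex_point (R : realType) (M : riemannSurface R)
    (f : M -> CP2 R) (p : M) : Prop :=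
  exists c j, charts_at f p c j /\
    exists2 u : 'rV[R[i]]_3, u != 0 &
      range (diff_to_CP2 f c j p) = [set a *: u | a in [set: R[i]]].

(* S^5 is an embedded submanifold of C^3. *)
Definition smooth_to_sphere5 (R : realType) (M : riemannSurface R)
    (g : M -> sphere5 R) : Prop :=
  smooth_on [set: M] (fun p => val (g p)).

(* Main.v *)
Require Import Defs.
From mathcomp Require Import all_boot all_order all_algebra.
From mathcomp Require Import complex.
From mathcomp Require Import all_classical all_reals all_analysis.
From HB Require Import structures.
From mathcomp Require Import ring lra.

(** A lift of [f] is a nowhere zero smooth section, normalised to length one, of
    the line bundle whose fibre at [p] is the line [f p].  Such a section exists
    because a complex line bundle on a non-compact surface is trivial, and a
    trivialisation is obtained by pushing the zeros of a section to infinity.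

    For a linear form [A] on C^3, the orthogonal projection to the line [f p] of
    the vector representing [A] is a smooth section, which vanishes where [A]
    does.  The forms having a degenerate zero are multiples of the cross products
    of [f p] with a tangent vector, a family with five real parameters, so that
    by Baire's theorem some [A] has non-degenerate zeros only.  At such a zero
    the section looks like [z] or like the conjugate of [z].

    If [q] and [q'] are close to each other in a chart, a cut-off of
    [(z - q') / (z - q)] equals 1 away from them; multiplying the section by this
    function, or by its conjugate, moves the zero from [q] to [q'].  Chaining
    such moves, zeros travel inside any connected open set.  Exhausting the
    surface by compact sets whose complement has no relatively compact
    component, the zeros are removed from each of them in turn without changing
    the section on the preceding one.

    Smooth cut-off functions live in one chart and must be smooth in all of them.
    That transition maps are smooth follows from the conformality of [f], not
    from Cauchy's formula; see [transition_CC_local]. *)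

Set Implicit Arguments.
Unset Strict Implicit.
Unset Printing Implicit Defensive.
Import Order.TTheory GRing.Theory Num.Theory.
Import numFieldNormedType.Exports.
Import ComplexField.Normc.
Local Open Scope classical_set_scope.
Local Open Scope ring_scope.
Local Open Scope complex_scope.

(** * Complex numbers and one-variable lines *)

(** The section is smooth, not holomorphic: at a non-degenerate zero its differential is
    [a z + b conj z] with [|a| <> |b|]. If [|b| < |a|], the quotient by [z] has in general no limit
    at the zero, but it stays in a disc about [a] that misses 0; otherwise the same holds for the
    quotient by [conj z]. Nothing more is kept of a zero: being trapped in such a disc survives
    multiplication by a function with a non-zero limit, and it suffices for replacing the function
    near the point by a constant without creating zeros. Poles and zeros of the multipliers are
    therefore described by limits in a chart, and of the holomorphic structure only the derivatives
    of the transition maps are used.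

    The five parameters of the degenerate forms are two for the point, one for the real direction of
    the tangent vector and two for the complex factor. That a Lipschitz image of a five-dimensional
    box is nowhere dense in R^6 is shown by counting cubes; this takes the place of Sard's
    theorem. *)

Lemma normcC (R : realType) (z : R[i]) : `|z| = (normc z)%:C.
Proof. by []. Qed.

Lemma normc_ge0 (R : realType) (z : R[i]) : 0 <= normc z.
Proof. by rewrite -ler0c -normcC. Qed.

Lemma normc_gt0 (R : realType) (z : R[i]) : (0 < normc z) = (z != 0).
Proof. by rewrite -ltcR -normcC normr_gt0. Qed.

Lemma normc_eq0 (R : realType) (z : R[i]) : (normc z == 0) = (z == 0).
Proof. by apply/eqP/eqP => [/eq0_normc//|->]; rewrite normc0. Qed.

Lemma normcB (R : realType) (z w : R[i]) : normc (z - w) = normc (w - z).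
Proof. by rewrite -opprB normcN. Qed.

Lemma normcR (R : realType) (x : R) : normc x%:C = `|x|.
Proof. by rewrite /= expr0n /= addr0 sqrtr_sqr. Qed.

Lemma normc_conj (R : realType) (z : R[i]) : normc z^* = normc z.
Proof. by apply: complexI; rewrite -!normcC normcJ. Qed.

Lemma ler_Re_normc (R : realType) (z : R[i]) : `|complex.Re z| <= normc z.
Proof. by rewrite -lecR -normcC normc_ge_Re. Qed.

Lemma ler_Im_normc (R : realType) (z : R[i]) : `|complex.Im z| <= normc z.
Proof.
case: z => a b /=; rewrite -sqrtr_sqr; apply: ler_wsqrtr.
by rewrite lerDr sqr_ge0.
Qed.

Lemma normc_le_ReIm (R : realType) (z : R[i]) :
  normc z <= `|complex.Re z| + `|complex.Im z|.
Proof.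
rewrite {1}[z]complexE; apply: le_trans (le_normcD _ _) _.
by rewrite normcM !normcR /= expr0n expr1n add0r sqrtr1 mul1r.
Qed.

Lemma normc_i (R : realType) : normc ('i : R[i]) = 1.
Proof. by rewrite /= expr0n expr1n add0r sqrtr1. Qed.

Lemma gt0_complex (R : realType) (e : R[i]) :
  0 < e -> exists2 d : R, 0 < d & e = d%:C.
Proof.
by case: e => a b; rewrite ltcE /= => /andP[/eqP-> a0]; exists a.
Qed.

Lemma nbhs_complexP (R : realType) (z : R[i]) (A : set R[i]) :
  nbhs z A <-> exists2 e : R, 0 < e & forall w, normc (w - z) < e -> A w.
Proof.
split=> [/nbhs_normP[e /= e0 eA]|[e e0 eA]].
  have [d d0 ed] := gt0_complex e0; exists d => // w wz; apply: eA => /=.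
  by rewrite ed normcC ltcR normcB.
apply/nbhs_normP; exists e%:C; first by rewrite /= ltcR.
by move=> w /=; rewrite normcC ltcR => wz; apply: eA; rewrite normcB.
Qed.

Lemma nbhs_realP (R : realType) (z : R) (A : set R) :
  nbhs z A <-> exists2 e : R, 0 < e & forall w, `|w - z| < e -> A w.
Proof.
split=> [/nbhs_normP[e /= e0 eA]|[e e0 eA]].
  by exists e => // w wz; apply: eA => /=; rewrite distrC.
by apply/nbhs_normP; exists e => //= w /= wz; apply: eA; rewrite distrC.
Qed.

Lemma open_complexP (R : realType) (U : set R[i]) (z : R[i]) :
  open U -> U z ->
  exists2 e : R, 0 < e & forall w, normc (w - z) < e -> U w.
Proof. by move=> oU Uz; apply/nbhs_complexP/open_nbhs_nbhs. Qed.

Lemma near_eq_for (S T : topologicalType) (f g : S -> T) (x : S) :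
  (\forall y \near x, f y = g y) ->
  {for x, continuous f} -> {for x, continuous g}.
Proof.
move=> E cf; rewrite /prop_for /continuous_at -(nbhs_singleton E).
exact: cvg_trans (near_eq_cvg E) cf.
Qed.

Section topC.
Variable R : realType.
Local Notation C := R[i].
Implicit Types (u v : C -> R) (z w : C) (U V : set C).

Lemma cvg_complexP (T : Type) (F : set_system T) (FF : Filter F)
    (h : T -> C) (l : C) :
  (h @ F --> l) <->
  (forall e : R, 0 < e -> \forall x \near F, normc (h x - l) < e).
Proof.
split=> [hl e e0|H A /nbhs_complexP[e e0 eA]].
  by apply: (hl [set w | normc (w - l) < e]); apply/nbhs_complexP; exists e.
by move: (H e e0); apply: filterS => x; exact: eA.
Qed.

Lemma cvg_realP (T : Type) (F : set_system T) (FF : Filter F)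
    (h : T -> R) (l : R) :
  (h @ F --> l) <->
  (forall e : R, 0 < e -> \forall x \near F, `|h x - l| < e).
Proof.
split=> [hl e e0|H A /nbhs_realP[e e0 eA]].
  by apply: (hl [set w | `|w - l| < e]); apply/nbhs_realP; exists e.
by move: (H e e0); apply: filterS => x; exact: eA.
Qed.

Lemma continuous_complexP (T : topologicalType) (h : T -> C) (p : T) :
  {for p, continuous h} <->
  (forall e : R, 0 < e -> \forall x \near p, normc (h x - h p) < e).
Proof. exact: cvg_complexP. Qed.

Lemma cvg_Re (T : Type) (F : set_system T) (FF : Filter F)
    (h : T -> C) (l : C) :
  h @ F --> l -> (fun x => complex.Re (h x)) @ F --> complex.Re l.
Proof.
move=> /cvg_complexP H; apply/cvg_realP => e /H; apply: filterS => x.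
by apply: le_lt_trans; rewrite -raddfB ler_Re_normc.
Qed.

Lemma cvg_Im (T : Type) (F : set_system T) (FF : Filter F)
    (h : T -> C) (l : C) :
  h @ F --> l -> (fun x => complex.Im (h x)) @ F --> complex.Im l.
Proof.
move=> /cvg_complexP H; apply/cvg_realP => e /H; apply: filterS => x.
by apply: le_lt_trans; rewrite -raddfB ler_Im_normc.
Qed.

Lemma cvg_complex (T : Type) (F : set_system T) (FF : Filter F)
    (a b : T -> R) (x y : R) :
  a @ F --> x -> b @ F --> y -> (fun t => a t +i* b t) @ F --> x +i* y.
Proof.
move=> /cvg_realP Ha /cvg_realP Hb; apply/cvg_complexP => e e0.
have e20 : 0 < e / 2 by rewrite divr_gt0.
move: (Ha _ e20) (Hb _ e20); apply: filterS2 => t ha hb.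
apply: le_lt_trans (normc_le_ReIm _) _ => /=.
by rewrite [e]splitr ltrD.
Qed.

Lemma continuous_conjc : continuous (@conjc R).
Proof.
move=> z; have -> : @conjc R = fun z => complex.Re z +i* - complex.Im z.
  by apply/funext => -[].
have hid : (fun z : C => z) @ z --> z by exact: cvg_id.
exact: cvg_complex _ (cvg_Re _ hid) (cvgN (cvg_Im _ hid)).
Qed.

Lemma continuous_real_line z w (t : R) :
  {for t, continuous (real_line z w)}.
Proof.
rewrite /real_line; have -> : (fun t : R => z + t%:C * w) = fun t =>
   (complex.Re z + t * complex.Re w) +i* (complex.Im z + t * complex.Im w).
  apply/funext => s; case: z w => [a b] [c d]; simpc; congr (_ +i* _); ring.
have lin (a b : R) : (fun s : R => a + s * b) @ t --> a + t * b.
  by apply: cvgD; [exact: cvg_cst|apply: cvgMr_tmp; exact: cvg_id].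
exact: cvg_complex _ (lin _ _) (lin _ _).
Qed.

Lemma real_line0 z w : real_line z w 0 = z.
Proof. by rewrite /real_line mul0r addr0. Qed.

Lemma near_real_line U z w : open U -> U z ->
  \forall t \near (0 : R), U (real_line z w t).
Proof.
move=> oU Uz; apply: (@continuous_real_line z w 0).
by rewrite real_line0; exact: open_nbhs_nbhs.
Qed.

End topC.

(** * Functions of class C^k on open sets of C *)

Section CkTheory.
Variable R : realType.
Local Notation C := R[i].
Implicit Types (u w : C -> R) (z v : C) (U V : set C).

Lemma Ck_continuous n U u z : Ck n U u -> U z -> {for z, continuous u}.
Proof. by case: n => [|n] [cu _]; exact: cu. Qed.

(** Openness of [U] matters: a derivative at a point of [U] sees the values along a segment through
    that point. *)
Lemma Ck_congr n U u w : open U -> (forall z, U z -> u z = w z) ->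
  Ck n U u -> Ck n U w.
Proof.
move=> oU.
have cE u' w' z : (forall z, U z -> u' z = w' z) -> U z ->
    {for z, continuous u'} -> {for z, continuous w'}.
  move=> E Uz; apply: near_eq_for.
  by apply: filterS (open_nbhs_nbhs (conj oU Uz)).
elim: n u w => [|n IH] u w E [cu du].
  by split=> // z Uz; apply: (cE u) => //; exact: cu.
split=> [z Uz|v hv]; first by apply: (cE u) => //; exact: cu.
have [dv Cv] := du _ hv; split=> [z Uz|].
  apply: near_eq_derivable (dv _ Uz).
  by apply: filterS (near_real_line v oU Uz) => t /E.
apply: IH Cv => z Uz; rewrite /real_dir_derive !derive1E.
apply: near_eq_derive.
by apply: filterS (near_real_line v oU Uz) => t /E.
Qed.

(** Trades [derivable] and the value of [real_dir_derive] for one [is_derive] witness, so that the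
    closure properties below follow from the derivation rules by induction on [n]. *)
Lemma CkSP n U u : open U ->
  Ck n.+1 U u <->
  (forall z, U z -> {for z, continuous u}) /\
  forall v, v = 1 \/ v = 'i -> exists2 du : C -> R,
    (forall z, U z -> is_derive (0 : R) (1 : R) (u \o real_line z v) (du z)) &
    Ck n U du.
Proof.
move=> oU; split=> [[cu du]|[cu du]]; split=> // v hv.
  have [dvu Cu] := du v hv; exists (fun z => real_dir_derive u v z) => // z Uz.
  by split; [exact: dvu|rewrite -derive1E].
have [d hd Cd] := du v hv; split=> [z /hd|]; first by case.
apply: Ck_congr Cd => // z /hd[_ <-].
by rewrite -derive1E.
Qed.

Lemma Ck_sub n U V u : V `<=` U -> Ck n U u -> Ck n V u.
Proof.
elim: n u => [|n IH] u VU [cu du]; (split; first by move=> z /VU/cu) => // v hv.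
by have [d1 d2] := du v hv; split=> [z /VU/d1//|]; exact: IH.
Qed.

Lemma CkW n U u : Ck n.+1 U u -> Ck n U u.
Proof.
elim: n u => [|n IH] u [cu du]; split=> // v hv.
by have [d1 d2] := du v hv; split=> //; exact: IH.
Qed.

Lemma Ck_le m n U u : (m <= n)%N -> Ck n U u -> Ck m U u.
Proof.
move=> /subnK <-; elim: (n - m)%N => [//|k IH] H; apply: IH.
by apply: CkW; rewrite addSn in H.
Qed.

(** [V] may be any set: continuity and derivability in [Ck] concern [u] as a function on the whole
    plane, tested at the points of [V]. *)
Lemma Ck_local n U u :
  (forall z, U z -> exists2 V, V z & Ck n V u) -> Ck n U u.
Proof.
have cu m (u' : C -> R) : (forall z, U z -> exists2 V, V z & Ck m V u') ->
  forall z, U z -> {for z, continuous u'}.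
  by move=> H z /H[V Vz /Ck_continuous]; exact.
elim: n u => [|n IH] u H; (split; first exact: cu H) => // v hv.
split=> [z /H[V Vz [_ /(_ v hv)[dV _]]]|]; first exact: dV.
by apply: IH => z /H[V Vz [_ /(_ v hv)[_ CV]]]; exists V.
Qed.

Lemma Ck_cst n U (a : R) : open U -> Ck n U (fun=> a).
Proof.
move=> oU; elim: n a => [|n IH] a; first by split=> // z _; exact: cst_continuous.
apply/CkSP => //; split=> [z _|v _]; first exact: cst_continuous.
by exists (fun=> 0); [move=> z _; exact: is_derive_cst|exact: IH].
Qed.

Lemma is_derive_linear u z v :
  (forall z v t, u (real_line z v t) = u z + t * u v) ->
  is_derive (0 : R) (1 : R) (u \o real_line z v) (u v).
Proof.
move=> lu; rewrite (_ : u \o _ = cst (u z) + (fun t => t * u v)); last first.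
  by apply/funext => t /=; rewrite lu.
have /= H := is_deriveD (is_derive_cst (u z) (0 : R) (1 : R))
  (is_deriveM (is_derive_id (0 : R) (1 : R)) (is_derive_cst (u v) (0 : R) (1 : R))).
by apply: is_derive_eq; rewrite scaler0 !add0r [LHS]mulr1.
Qed.

Lemma Ck_linear n U u : open U ->
  (forall z, {for z, continuous u}) ->
  (forall z v t, u (real_line z v t) = u z + t * u v) -> Ck n U u.
Proof.
move=> oU cu lu; case: n => [|n]; first by split.
apply/CkSP => //; split=> // v _; exists (fun=> u v); last exact: Ck_cst.
by move=> z _; exact: is_derive_linear.
Qed.

Lemma CkD n U u w : open U -> Ck n U u -> Ck n U w ->
  Ck n U (fun z => u z + w z).
Proof.
move=> oU; elim: n u w => [|n IH] u w.
  move=> [cu _] [cw _]; split=> // z Uz.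
  exact: continuousD (cu _ Uz) (cw _ Uz).
move=> /(CkSP _ _ oU)[cu du] /(CkSP _ _ oU)[cw dw].
apply/(CkSP _ _ oU); split=> [z Uz|v hv].
  exact: continuousD (cu _ Uz) (cw _ Uz).
have [d1 hd1 C1] := du v hv; have [d2 hd2 C2] := dw v hv.
exists (fun z => d1 z + d2 z); last exact: IH.
by move=> z Uz; apply: is_deriveD; [exact: hd1|exact: hd2].
Qed.

Lemma CkM n U u w : open U -> Ck n U u -> Ck n U w ->
  Ck n U (fun z => u z * w z).
Proof.
move=> oU; elim: n u w => [|n IH] u w.
  move=> [cu _] [cw _]; split=> // z Uz.
  exact: continuousM (cu _ Uz) (cw _ Uz).
move=> Cu Cw; move: (Cu) (Cw) => /(CkSP _ _ oU)[cu du] /(CkSP _ _ oU)[cw dw].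
apply/(CkSP _ _ oU); split=> [z Uz|v hv].
  exact: continuousM (cu _ Uz) (cw _ Uz).
have [d1 hd1 C1] := du v hv; have [d2 hd2 C2] := dw v hv.
exists (fun z => u z * d2 z + w z * d1 z).
  move=> z Uz; have [{}hd1 {}hd2] := (hd1 z Uz, hd2 z Uz).
  by have := is_deriveM hd1 hd2; rewrite /= real_line0.
by apply: CkD => //; apply: IH => //; exact: CkW.
Qed.

Lemma CkN n U u : open U -> Ck n U u -> Ck n U (fun z => - u z).
Proof.
move=> oU Cu; apply: (@Ck_congr _ _ (fun z => -1 * u z)) => //.
  by move=> z _; rewrite mulN1r.
by apply: CkM => //; exact: Ck_cst.
Qed.

(** The regularity of [psi \o u] is left as a hypothesis because, for the inverse, the square root
    and [rho], the derivative [psi] is built from functions of the same kind; an induction on [n]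
    then supplies it. *)
Lemma Ck_comp1 n U u (phi psi : R -> R) : open U -> Ck n.+1 U u ->
  (forall z, U z -> {for u z, continuous phi}) ->
  (forall z, U z -> is_derive (u z) (1 : R) phi (psi (u z))) ->
  Ck n U (psi \o u) -> Ck n.+1 U (phi \o u).
Proof.
move=> oU /[dup] Cu /(CkSP _ _ oU)[cu du] cphi dphi Cpsi; apply/(CkSP _ _ oU).
split=> [z Uz|v hv]; first exact: continuous_comp (cu _ Uz) (cphi _ Uz).
have [d hd Cd] := du v hv; exists (fun z => d z * psi (u z)); last exact: CkM.
move=> z Uz; have hu := hd z Uz.
have := dphi z Uz; rewrite -{1}[z in u z](real_line0 z v) => hphi.
by have := is_derive1_comp hphi hu; rewrite mulrC.
Qed.

Lemma CkV n U u : open U -> (forall z, U z -> u z != 0) -> Ck n U u ->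
  Ck n U (fun z => (u z)^-1).
Proof.
move=> oU u0; elim: n => [|n IH] Cu.
  case: Cu => cu _; split=> // z Uz; exact: continuousV (u0 _ Uz) (cu _ Uz).
apply: (@Ck_comp1 _ _ _ (fun x => x^-1) (fun x => - x ^- 2)) => //.
- by move=> z Uz; apply: inv_continuous; exact: u0.
- move=> z Uz; split; first by apply: derivableV => //; exact: u0.
  rewrite deriveV//; last exact: u0.
  by rewrite derive_id [LHS]mulr1.
have Cu' := IH (CkW Cu).
apply: (@Ck_congr _ _ (fun z => - ((u z)^-1 * (u z)^-1))) => //.
  by move=> z Uz /=; rewrite -exprVn expr2.
exact/CkN/CkM.
Qed.

Lemma Ck_sqrt n U u : open U -> (forall z, U z -> 0 < u z) -> Ck n U u ->
  Ck n U (fun z => Num.sqrt (u z)).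
Proof.
move=> oU u0; elim: n => [|n IH] Cu.
  case: Cu => cu _; split=> // z Uz.
  exact: continuous_comp (cu _ Uz) (@sqrt_continuous _ _).
apply: (@Ck_comp1 _ _ _ Num.sqrt (fun x => (2 * Num.sqrt x)^-1)) => //.
- by move=> z Uz; exact: sqrt_continuous.
- by move=> z Uz; apply: is_derive1_sqrt; exact: u0.
apply: CkV => // [z Uz|]; first by rewrite mulf_neq0// sqrtr_eq0 -ltNge u0.
by apply: CkM; [exact: oU|exact: Ck_cst|exact/IH/CkW].
Qed.

End CkTheory.

(** * The flat function exp(-1/x) and its relatives *)

Section OneVar.
Variable R : realType.
Implicit Types (f : R -> R) (x d e t : R).

Lemma is_derive_eps f x d :
  (forall e, 0 < e -> exists2 c : R, 0 < c &
     forall t, `|t| < c -> `|f (x + t) - f x - t * d| <= e * `|t|) ->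
  is_derive x 1 f d.
Proof.
move=> H; have L : (fun h : R => h^-1 *: ((f \o shift x) (h *: (1 : R)) - f x))
    @ 0^' --> d.
  apply/cvgrPdist_le => e e0; have [c c0 Hc] := H e e0.
  near=> t; have t0 : t != 0 by near: t; exact: nbhs_dnbhs_neq.
  have tc : `|t| < c by near: t; apply: dnbhs0_lt.
  have {Hc} := Hc t tc; rewrite /= -[_ *: 1]/(t * 1) mulr1 [t + x]addrC => Hc.
  rewrite distrC -(ler_pM2l (_ : 0 < `|t|)) ?normr_gt0// -normrM mulrBr.
  by rewrite -[_ *: _]/(t^-1 * _) mulrA divff// mul1r mulrC [e * _]mulrC in Hc *.
split; first by apply/cvg_ex; exists d.
exact: cvg_lim L.
Unshelve. all: by end_near. Qed.

Lemma is_derive_shift0 f x d :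
  is_derive (0 : R) (1 : R) (fun t => f (x + t)) d -> is_derive x (1 : R) f d.
Proof.
have E : (fun h : R => h^-1 *: (((fun t => f (x + t)) \o shift 0) (h *: (1 : R))
    - f (x + 0))) = (fun h => h^-1 *: ((f \o shift x) (h *: 1) - f x)).
  by apply/funext => h /=; rewrite !addr0 [x + _]addrC.
move=> [d1 d2]; split; first by move: d1; rewrite /derivable E.
by move: d2; rewrite /derive E.
Qed.

(** For [n = 0] this is the classical flat function; the factors [x ^- n] make the family stable
    under differentiation up to linear combinations, so that one induction proves all its members
    smooth. *)
Definition rho (n : nat) (x : R) : R :=
  if 0 < x then x ^- n * expR (- x^-1) else 0.

Lemma rho_ge0 n x : 0 <= rho n x.
Proof.
rewrite /rho; case: ifP => // x0.
by rewrite mulr_ge0 ?expR_ge0// invr_ge0 exprn_ge0// ltW.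
Qed.

Lemma rho0_gt0 x : 0 < x -> 0 < rho 0 x.
Proof. by move=> x0; rewrite /rho x0 invr1 mul1r expR_gt0. Qed.

Lemma rho_le0 n x : x <= 0 -> rho n x = 0.
Proof. by rewrite /rho ltNge => ->. Qed.

(** The bound comes from the term of degree [n + 2] of the exponential series at [1 / x]. Being
    quadratic, it gives the derivative 0 at the origin. *)
Lemma rho_quadratic n x : 0 < x -> rho n x <= (n.+2)`!%:R * x ^+ 2.
Proof.
move=> x0; rewrite /rho x0.
have f0 : 0 < ((n.+2)`!%:R : R) by rewrite ltr0n fact_gt0.
have xn m : 0 < x ^+ m by rewrite exprn_gt0.
have H : x^-1 ^+ n.+2 / (n.+2)`!%:R <= expR (x^-1).
  apply: le_trans (@expR_ge1Dxn R x^-1 n.+1 _); first by rewrite lerDr.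
  by rewrite invr_ge0 ltW.
rewrite expRN ler_pdivrMr ?expR_gt0//.
move: H; rewrite ler_pdivrMr// -(ler_pM2l (xn 2%N)) => H.
have -> : x ^- n = x ^+ 2 * x^-1 ^+ n.+2.
  by rewrite exprVn -[n.+2]addn2 exprD invfM mulrCA divff ?mulr1// gt_eqF.
by apply: le_trans H _; rewrite le_eqVlt; apply/orP; left; apply/eqP; ring.
Qed.

Lemma is_derive_rho n x :
  is_derive x 1 (rho n) (rho n.+2 x - n%:R * rho n.+1 x).
Proof.
have [x0|x0|->] := ltgtP x 0.
- rewrite !rho_le0 ?ltW// mulr0 subr0.
  apply: (@near_eq_is_derive _ _ _ (cst (0 : R))).
  near=> y; rewrite rho_le0//; near: y.
  by apply: filterS (lt_nbhsl x0) => ? /ltW.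
- have xn0 : x != 0 by rewrite gt_eqF.
  apply: (@near_eq_is_derive _ _ _ (fun y : R => y ^- n * expR (- y^-1))).
    near=> y; rewrite /rho ifT//; near: y; exact: lt_nbhsr.
  have H1 : is_derive x (1 : R) (fun y : R => - y^-1) (- (- x ^- 2 *: 1)).
    by apply: is_deriveN; exact: (@is_deriveV _ (id : R -> R)).
  have H2 := is_derive1_comp (is_derive_expR _) H1.
  have H3 : is_derive x (1 : R) (fun y : R => y ^- n)
      (- (x ^+ n) ^- 2 *: ((n%:R * x ^+ n.-1) *: 1)).
    apply: (@is_deriveV _ (fun y : R => y ^+ n)); first by rewrite expf_neq0.
    have := @is_deriveX _ _ (id : R -> R) n x 1 1 (is_derive_id _ _).
    by rewrite exprfctE.
  have H := is_deriveM H3 H2.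
  apply: (is_derive_eq H); rewrite /=.
  rewrite /rho x0 -![_ *: _]/(_ * _) !mulr1 mulNr opprK.
  case: n {H H3} => [|n] /=; first by rewrite !mul0r !mulr0; field.
  by rewrite !exprS; field; rewrite xn0 expf_neq0.
- apply: is_derive_eps => e e0.
  set K := (n.+2)`!%:R : R.
  exists (e / (K + 1)) => [|t].
    by rewrite divr_gt0// ltr_wpDl// ler0n.
  rewrite add0r !(rho_le0 _ (lexx 0)) mulr0 !subr0 mulr0 subr0 => tc.
  have [t0|t0] := leP t 0; first by rewrite rho_le0// normr0 mulr_ge0// ltW.
  rewrite !ger0_norm ?rho_ge0 ?(ltW t0)// in tc *.
  apply: le_trans (rho_quadratic n t0) _; rewrite -/K expr2 mulrA.
  rewrite ler_wpM2r// ?ltW//; move: tc; rewrite ltr_pdivlMr; last first.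
    by rewrite ltr_wpDl// ler0n.
  rewrite mulrDr mulr1 => tc; lra.
Unshelve. all: by end_near. Qed.

End OneVar.

(** * Differentiability from continuous partial derivatives, and the chain rule *)

Section Differentiability.
Variable R : realType.
Local Notation C := R[i].
Implicit Types (u : C -> R) (z v h w c : C) (U V : set C).

Lemma Ck_rho n m U u : open U -> Ck n U u -> Ck n U (fun z => rho m (u z)).
Proof.
move=> oU; elim: n m u => [|n IH] m u Cu.
  case: Cu => cu _; split=> // z Uz; apply: (continuous_comp (cu _ Uz)).
  have [d _] := is_derive_rho m (u z).
  exact/differentiable_continuous/derivable1_diffP.
apply: (@Ck_comp1 _ _ _ _ (rho m)
  (fun x => rho m.+2 x - m%:R * rho m.+1 x)) => //.
- move=> z Uz; have [d _] := is_derive_rho m (u z).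
  exact/differentiable_continuous/derivable1_diffP.
- by move=> z _; exact: is_derive_rho.
have {}IH k := IH k _ (CkW Cu).
apply: (CkD oU (IH m.+2)); apply: CkN => //.
exact: (CkM oU (Ck_cst n m%:R oU) (IH m.+1)).
Qed.

Lemma is_derive_line U u v z (s : R) : Ck 1 U u -> v = 1 \/ v = 'i ->
  U (real_line z v s) ->
  is_derive s (1 : R) (u \o real_line z v)
    (real_dir_derive u v (real_line z v s)).
Proof.
move=> [_ /(_ v)H] hv Us; have [dv _] := H hv.
apply: is_derive_shift0.
rewrite (_ : (fun t => _) = u \o real_line (real_line z v s) v).
  by split; [exact: dv|rewrite -derive1E].
apply/funext => t; rewrite /comp /real_line.
by rewrite rmorphD mulrDl addrA.
Qed.

Lemma mvt_line U u v z (t : R) : Ck 1 U u -> v = 1 \/ v = 'i ->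
  (forall s : R, `|s| <= `|t| -> U (real_line z v s)) ->
  exists2 s : R, `|s| <= `|t| &
    u (real_line z v t) - u z = t * real_dir_derive u v (real_line z v s).
Proof.
move=> Cu hv HU; set f := u \o real_line z v.
set df := fun s => real_dir_derive u v (real_line z v s).
have dfs s : `|s| <= `|t| -> is_derive (s : R) (1 : R) f (df s).
  by move=> st; exact: is_derive_line Cu hv (HU _ st).
have cf (s : R) : `|s| <= `|t| -> {for s, continuous f}.
  by move=> /dfs[d _]; exact/differentiable_continuous/derivable1_diffP.
have f0 : f 0 = u z by rewrite /f /= real_line0.
have [t0|t0|t0] := ltgtP t 0.
- have bd (s : R) : s \in `[t, 0]%R -> `|s| <= `|t|.
    by rewrite in_itv /= => /andP[ts s0]; rewrite !ler0_norm ?lerN2// ltW.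
  have h1 (s : R) : s \in `]t, 0[%R -> is_derive s (1 : R) f (df s).
    by move=> st; apply/dfs/bd; exact: subset_itv_oo_cc.
  have h2 : {within `[t, 0], continuous f}.
    by apply: continuous_in_subspaceT => s; rewrite inE => /bd; exact: cf.
  have [s sI E] := MVT_segment (ltW t0) h1 h2.
  by exists s; [exact: bd|rewrite -f0 -opprB E /df sub0r mulrN opprK mulrC].
- have bd (s : R) : s \in `[0, t]%R -> `|s| <= `|t|.
    by rewrite in_itv /= => /andP[ts s0]; rewrite !ger0_norm// ltW.
  have h1 (s : R) : s \in `]0, t[%R -> is_derive s (1 : R) f (df s).
    by move=> st; apply/dfs/bd; exact: subset_itv_oo_cc.
  have h2 : {within `[0, t], continuous f}.
    by apply: continuous_in_subspaceT => s; rewrite inE => /bd; exact: cf.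
  have [s sI E] := MVT_segment (ltW t0) h1 h2.
  by exists s; [exact: bd|rewrite -f0 E /df subr0 mulrC].
by exists 0; rewrite ?normr0// t0 real_line0 subrr mul0r.
Qed.

Lemma complex_line w z : w = real_line (real_line z 1 (complex.Re (w - z)))
  'i (complex.Im (w - z)).
Proof.
rewrite /real_line mulr1 -addrA [_%:C * 'i]mulrC.
by rewrite -complexE addrC subrK.
Qed.

Lemma normc_line1 z (s : R) : normc (real_line z 1 s - z) = `|s|.
Proof. by rewrite /real_line mulr1 addrAC subrr add0r normcR. Qed.

Lemma normc_linei z (s : R) : normc (real_line z 'i s - z) = `|s|.
Proof.
by rewrite /real_line addrAC subrr add0r normcM normcR normc_i mulr1.
Qed.

Lemma normc_triangle (z w t : C) : normc (z - t) <= normc (z - w) + normc (w - t).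
Proof. by apply: le_trans (le_normcD _ _); rewrite addrA subrK. Qed.

(* Going from [z'] to [w] first horizontally, then vertically, stays within
   distance [5 r] of the centre when [z'] and [w] are at distance at most [r]. *)
Lemma mvt_corner U u c z w (r : R) : Ck 1 U u ->
  (forall x, normc (x - c) <= 5 * r -> U x) ->
  normc (z - c) <= r -> normc (w - c) <= r ->
  exists x y, [/\ normc (x - c) <= 5 * r, normc (y - c) <= 5 * r &
    u w - u z = complex.Re (w - z) * real_dir_derive u 1 x +
                complex.Im (w - z) * real_dir_derive u 'i y].
Proof.
move=> Cu HU zr wr.
have wz : normc (w - z) <= 2 * r.
  apply: le_trans (normc_triangle _ c _) _; rewrite [normc (c - z)]normcB.
  by rewrite mulr_natl mulr2n lerD.
set a := complex.Re (w - z); set b := complex.Im (w - z).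
have ha : `|a| <= 2 * r by apply: le_trans (ler_Re_normc _) wz.
have hb : `|b| <= 2 * r by apply: le_trans (ler_Im_normc _) wz.
have B1 s : `|s| <= `|a| -> normc (real_line z 1 s - c) <= 3 * r.
  move=> sa; apply: le_trans (normc_triangle _ z _) _.
  by rewrite normc_line1; lra.
have r0 : 0 <= r by apply: le_trans zr; exact: normc_ge0.
have B2 s : `|s| <= `|b| -> normc (real_line (real_line z 1 a) 'i s - c) <= 5 * r.
  move=> sb; apply: le_trans (normc_triangle _ (real_line z 1 a) _) _.
  by rewrite normc_linei; have := B1 a (lexx _); lra.
have U1 (s : R) : `|s| <= `|a| -> U (real_line z 1 s).
  by move=> /B1 H; apply: HU; apply: le_trans H _; rewrite ler_wpM2r// ler_nat.
have U2 (s : R) : `|s| <= `|b| -> U (real_line (real_line z 1 a) 'i s).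
  by move=> /B2; exact: HU.
have [s sa E1] := mvt_line Cu (or_introl erefl) U1.
have [s' sb E2] := mvt_line Cu (or_intror erefl) U2.
exists (real_line z 1 s), (real_line (real_line z 1 a) 'i s'); split.
- by apply: le_trans (B1 _ sa) _; rewrite ler_wpM2r// ler_nat.
- exact: B2.
by rewrite {1}(complex_line w z) -/a -/b -E1 -E2 [RHS]addrC addrA subrK.
Qed.


Lemma Ck1_lipschitz U u c : open U -> Ck 1 U u -> U c ->
  exists r L : R, [/\ 0 < r, 0 <= L &
    forall z w, normc (z - c) <= r -> normc (w - c) <= r ->
      `|u w - u z| <= L * normc (w - z)].
Proof.
move=> oU Cu Uc; have Cd v (hv : v = 1 \/ v = 'i) : exists2 r : R, 0 < r &
    forall x, normc (x - c) < r -> U x /\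
      `|real_dir_derive u v x - real_dir_derive u v c| < 1.
  have [_ [C0 _]] := (proj2 Cu) v hv; have cv := C0 _ Uc.
  move/cvg_realP: cv => /(_ _ ltr01) cv.
  apply/nbhs_complexP; apply: filterS2 cv (open_nbhs_nbhs (conj oU Uc)).
  by move=> x h1 h2; split.
have [r1 r10 H1] := Cd _ (or_introl erefl).
have [r2 r20 H2] := Cd _ (or_intror erefl).
set A := real_dir_derive u 1 c in H1; set B := real_dir_derive u 'i c in H2.
have m0 : 0 < Num.min r1 r2 by rewrite lt_min r10.
(* The corner path stays within 5 times the radius, and 6 leaves the strict inequality that [H1] and
   [H2] ask for. The second witness bounds the sum of the two partial derivatives near [c]. *)
exists (Num.min r1 r2 / 6), (`|A| + 1 + (`|B| + 1)); split.
- by rewrite divr_gt0.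
- by rewrite !addr_ge0.
move=> z w zr wr.
have HU x : normc (x - c) <= 5 * (Num.min r1 r2 / 6) ->
    normc (x - c) < r1 /\ normc (x - c) < r2.
  by move=> h; apply/andP; rewrite -lt_min; apply: le_lt_trans h _; lra.
have HU' x : normc (x - c) <= 5 * (Num.min r1 r2 / 6) -> U x by move=> /HU[/H1[]].
have [x [y [hx hy ->]]] := mvt_corner Cu HU' zr wr.
apply: le_trans (ler_normD _ _) _; rewrite mulrDl !normrM; apply: lerD.
  rewrite mulrC ler_pM//; last exact: ler_Re_normc.
  have [/H1[_ h] _] := HU x hx.
  by have := ler_normD (real_dir_derive u 1 x - A) A; rewrite subrK; lra.
rewrite mulrC ler_pM//; last exact: ler_Im_normc.
have [_ /H2[_ h]] := HU y hy.
by have := ler_normD (real_dir_derive u 'i y - B) B; rewrite subrK; lra.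
Qed.

(** The increment is evaluated by the partial derivatives at points of a corner path, where by
    continuity they are within [e / 2] of their values at [c]. *)
Lemma Ck1_diff U u c (e : R) : open U -> Ck 1 U u -> U c -> 0 < e ->
  exists2 r : R, 0 < r & forall h, normc h < r ->
    `|u (c + h) - u c - (complex.Re h * real_dir_derive u 1 c +
                         complex.Im h * real_dir_derive u 'i c)|
      <= e * normc h.
Proof.
move=> oU Cu Uc e0; have e20 : 0 < e / 2 by rewrite divr_gt0.
have Cd v (hv : v = 1 \/ v = 'i) : exists2 r : R, 0 < r &
    forall x, normc (x - c) < r -> U x /\
      `|real_dir_derive u v x - real_dir_derive u v c| < e / 2.
  have [_ [C0 _]] := (proj2 Cu) v hv; have cv := C0 _ Uc.
  move/cvg_realP: cv => /(_ _ e20) cv.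
  apply/nbhs_complexP; apply: filterS2 cv (open_nbhs_nbhs (conj oU Uc)).
  by move=> x h1 h2; split.
have [r1 r10 H1] := Cd _ (or_introl erefl).
have [r2 r20 H2] := Cd _ (or_intror erefl).
have m0 : 0 < Num.min r1 r2 by rewrite lt_min r10.
exists (Num.min r1 r2 / 6); first by rewrite divr_gt0.
move=> h hr.
have HU x : normc (x - c) <= 5 * (Num.min r1 r2 / 6) ->
    normc (x - c) < r1 /\ normc (x - c) < r2.
  by move=> k; apply/andP; rewrite -lt_min; apply: le_lt_trans k _; lra.
have HU' x : normc (x - c) <= 5 * (Num.min r1 r2 / 6) -> U x by move=> /HU[/H1[]].
have c1 : normc (c - c) <= Num.min r1 r2 / 6 by rewrite subrr normc0; lra.
have c2 : normc (c + h - c) <= Num.min r1 r2 / 6.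
  by rewrite addrAC subrr add0r ltW.
have [x [y [hx hy]]] := mvt_corner Cu HU' c1 c2.
rewrite [c + h - c]addrAC subrr add0r => ->.
rewrite opprD addrACA -!mulrBr.
have [/H1[_ h1] _] := HU x hx; have [_ /H2[_ h2]] := HU y hy.
apply: le_trans (ler_normD _ _) _; rewrite [e]splitr mulrDl !normrM.
by apply: lerD; rewrite mulrC; apply: ler_pM;
  rewrite ?normr_ge0 ?ler_Re_normc ?ler_Im_normc// ltW.
Qed.

(** Complex differentiability in little-o form with real radii, ready to be composed with
    [Ck1_diff]. *)
Definition cderiv (tau : C -> C) (z d : C) : Prop :=
  forall e : R, 0 < e -> exists2 r : R, 0 < r & forall h, normc h < r ->
    normc (tau (z + h) - tau z - d * h) <= e * normc h.

Lemma cderiv_id z : cderiv id z 1.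
Proof.
move=> e e0; exists 1 => // h _.
rewrite (_ : _ - _ = 0) ?normc0 ?mulr_ge0 ?normc_ge0 ?(ltW e0)// /=; ring.
Qed.

Lemma derivable_cderiv (tau : C -> C) z :
  derivable tau z 1 -> cderiv tau z ('D_1 tau z).
Proof.
move=> dt e e0; move: dt; rewrite /derivable -/(derive tau z 1) => /cvg_complexP.
move=> /(_ _ e0); set D := 'D_1 tau z => H.
have /nbhs_complexP[r r0 Hr] : nbhs (0 : C) (fun h : C => h != 0 ->
   normc (h^-1 *: ((tau \o shift z) (h *: 1) - tau z) - D) < e) by exact: H.
exists r => // h hr; have [->|h0] := eqVneq h 0.
  by rewrite addr0 mulr0 subrr subr0 normc0 mulr0.
have {Hr} := Hr h; rewrite subr0 => /(_ hr h0) /= /ltW.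
rewrite -[h *: 1]/(h * 1) -[_ *: _]/(h^-1 * _) mulr1 [h + z]addrC.
rewrite -(ler_pM2r (_ : 0 < normc h)) ?normc_gt0// -normcM mulrBl.
by rewrite mulrAC mulVf// mul1r.
Qed.

Lemma cderiv_continuous (tau : C -> C) z d :
  cderiv tau z d -> {for z, continuous tau}.
Proof.
move=> H; apply/continuous_complexP => e e0; have [r r0 Hr] := H 1 ltr01.
set K := 1 + normc d + 1; have K0 : 0 < K.
  by rewrite /K ltr_wpDl// addr_ge0// normc_ge0.
apply/nbhs_complexP; exists (Num.min r (e / K)).
  by rewrite lt_min r0 divr_gt0.
move=> w; rewrite lt_min => /andP[wr we].
have := Hr _ wr; rewrite [z + _]addrC subrK mul1r => h.
have : normc (tau w - tau z) <= normc (tau w - tau z - d * (w - z)) + normc (d * (w - z)).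
  by apply: le_trans (le_normcD _ _); rewrite subrK.
rewrite normcM => h'; move: we; rewrite ltr_pdivlMr// /K !mulrDr mulr1.
have := normc_ge0 (w - z); have := normc_ge0 d; nra.
Qed.

Lemma is_derive_comp_cderiv U u (tau : C -> C) z d v : open U -> Ck 1 U u ->
  U (tau z) -> cderiv tau z d ->
  is_derive (0 : R) (1 : R) ((u \o tau) \o real_line z v)
    (complex.Re (d * v) * real_dir_derive u 1 (tau z) +
     complex.Im (d * v) * real_dir_derive u 'i (tau z)).
Proof.
move=> oU Cu Utz dtau; apply: is_derive_eps => e e0.
set A := real_dir_derive u 1 (tau z); set B := real_dir_derive u 'i (tau z).
set nd := normc d; set nv := normc v.
have nd0 : 0 <= nd by exact: normc_ge0.
have nv0 : 0 <= nv by exact: normc_ge0.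
have AB0 : 0 <= `|A| + `|B| by rewrite addr_ge0.
(* The error has two parts: that of [u] on the increment [k] of [tau], at most [e2 |k|], and the
   differential of [u] applied to the error of [tau], at most [e1 |h| (|A| + |B|)]. The constants
   make each of them at most [(e / 2) |t|]; the bound [e1 <= 1] gives [|k| <= (nd + 1) |h|]. *)
pose e2 := e / (2 * (nd + 1) * (nv + 1)).
pose e1 := Num.min 1 (e / (2 * (`|A| + `|B| + 1) * (nv + 1))).
have e20 : 0 < e2 by rewrite divr_gt0// !mulr_gt0// ltr_wpDl.
have e10 : 0 < e1.
  by rewrite lt_min ltr01/= divr_gt0// !mulr_gt0// ltr_wpDl.
have e11 : e1 <= 1 by rewrite ge_min lexx.
have e2E : e2 * ((nd + 1) * (nv + 1)) = e / 2.
  by rewrite /e2; field; rewrite !gt_eqF// ltr_wpDl.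
have e1E : e1 * ((`|A| + `|B| + 1) * (nv + 1)) <= e / 2.
  have -> : e / 2 = e / (2 * (`|A| + `|B| + 1) * (nv + 1)) *
      ((`|A| + `|B| + 1) * (nv + 1)).
    by field; rewrite !gt_eqF// ltr_wpDl.
  rewrite ler_wpM2r ?mulr_ge0 ?addr_ge0//.
  by rewrite ge_min lexx orbT.
have [r2 r20 H2] := Ck1_diff oU Cu Utz e20.
have [r1 r10 H1] := dtau _ e10.
pose V := nv + 1; have V0 : 0 < V by rewrite ltr_wpDl.
pose D := (nd + 1) * V; have D0 : 0 < D by rewrite mulr_gt0// ltr_wpDl.
exists (Num.min (r1 / V) (r2 / D)).
  by rewrite lt_min !divr_gt0.
move=> t; rewrite lt_min !ltr_pdivlMr// => /andP[t1 t2].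
set h : C := t%:C * v; have hE : normc h = `|t| * nv by rewrite normcM normcR.
have hr1 : normc h < r1.
  by apply: le_lt_trans t1; rewrite hE ler_wpM2l// lerDl.
have {H1} := H1 _ hr1; set k := tau (z + h) - tau z => Hk.
have t0 : 0 <= `|t| by [].
have kle : normc k <= (nd + 1) * normc h.
  have := normc_ge0 h.
  have : normc k <= normc (k - d * h) + normc (d * h).
    by apply: le_trans (le_normcD _ _); rewrite subrK.
  rewrite [normc (d * h)]normcM -/nd; nra.
have kr2 : normc k < r2.
  apply: le_lt_trans kle _; apply: le_lt_trans t2.
  rewrite hE mulrCA ler_wpM2l// ler_wpM2l ?addr_ge0//.
  by rewrite lerDl.
have {H2} := H2 _ kr2; rewrite /k [tau z + _]addrC subrK -/k -/A -/B => H2.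
rewrite add0r /= real_line0 /real_line -/h.
set T := (X in `|X| <= _).
have -> : T = (u (tau (z + h)) - u (tau z) -
    (complex.Re k * A + complex.Im k * B)) +
    (complex.Re (k - d * h) * A + complex.Im (k - d * h) * B).
  have -> : complex.Re (k - d * h) = complex.Re k - t * complex.Re (d * v).
    by rewrite raddfB /h mulrCA; case: (d * v) => d1 d2 /=; ring.
  have -> : complex.Im (k - d * h) = complex.Im k - t * complex.Im (d * v).
    by rewrite raddfB /h mulrCA; case: (d * v) => d1 d2 /=; ring.
  rewrite /T; ring.
apply: le_trans (ler_normD _ _) _.
have [aR aI] := (ler_Re_normc (k - d * h), ler_Im_normc (k - d * h)).
have Q : `|complex.Re (k - d * h) * A + complex.Im (k - d * h) * B| <=
    normc (k - d * h) * (`|A| + `|B|).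
  rewrite mulrDr; apply: le_trans (ler_normD _ _) _; rewrite !normrM.
  by apply: lerD; rewrite ler_wpM2r.
have Q1 : normc (k - d * h) * (`|A| + `|B|) <= (e / 2) * `|t|.
  apply: (@le_trans _ _ ((e1 * ((`|A| + `|B| + 1) * (nv + 1))) * `|t|)); last first.
    by rewrite ler_wpM2r.
  have -> : e1 * ((`|A| + `|B| + 1) * (nv + 1)) * `|t| =
    (e1 * (`|t| * (nv + 1))) * (`|A| + `|B| + 1) by ring.
  apply: ler_pM => //; [exact: normc_ge0| |by rewrite lerDl].
  apply: le_trans Hk _; rewrite hE ler_wpM2l ?(ltW e10)// ler_wpM2l//.
  by rewrite lerDl.
have Q2 : e2 * normc k <= (e / 2) * `|t|.
  rewrite -e2E -mulrA ler_wpM2l ?(ltW e20)//; apply: le_trans kle _.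
  rewrite hE -mulrA ler_wpM2l ?addr_ge0// mulrC ler_wpM2r// lerDl//.
by rewrite [e]splitr mulrDl; apply: lerD; [exact: le_trans H2 Q2|exact: le_trans Q Q1].
Qed.

End Differentiability.

(** * Complex-valued functions of class C^k *)

Section ComplexCk.
Variable R : realType.
Local Notation C := R[i].
Implicit Types (h g : C -> C) (u : C -> R) (z v : C) (U V : set C).

Definition CC (n : nat) U h : Prop :=
  Ck n U (fun z => complex.Re (h z)) /\ Ck n U (fun z => complex.Im (h z)).

Definition cpd v h z : C :=
  real_dir_derive (fun w => complex.Re (h w)) v z
    +i* real_dir_derive (fun w => complex.Im (h w)) v z.

Lemma CC_continuous n U h z : CC n U h -> U z -> {for z, continuous h}.
Proof.
move=> [/Ck_continuous cR /Ck_continuous cI] Uz.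
have := cvg_complex (nbhs_filter z) (cR _ Uz) (cI _ Uz).
rewrite (_ : (fun t => _) = h); last by apply/funext => t; case: (h t).
by rewrite /prop_for /continuous_at; case: (h z).
Qed.

Lemma CC_congr n U h g : open U -> (forall z, U z -> h z = g z) ->
  CC n U h -> CC n U g.
Proof.
by move=> oU E [hR hI]; split; [apply: Ck_congr hR|apply: Ck_congr hI] => // z /E->.
Qed.

Lemma CC_sub n U V h : V `<=` U -> CC n U h -> CC n V h.
Proof. by move=> VU [hR hI]; split; [exact: Ck_sub hR|exact: Ck_sub hI]. Qed.

Lemma CC_local n U h :
  (forall z, U z -> exists2 V, V z & CC n V h) -> CC n U h.
Proof.
by move=> H; split; apply: Ck_local => z /H[V Vz [hR hI]]; exists V.
Qed.

Lemma CC_cst n U (a : C) : open U -> CC n U (fun=> a).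
Proof. by move=> oU; split; exact: Ck_cst. Qed.

Lemma CC_real n U u : open U -> Ck n U u -> CC n U (fun z => (u z)%:C).
Proof. by move=> oU Cu; split => //=; exact: Ck_cst. Qed.

Lemma Re_real_line z v (t : R) :
  complex.Re (real_line z v t) = complex.Re z + t * complex.Re v.
Proof. by case: z v => [a b] [c d] /=; ring. Qed.

Lemma Im_real_line z v (t : R) :
  complex.Im (real_line z v t) = complex.Im z + t * complex.Im v.
Proof. by case: z v => [a b] [c d] /=; ring. Qed.

Lemma CC_id n U : open U -> CC n U (fun z => z).
Proof.
move=> oU; have cid z : (fun w : C => w) @ z --> z by exact: cvg_id.
split; apply: Ck_linear => //; try exact: Re_real_line; try exact: Im_real_line.
- by move=> z; exact: cvg_Re (cid z).
- by move=> z; exact: cvg_Im (cid z).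
Qed.

Lemma real_dir_derive_Re v z : real_dir_derive (@complex.Re R) v z = complex.Re v.
Proof.
have [_ <-] := is_derive_linear z v Re_real_line.
by rewrite /real_dir_derive derive1E.
Qed.

Lemma real_dir_derive_Im v z : real_dir_derive (@complex.Im R) v z = complex.Im v.
Proof.
have [_ <-] := is_derive_linear z v Im_real_line.
by rewrite /real_dir_derive derive1E.
Qed.

Section OpenSet.
Variables (n : nat) (U : set C).
Hypothesis oU : open U.

Lemma CCD h g : CC n U h -> CC n U g -> CC n U (fun z => h z + g z).
Proof.
move=> [hR hI] [gR gI]; split.
  by apply: Ck_congr (CkD oU hR gR) => // z _; rewrite raddfD.
by apply: Ck_congr (CkD oU hI gI) => // z _; rewrite raddfD.
Qed.

Lemma CCN h : CC n U h -> CC n U (fun z => - h z).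
Proof.
move=> [hR hI]; split.
  by apply: Ck_congr (CkN oU hR) => // z _; rewrite raddfN.
by apply: Ck_congr (CkN oU hI) => // z _; rewrite raddfN.
Qed.

Lemma CCB h g : CC n U h -> CC n U g -> CC n U (fun z => h z - g z).
Proof. by move=> Ch Cg; apply: CCD => //; exact: CCN. Qed.

Lemma CCM h g : CC n U h -> CC n U g -> CC n U (fun z => h z * g z).
Proof.
move=> [hR hI] [gR gI]; split.
  apply: Ck_congr (CkD oU (CkM oU hR gR) (CkN oU (CkM oU hI gI))) => // z _.
  by case: (h z) (g z) => [a b] [c d].
apply: Ck_congr (CkD oU (CkM oU hR gI) (CkM oU hI gR)) => // z _.
by case: (h z) (g z) => [a b] [c d].
Qed.

Lemma CC_conj h : CC n U h -> CC n U (fun z => (h z)^*).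
Proof.
move=> [hR hI]; split.
  by apply: Ck_congr hR => // z _; case: (h z).
by apply: Ck_congr (CkN oU hI) => // z _; case: (h z).
Qed.

Lemma CC_normc2 h : CC n U h -> Ck n U (fun z => normc (h z) ^+ 2).
Proof.
move=> [hR hI]; apply: Ck_congr (CkD oU (CkM oU hR hR) (CkM oU hI hI)) => // z _.
by case: (h z) => a b /=; rewrite sqr_sqrtr ?expr2// addr_ge0// -expr2 sqr_ge0.
Qed.

Lemma CCV h : (forall z, U z -> h z != 0) -> CC n U h ->
  CC n U (fun z => (h z)^-1).
Proof.
move=> h0 Ch; have Cn := CC_normc2 Ch.
have n0 z : U z -> normc (h z) ^+ 2 != 0.
  by move=> /h0; rewrite -normc_eq0 => ?; exact: expf_neq0.
have H := CCM (CC_real oU (CkV oU n0 Cn)) (CC_conj Ch).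
apply: CC_congr H => // z Uz; rewrite invc_norm normcC.
by rewrite fmorphV rmorphXn.
Qed.

Lemma CC_sum (I : finType) (h : I -> C -> C) :
  (forall i, CC n U (h i)) -> CC n U (fun z => \sum_i h i z).
Proof.
move=> Ch; apply: (@CC_congr _ _ (fun z => (\sum_i h i) z)) => //.
  by move=> z _; rewrite fct_sumE.
elim/big_ind: _ => [|a b Ca Cb|i _]; [exact: CC_cst|exact: CCD|exact: Ch].
Qed.

End OpenSet.

Lemma CC_cpd n U h v : v = 1 \/ v = 'i -> CC n.+1 U h -> CC n U (cpd v h).
Proof.
by move=> hv [[_ hR] [_ hI]]; split; [have [_] := hR v hv|have [_] := hI v hv].
Qed.

(** Only orders below [n] are asked of [dtau]: in [transition_CC_local] the known regularity of the
    derivative lags one order behind that of [tau]. *)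
Lemma Ck_comp_cderiv n U V u (tau dtau : C -> C) : open U -> open V ->
  (forall z, U z -> V (tau z)) -> (forall z, U z -> cderiv tau z (dtau z)) ->
  (forall m, (m < n)%N -> CC m U dtau) ->
  Ck n V u -> Ck n U (u \o tau).
Proof.
move=> oU oV UV dt; elim: n u => [|n IH] u Cdt Cu.
  split=> // z Uz; apply: continuous_comp; first exact: cderiv_continuous (dt _ Uz).
  exact: Ck_continuous Cu (UV _ Uz).
apply/(CkSP _ _ oU); split=> [z Uz|v hv].
  apply: continuous_comp; first exact: cderiv_continuous (dt _ Uz).
  exact: Ck_continuous Cu (UV _ Uz).
exists (fun z => complex.Re (dtau z * v) * real_dir_derive u 1 (tau z) +
     complex.Im (dtau z * v) * real_dir_derive u 'i (tau z)).
  move=> z Uz; apply: (@is_derive_comp_cderiv R V) (dt _ Uz) => //.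
    exact: Ck_le Cu.
  exact: UV.
have [dR dI] := CCM oU (Cdt n (leqnn _)) (CC_cst n v oU).
have IH' w : w = 1 \/ w = 'i -> Ck n U (real_dir_derive u w \o tau).
  move=> hw; apply: IH; first by move=> m mn; apply: Cdt; rewrite ltnS ltnW.
  by have [_] := (proj2 Cu) w hw.
apply: (CkD oU (CkM oU dR _) (CkM oU dI _)).
  by apply: IH'; left.
by apply: IH'; right.
Qed.

Lemma CC_comp_cderiv n U V h (tau dtau : C -> C) : open U -> open V ->
  (forall z, U z -> V (tau z)) -> (forall z, U z -> cderiv tau z (dtau z)) ->
  (forall m, (m < n)%N -> CC m U dtau) ->
  CC n V h -> CC n U (h \o tau).
Proof.
move=> oU oV UV dt Cdt [hR hI]; split; first exact: (Ck_comp_cderiv oU oV UV dt Cdt hR).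
exact: (Ck_comp_cderiv oU oV UV dt Cdt hI).
Qed.

(** The chain rule with the coordinate functions Re and Im in the role of [u] identifies the
    derivative of [tau] in the direction [v] with [dtau z * v]. *)
Lemma CC_of_cderiv n U (tau dtau : C -> C) : open U ->
  (forall z, U z -> cderiv tau z (dtau z)) -> CC n U dtau -> CC n.+1 U tau.
Proof.
move=> oU dt Cdt; have Cid := CC_id 1 (@openT C).
have H v z : U z ->
    is_derive (0 : R) (1 : R) (@complex.Re R \o tau \o real_line z v) (complex.Re (dtau z * v)) /\
    is_derive (0 : R) (1 : R) (@complex.Im R \o tau \o real_line z v) (complex.Im (dtau z * v)).
  move=> Uz; split.
    have := is_derive_comp_cderiv v openT (proj1 Cid) I (dt _ Uz).
    by rewrite !real_dir_derive_Re /= mulr1 mulr0 addr0.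
  have := is_derive_comp_cderiv v openT (proj2 Cid) I (dt _ Uz).
  by rewrite !real_dir_derive_Im /= mulr1 mulr0 add0r.
split; apply/(CkSP _ _ oU); split.
- by move=> z /dt/cderiv_continuous ct; exact: (cvg_Re (nbhs_filter z) ct).
- move=> v _; exists (fun z => complex.Re (dtau z * v)).
    by move=> z /(H v)[].
  by have [] := CCM oU Cdt (CC_cst n v oU).
- by move=> z /dt/cderiv_continuous ct; exact: (cvg_Im (nbhs_filter z) ct).
- move=> v _; exists (fun z => complex.Im (dtau z * v)).
    by move=> z /(H v)[].
  by have [] := CCM oU Cdt (CC_cst n v oU).
Qed.

End ComplexCk.

(** * Vectors, lines and charts *)

Section Vectors.
Variable R : realType.
Local Notation C := R[i].

(** Bridges two conjugations: [dotmx] is built on [Num.conj], the smoothness lemmas on [conjc]. *)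
Lemma conjCc (z : C) : Num.conj z = z^*.
Proof.
have [->|z0] := eqVneq z 0; first by rewrite rmorph0 conjc0.
by apply: (mulfI z0); rewrite -normCK sqr_normc.
Qed.

Lemma dotmxsum n (u v : 'rV[C]_n) : dotmx u v = \sum_k u 0 k * conjc (v 0 k).
Proof.
by rewrite dotmxE mxE; apply: eq_bigr => k _; rewrite !mxE conjCc.
Qed.

Lemma dotmx_lin n (a b : C) (u v w : 'rV[C]_n) :
  dotmx (a *: u + b *: v) w = a * dotmx u w + b * dotmx v w.
Proof.
rewrite !dotmxsum !mulr_sumr -big_split /=; apply: eq_bigr => k _.
by rewrite !mxE; ring.
Qed.

Lemma horizontal_lin (a b : C) (z u v : 'rV[C]_3) :
  horizontal z (a *: u + b *: v) = a *: horizontal z u + b *: horizontal z v.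
Proof.
rewrite /horizontal dotmx_lin.
move: (dotmx u z) (dotmx v z) (dotmx z z)^-1 => x y t.
by rewrite !scalerBr !scalerA mulrDl scalerDl opprD addrACA !mulrA.
Qed.

Lemma fubini_study_lin (a b : R) (z u v w : 'rV[C]_3) :
  fubini_study z (a%:C *: u + b%:C *: v) w =
  a * fubini_study z u w + b * fubini_study z v w.
Proof.
have E (x y t : C) : complex.Re ((a%:C * x + b%:C * y) * t) =
    a * complex.Re (x * t) + b * complex.Re (y * t).
  by rewrite mulrDl -!mulrA; case: (x * t) (y * t) => [x1 x2] [y1 y2] /=; ring.
by rewrite /fubini_study horizontal_lin dotmx_lin E.
Qed.

Lemma dotmx_neq0 n (u : 'rV[C]_n) : u != 0 -> dotmx u u != 0.
Proof. by move=> u0; rewrite gt_eqF// dotmx_is_dotmx. Qed.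

Lemma affine_coordE (j : 'I_3) (L : CP2 R) : affine_dom j L -> affine_coord j L 0 j = 1.
Proof. by move=> Lj; rewrite /affine_coord mxE mulVf. Qed.

Lemma line_vector_neq0 (L : CP2 R) : line_vector L != 0.
Proof. by rewrite /line_vector vpick0 -dimv_eq0 (eqP (valP L)). Qed.

Lemma line_vector_mem (L : CP2 R) : line_vector L \in val L.
Proof. exact: memv_pick. Qed.

Lemma affine_coord_mem (j : 'I_3) (L : CP2 R) : affine_coord j L \in val L.
Proof. by rewrite memvZ// line_vector_mem. Qed.

Lemma CP2_line (L : CP2 R) (v : 'rV[C]_3) : v \in val L -> v != 0 ->
  (val L = <[v]>)%VS.
Proof.
move=> vL v0; apply/esym/eqP.
by rewrite eqEdim dim_vline v0 (eqP (valP L)) leqnn andbT -memvE.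
Qed.

Lemma mem_line_affine (j : 'I_3) (L : CP2 R) (v : 'rV[C]_3) :
  affine_dom j L -> v \in val L -> v = v 0 j *: affine_coord j L.
Proof.
move=> Lj; have a0 : affine_coord j L != 0.
  apply: contraTneq isT => /(congr1 (fun m : 'rV_3 => m 0 j)).
  by rewrite affine_coordE// mxE => /eqP; rewrite oner_eq0.
rewrite (CP2_line (affine_coord_mem j L) a0) => /vlineP[k ->].
by rewrite mxE affine_coordE// mulr1.
Qed.

Lemma affine_dom_ex (L : CP2 R) : exists j : 'I_3, affine_dom j L.
Proof.
apply: contrapT => H; have /negP := line_vector_neq0 L; apply; apply/eqP/rowP => j.
rewrite mxE; apply/eqP/negPn/negP => Lj; apply: H; by exists j.
Qed.

End Vectors.

Section ChartTopology.
Variables (R : realType) (T : topologicalType) (c : chart R T).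

Lemma chart_image_open (W : set T) : open W ->
  open (chart_map c @` (W `&` chart_dom c)).
Proof.
move=> oW; rewrite openE => _ [p [Wp cp] <-]; rewrite /interior.
have zc : (chart_map c @` chart_dom c) (chart_map c p) by exists p.
have H1 := open_nbhs_nbhs (conj (@chart_map_open _ _ c) zc).
have H2 : \forall z \near chart_map c p, W (chart_inv c z).
  apply: (chart_inv_continuous zc).
  by rewrite chart_mapK//; exact: open_nbhs_nbhs.
apply: filterS2 H1 H2 => _ [q cq <-].
by rewrite chart_mapK// => Wq; exists q.
Qed.

End ChartTopology.

Section VectorCk.
Variable R : realType.
Local Notation C := R[i].

Definition vCC (n m : nat) (U : set C) (A : C -> 'rV[C]_m) : Prop :=
  forall k, CC n U (fun z => A z 0 k).

Variables (n : nat) (U : set C).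
Hypothesis oU : open U.

Lemma CC_dotmx m (A B : C -> 'rV[C]_m) : vCC n U A -> vCC n U B ->
  CC n U (fun z => dotmx (A z) (B z)).
Proof.
move=> CA CB; apply: (@CC_congr _ _ _ (fun z => \sum_k A z 0 k * conjc (B z 0 k))) => //.
  by move=> z _; rewrite dotmxsum.
apply: CC_sum => // k; have H := CCM oU (CA k) (CC_conj oU (CB k)); exact: H.
Qed.

Lemma vCC_horizontal (A B : C -> 'rV[C]_3) : (forall z, U z -> A z != 0) ->
  vCC n U A -> vCC n U B -> vCC n U (fun z => horizontal (A z) (B z)).
Proof.
move=> A0 CA CB k.
have CV : CC n U (fun z => (dotmx (A z) (A z))^-1).
  have A00 z : U z -> dotmx (A z) (A z) != 0 by move=> /A0/dotmx_neq0.
  have H := CCV oU A00 (CC_dotmx CA CA); exact: H.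
have H := CCB oU (CB k) (CCM oU (CCM oU (CC_dotmx CB CA) CV) (CA k)).
by apply: CC_congr oU _ H => z _; rewrite /horizontal !mxE.
Qed.

Lemma Ck_fubini_study (A B D : C -> 'rV[C]_3) : (forall z, U z -> A z != 0) ->
  vCC n U A -> vCC n U B -> vCC n U D ->
  Ck n U (fun z => fubini_study (A z) (B z) (D z)).
Proof.
move=> A0 CA CB CD.
have CV : CC n U (fun z => (dotmx (A z) (A z))^-1).
  have A00 z : U z -> dotmx (A z) (A z) != 0 by move=> /A0/dotmx_neq0.
  have H := CCV oU A00 (CC_dotmx CA CA); exact: H.
have [H _] := CCM oU (CC_dotmx (vCC_horizontal A0 CA CB) (vCC_horizontal A0 CA CD)) CV.
exact: H.
Qed.

Lemma vCC_real_diff m (F : C -> 'rV[C]_m) v : v = 1 \/ v = 'i ->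
  vCC n.+1 U F -> vCC n U (fun z => real_diff F z v).
Proof.
move=> hv CF k; apply: CC_congr oU _ (CC_cpd hv (CF k)) => z _.
by rewrite mxE.
Qed.

End VectorCk.

Lemma real_diff_comp (R : realType) (m : nat) (U V : set R[i])
    (F G : R[i] -> 'rV[R[i]]_m) (tau : R[i] -> R[i]) (z d v : R[i]) :
  open U -> open V -> vCC 1 V F -> U z -> V (tau z) -> cderiv tau z d ->
  (forall w, U w -> G w = F (tau w)) ->
  real_diff G z v = (complex.Re (d * v))%:C *: real_diff F (tau z) 1
                  + (complex.Im (d * v))%:C *: real_diff F (tau z) 'i.
Proof.
move=> oU oV CF Uz Vz dt GF; apply/rowP => k; rewrite !mxE.
have D (u : R[i] -> R) (g : R[i] -> R) : (forall w, U w -> g w = u (tau w)) -> Ck 1 V u ->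
  real_dir_derive g v z = complex.Re (d * v) * real_dir_derive u 1 (tau z) +
     complex.Im (d * v) * real_dir_derive u 'i (tau z).
  move=> gu Cu; have H := is_derive_comp_cderiv v oV Cu Vz dt.
  have [|_ <-] := @near_eq_is_derive _ _ _ _ (g \o real_line z v) _ _ _ _ H.
    by apply: filterS (near_real_line v oU Uz) => t /gu.
  by rewrite /real_dir_derive derive1E.
have [FR FI] := CF k.
rewrite (D (fun w => complex.Re (F w 0 k))) //; last by move=> w /GF->.
rewrite (D (fun w => complex.Im (F w 0 k))) //; last by move=> w /GF->.
by apply/eqP; rewrite eq_complex /=; apply/andP; split; apply/eqP; ring.
Qed.

(** * Smoothness of the transition maps *)

Section Transition.
Variables (R : realType) (M : riemannSurface R) (f : M -> CP2 R).
Hypothesis fC : conformal_immersion f.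
Local Notation C := R[i].

Lemma smooth_affine j c n : @atlas R M c ->
  vCC n (chart_map c @` (f @^-1` affine_dom j `&` chart_dom c))
    (affine_coord j \o f \o chart_inv c).
Proof. by move=> ac k; have [H _ _] := fC; have [_ S] := H j; exact: S c ac k n. Qed.

Lemma open_affine j : open (f @^-1` affine_dom (R := R) j).
Proof. by have [H _ _] := fC; have [] := H j. Qed.

Lemma affine_coord_neq0 j (L : CP2 R) : affine_dom j L -> affine_coord j L != 0.
Proof.
move=> Lj; apply/eqP => /(congr1 (fun m : 'rV_3 => m 0 j)).
by rewrite affine_coordE// mxE => /eqP; rewrite oner_eq0.
Qed.

(* By conformality the derivative [tau'] of a transition map can be read off
   from the differentials of f in both charts: [df_c(1) = df_d(tau')] gives
   [Re tau' = <df_c(1), df_d(1)> / |df_d(1)|^2] and similarly for [Im tau'], so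
   that smoothness of [tau] of order n improves to order n + 1. *)
Lemma transition_CC_local n c d p : @atlas R M c -> @atlas R M d ->
  chart_dom c p -> chart_dom d p ->
  exists2 U : set C, open U /\ U (chart_map c p) &
    CC n U (chart_map d \o chart_inv c).
Proof.
move=> ac ad cp dp; have [j fpj] := affine_dom_ex (f p).
pose W := f @^-1` affine_dom j `&` chart_dom d.
have oW : open W by apply: openI; [exact: open_affine|exact: chart_dom_open].
pose U := chart_map c @` (W `&` chart_dom c).
pose V := chart_map d @` (f @^-1` affine_dom j `&` chart_dom d).
have oU : open U by exact: chart_image_open.
have oV : open V by apply: chart_image_open; exact: open_affine.
set tau := chart_map d \o chart_inv c.
have UV z : U z -> V (tau z).
  by move=> [q [[fq dq] cq] <-]; exists q => //; rewrite /tau /= chart_mapK.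
pose dtau z := 'D_1 tau z.
have dt z : U z -> cderiv tau z (dtau z).
  move=> [q [[fq dq] cq] <-]; apply: derivable_cderiv.
  exact: atlas_holomorphic.
pose Fc := affine_coord j \o f \o chart_inv c.
pose Fd := affine_coord j \o f \o chart_inv d.
have CFc m : vCC m U Fc.
  move=> k; apply: CC_sub (smooth_affine j m ac k).
  by move=> _ [q [[fq dq] cq] <-]; exists q.
have CFd m : vCC m V Fd := smooth_affine j m ad.
have FcE z : U z -> Fc z = Fd (tau z).
  by move=> [q [[fq dq] cq] <-]; rewrite /Fc /Fd /tau /= !chart_mapK.
have Fc0 z : U z -> Fc z != 0.
  move=> [q [[fq dq] cq] <-]; rewrite /Fc /= chart_mapK//.
  exact: affine_coord_neq0.
pose N1 z := fubini_study (Fc z) (real_diff Fc z 1) (real_diff Fd (tau z) 1).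
pose N2 z := fubini_study (Fc z) (real_diff Fc z 1) (real_diff Fd (tau z) 'i).
pose L z := fubini_study (Fc z) (real_diff Fd (tau z) 1) (real_diff Fd (tau z) 1).
have key z : U z -> 0 < L z /\ dtau z = (N1 z / L z) +i* (N2 z / L z).
  move=> Uz; have := real_diff_comp 1 oU oV (CFd 1%N) Uz (UV _ Uz) (dt _ Uz) FcE.
  rewrite mulr1 => E.
  have [q [[fq dq] cq] qz] := Uz.
  have [_ _ /(_ q d j)[//|l l0 H]] := fC.
  have tq : tau z = chart_map d q by rewrite -qz /tau /= chart_mapK.
  have H' v w : fubini_study (Fc z) (real_diff Fd (tau z) v) (real_diff Fd (tau z) w) =
      l * complex.Re (v * conjc w).
    rewrite -(conjCc w) tq -H /diff_to_CP2 -qz.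
    by rewrite /Fc /= chart_mapK.
  have LE : L z = l by rewrite /L H' conjc1 mulr1 /= mulr1.
  have NE v : fubini_study (Fc z) (real_diff Fc z 1) (real_diff Fd (tau z) v) =
      complex.Re (dtau z) * (l * complex.Re (1 * conjc v)) +
      complex.Im (dtau z) * (l * complex.Re ('i * conjc v)).
    by rewrite -(H' 1 v) -(H' 'i v) E fubini_study_lin.
  have N1E : N1 z = complex.Re (dtau z) * l.
    rewrite /N1 NE /=; ring.
  have N2E : N2 z = complex.Im (dtau z) * l.
    rewrite /N2 NE /=; ring.
  rewrite LE N1E N2E !mulfK ?gt_eqF//; split => //.
  by case: (dtau z).
(* Both claims must advance together: the chain rule for [Fd \o tau] at order [n] consumes [dtau] at
   all orders below [n], and yields [dtau] at order [n]. *)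
suff [] : CC n U tau /\ (forall m, (m < n)%N -> CC m U dtau).
  by exists U => //; split => //; exists p.
elim: n => [|n [IH1 IH2]].
  split=> //; split; split=> // z /dt/cderiv_continuous ct.
    by have H := cvg_Re (nbhs_filter z) ct; exact: H.
  by have H := cvg_Im (nbhs_filter z) ct; exact: H.
have CFdt v : v = 1 \/ v = 'i -> vCC n U (fun z => real_diff Fd (tau z) v).
  move=> hv k; have := CC_comp_cderiv oU oV UV dt IH2 (vCC_real_diff oV hv (CFd n.+1) k).
  exact.
have v1 : (1 : C) = 1 \/ (1 : C) = 'i by left.
have vi : ('i : C) = 1 \/ ('i : C) = 'i by right.
have CL : Ck n U (fun z => (L z)^-1).
  apply: CkV oU _ (Ck_fubini_study oU Fc0 (CFc n) (CFdt _ v1) (CFdt _ v1)).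
  by move=> z /key[L0 _]; rewrite gt_eqF.
have CN1 := Ck_fubini_study oU Fc0 (CFc n) (vCC_real_diff oU v1 (CFc n.+1)) (CFdt _ v1).
have CN2 := Ck_fubini_study oU Fc0 (CFc n) (vCC_real_diff oU v1 (CFc n.+1)) (CFdt _ vi).
have Cdt : CC n U dtau.
  split.
    by apply: Ck_congr oU _ (CkM oU CN1 CL) => z /key[_ ->].
  by apply: Ck_congr oU _ (CkM oU CN2 CL) => z /key[_ ->].
split; first exact: CC_of_cderiv oU dt Cdt.
move=> m; rewrite ltnS leq_eqVlt => /predU1P[->//|]; exact: IH2.
Qed.

End Transition.

(** * Smooth functions on the surface *)

Section Discs.
Variable R : realType.
Local Notation C := R[i].

Lemma closed_disc_compact (a : C) (r : R) : compact [set w : C | normc (w - a) <= r].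
Proof.
pose A := [set w : C | normc (w - a) <= r].
pose g (x : R * R) : C := x.1 +i* x.2.
pose Q := `[complex.Re a - r, complex.Re a + r] `*` `[complex.Im a - r, complex.Im a + r].
have cg : continuous g.
  move=> x; apply: cvg_complex; [exact: cvg_fst|exact: cvg_snd].
have cQ : compact (g @` Q).
  apply: continuous_compact; first exact: continuous_subspaceT.
  by apply: compact_setX; exact: segment_compact.
apply: subclosed_compact cQ _ => //.
  rewrite -openC openE => w /= /negP; rewrite -ltNge => rw.
  apply/nbhs_complexP; exists (normc (w - a) - r); first by rewrite subr_gt0.
  move=> z zw /=; apply/negP; rewrite -ltNge.
  have := normc_triangle w z a; rewrite [normc (w - z)]normcB; lra.
move=> w /= wr; exists (complex.Re w, complex.Im w); last by case: (w).
have := le_trans (ler_Re_normc (w - a)) wr; have := le_trans (ler_Im_normc (w - a)) wr.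
rewrite !raddfB /= !ler_norml => /andP[i1 i2] /andP[r1 r2].
by split=> /=; rewrite in_itv /=; apply/andP; split; lra.
Qed.

Lemma open_disc_connected (a : C) (r : R) : connected [set w : C | normc (w - a) < r].
Proof.
have [r0|r0] := leP r 0.
  rewrite (_ : [set _ | _] = set0); first exact: connected0.
  by apply/seteqP; split=> // w /= /(le_lt_trans (normc_ge0 _)); rewrite ltNge r0.
pose D := [set w : C | normc (w - a) < r].
rewrite -/D (_ : D = \bigcup_(w in D) (real_line a (w - a) @` `[0, 1])); last first.
  apply/seteqP; split=> [w Dw|_ [w Dw [t t01 <-]]].
    exists w => //; exists 1; first by rewrite /= in_itv /= ler01 lexx.
    by rewrite /real_line mul1r addrC subrK.
  move: t01; rewrite /= in_itv /= => /andP[t0 t1].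
  rewrite /D /= /real_line addrAC subrr add0r normcM normcR ger0_norm//.
  by apply: le_lt_trans Dw; rewrite -[leRHS]mul1r ler_wpM2r// normc_ge0.
apply: bigcup_connected => [|w Dw].
  exists a => w Dw; exists 0; last exact: real_line0.
  by rewrite /= in_itv /= ler01 lexx.
apply: connected_continuous_connected; first exact: segment_connected.
by apply: continuous_subspaceT => t; exact: continuous_real_line.
Qed.

End Discs.

Section SmoothFunctions.
Variables (R : realType) (M : riemannSurface R) (f : M -> CP2 R).
Hypothesis fC : conformal_immersion f.
Local Notation C := R[i].
Implicit Types (W : set M) (h g : M -> C).

Definition smC W h : Prop := forall c, @atlas R M c ->
  forall k, CC k (chart_map c @` (W `&` chart_dom c)) (h \o chart_inv c).

Lemma smC_sub W V h : V `<=` W -> smC W h -> smC V h.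
Proof.
move=> VW Ch c ac k; apply: CC_sub (Ch c ac k).
by move=> _ [p [/VW Wp cp] <-]; exists p.
Qed.

Lemma smC_local W h :
  (forall p, W p -> exists2 V : set M, V p & smC V h) -> smC W h.
Proof.
move=> H c ac k; apply: CC_local => _ [p [Wp cp] <-].
have [V Vp CV] := H p Wp; exists (chart_map c @` (V `&` chart_dom c)).
  by exists p.
exact: CV.
Qed.

Lemma smC_congr W h g : open W -> (forall p, W p -> h p = g p) -> smC W h -> smC W g.
Proof.
move=> oW E Ch c ac k; apply: CC_congr (Ch c ac k); first exact: chart_image_open.
by move=> _ [p [Wp cp] <-]; rewrite /= chart_mapK// E.
Qed.

Lemma smC_continuous W h p : open W -> smC W h -> W p -> {for p, continuous h}.
Proof.
move=> oW Ch Wp; have [c ac cp] := atlas_cover p.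
have zc : (chart_map c @` (W `&` chart_dom c)) (chart_map c p) by exists p.
have c1 := CC_continuous (Ch c ac 0%N) zc.
have c2 := continuous_comp (chart_map_continuous cp) c1.
apply: near_eq_for c2.
apply: filterS (open_nbhs_nbhs (conj (@chart_dom_open _ _ c) cp)) => q cq.
by rewrite /= chart_mapK.
Qed.

Lemma smC_chart c : @atlas R M c -> smC (chart_dom c) (chart_map c).
Proof.
move=> ac d ad k; apply: CC_local => _ [p [cp dp] <-].
have [U [oU Up] CU] := transition_CC_local fC k ad ac dp cp.
by exists U.
Qed.

Section Algebra.
Variable W : set M.
Hypothesis oW : open W.

Lemma smC_cst (a : C) : smC W (fun=> a).
Proof. by move=> c ac k; apply: CC_cst; exact: chart_image_open. Qed.

Lemma smCD h g : smC W h -> smC W g -> smC W (fun p => h p + g p).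
Proof.
move=> Ch Cg c ac k; have := CCD (chart_image_open oW) (Ch c ac k) (Cg c ac k).
exact.
Qed.

Lemma smCB h g : smC W h -> smC W g -> smC W (fun p => h p - g p).
Proof.
move=> Ch Cg c ac k; have := CCB (chart_image_open oW) (Ch c ac k) (Cg c ac k).
exact.
Qed.

Lemma smCM h g : smC W h -> smC W g -> smC W (fun p => h p * g p).
Proof.
move=> Ch Cg c ac k; have := CCM (chart_image_open oW) (Ch c ac k) (Cg c ac k).
exact.
Qed.

Lemma smC_conj h : smC W h -> smC W (fun p => conjc (h p)).
Proof.
move=> Ch c ac k; have := CC_conj (chart_image_open oW) (Ch c ac k).
exact.
Qed.

Lemma smCV h : (forall p, W p -> h p != 0) -> smC W h -> smC W (fun p => (h p)^-1).
Proof.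
move=> h0 Ch c ac k; have := CCV (chart_image_open oW) _ (Ch c ac k); apply.
by move=> _ [p [Wp cp] <-]; rewrite /= chart_mapK// h0.
Qed.

Lemma smC_normc2 h : smC W h -> smC W (fun p => (normc (h p) ^+ 2)%:C).
Proof.
move=> Ch c ac k; have oU := chart_image_open (c := c) oW.
by have := CC_real oU (CC_normc2 oU (Ch c ac k)).
Qed.

Lemma smC_rho m (u : M -> R) : smC W (fun p => (u p)%:C) ->
  smC W (fun p => (rho m (u p))%:C).
Proof.
move=> Ch c ac k; have oU := chart_image_open (c := c) oW.
have [C1 _] := Ch c ac k.
by have := CC_real oU (Ck_rho m oU C1).
Qed.

Lemma smC_sqrt (u : M -> R) : (forall p, W p -> 0 < u p) ->
  smC W (fun p => (u p)%:C) -> smC W (fun p => (Num.sqrt (u p))%:C).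
Proof.
move=> u0 Ch c ac k; have oU := chart_image_open (c := c) oW.
have [C1 _] := Ch c ac k.
have := CC_real oU (Ck_sqrt oU _ C1); apply.
by move=> _ [p [Wp cp] <-]; rewrite /= chart_mapK// u0.
Qed.

Lemma smC_sum (I : finType) (h : I -> M -> C) :
  (forall i, smC W (h i)) -> smC W (fun p => \sum_i h i p).
Proof.
move=> Ch c ac k; have oU := chart_image_open (c := c) oW.
by have := CC_sum oU (fun i => Ch i c ac k).
Qed.

End Algebra.

Lemma chart_disc c p (N : set M) : chart_dom c p -> nbhs p N ->
  exists2 r : R, 0 < r & forall w, normc (w - chart_map c p) <= r ->
    (chart_map c @` chart_dom c) w /\ N (chart_inv c w).
Proof.
move=> cp Np; have zc : (chart_map c @` chart_dom c) (chart_map c p) by exists p.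
have H1 := open_nbhs_nbhs (conj (@chart_map_open _ _ c) zc).
have H2 : \forall z \near chart_map c p, N (chart_inv c z).
  by apply: (chart_inv_continuous zc); rewrite chart_mapK.
have [r r0 Hr] := (nbhs_complexP _ _).1 (filterI H1 H2).
exists (r / 2) => [|w wr]; first by rewrite divr_gt0.
by apply: Hr; apply: le_lt_trans wr _; rewrite ltr_pdivrMr// ltr_pMr// ltr1n.
Qed.

Definition mdisc c (a : C) (r : R) : set M :=
  [set p | chart_dom c p /\ normc (chart_map c p - a) < r].

Definition mcdisc c (a : C) (r : R) : set M :=
  [set p | chart_dom c p /\ normc (chart_map c p - a) <= r].

Lemma mdisc_open c a r : open (mdisc c a r).
Proof.
rewrite openE => p [cp pr].
have H1 := open_nbhs_nbhs (conj (@chart_dom_open _ _ c) cp).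
have H := (continuous_complexP _ _).1 (chart_map_continuous cp).
have d0 : 0 < r - normc (chart_map c p - a) by rewrite subr_gt0.
apply: filterS2 H1 (H _ d0) => q cq qp; split => //.
have := normc_triangle (chart_map c q) (chart_map c p) a; lra.
Qed.

Lemma mdisc_image c a r : (forall w, normc (w - a) <= r -> (chart_map c @` chart_dom c) w) ->
  mcdisc c a r = chart_inv c @` [set w | normc (w - a) <= r] /\
  mdisc c a r = chart_inv c @` [set w | normc (w - a) < r].
Proof.
move=> H; split; apply/seteqP; split=> [p [cp pr]|_ [w /= wr <-]].
- by exists (chart_map c p) => //; rewrite chart_mapK.
- by have [p cp pw] := H w wr; rewrite -pw chart_mapK//; split=> //; rewrite pw.
- by exists (chart_map c p) => //; rewrite chart_mapK.
- by have [p cp pw] := H w (ltW wr); rewrite -pw chart_mapK//; split=> //; rewrite pw.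
Qed.

Lemma mcdisc_compact c a r :
  (forall w, normc (w - a) <= r -> (chart_map c @` chart_dom c) w) ->
  compact (mcdisc c a r).
Proof.
move=> H; have [-> _] := mdisc_image H.
apply: continuous_compact; last exact: closed_disc_compact.
apply: continuous_in_subspaceT => w; rewrite inE /= => /H zc.
exact: chart_inv_continuous.
Qed.

Lemma mcdisc_closed c a r :
  (forall w, normc (w - a) <= r -> (chart_map c @` chart_dom c) w) ->
  closed (mcdisc c a r).
Proof.
by move=> H; apply: compact_closed; [exact: surface_hausdorff|exact: mcdisc_compact].
Qed.

Lemma mdisc_connected c a r :
  (forall w, normc (w - a) <= r -> (chart_map c @` chart_dom c) w) ->
  connected (mdisc c a r).
Proof.
move=> H; have [_ ->] := mdisc_image H.
apply: connected_continuous_connected; first exact: open_disc_connected.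
apply: continuous_in_subspaceT => w; rewrite inE /= => /ltW/H zc.
exact: chart_inv_continuous.
Qed.

(** [A] is positive exactly for radii below [r2], and [B] exactly for radii above [r1], so [A + B]
    never vanishes and [A / (A + B)] is the cut-off. Extension by 0 is smooth because the chart
    domain and the complement of the closed disc cover the surface; the latter is open since the
    disc is compact in a Hausdorff space. *)
Lemma bump_disc c (a : C) (r1 r2 : R) : @atlas R M c -> 0 < r1 -> r1 < r2 ->
  (forall w, normc (w - a) <= r2 -> (chart_map c @` chart_dom c) w) ->
  exists chi : M -> R, [/\ smC setT (fun p => (chi p)%:C),
    forall p, 0 <= chi p <= 1,
    forall p, mcdisc c a r1 p -> chi p = 1 &
    forall p, ~ mdisc c a r2 p -> chi p = 0].
Proof.
move=> ac r10 r12 H.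
pose A (p : M) : R := rho 0 (r2 ^+ 2 - normc (chart_map c p - a) ^+ 2).
pose B (p : M) : R := rho 0 (normc (chart_map c p - a) ^+ 2 - r1 ^+ 2).
have r20 : 0 < r2 by exact: lt_trans r12.
have A0 p : 0 <= A p by exact: rho_ge0.
have B0 p : 0 <= B p by exact: rho_ge0.
have AB0 p : 0 < A p + B p.
  have [pr|pr] := ltP (normc (chart_map c p - a)) r2.
    by rewrite ltr_pwDl// rho0_gt0// subr_gt0 ltrXn2r ?nnegrE ?normc_ge0// ltW.
  rewrite ltr_wpDl// rho0_gt0// subr_gt0 ltrXn2r ?nnegrE ?normc_ge0//.
    exact: ltW.
  exact: lt_le_trans pr.
(* The values of [chart_map c] off its domain mean nothing, hence the test on membership in the
   disc. *)
pose chi p : R := if `[< mdisc c a r2 p >] then A p / (A p + B p) else 0.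
exists chi; split.
- apply: smC_local => p _; have oc := @chart_dom_open _ _ c.
  have [cp|ncp] := pselect (chart_dom c p).
    exists (chart_dom c) => //.
    have Cc := smC_chart ac.
    have Cn := smC_normc2 oc (smCB oc Cc (smC_cst oc a)).
    have CA : smC (chart_dom c) (fun q => (A q)%:C).
      apply: smC_rho => //.
      have := smCB oc (smC_cst oc (r2 ^+ 2)%:C) Cn.
      by apply: smC_congr => // q _; rewrite rmorphB.
    have CB : smC (chart_dom c) (fun q => (B q)%:C).
      apply: smC_rho => //.
      have := smCB oc Cn (smC_cst oc (r1 ^+ 2)%:C).
      by apply: smC_congr => // q _; rewrite rmorphB.
    have CAB : smC (chart_dom c) (fun q => ((A q)%:C + (B q)%:C)^-1).
      apply: smCV (smCD oc CA CB) => // q _.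
      by rewrite -rmorphD /= fmorph_eq0 gt_eqF.
    apply: smC_congr (smCM oc CA CAB) => // q cq.
    rewrite /chi; case: asboolP => [_|nq]; first by rewrite -rmorphD -fmorphV -rmorphM.
    suff -> : A q = 0 by rewrite mul0r.
    apply: rho_le0; rewrite subr_le0 lerXn2r ?nnegrE ?normc_ge0 ?(ltW r20)//.
    by rewrite leNgt; apply/negP => qr; apply: nq.
  exists (~` mcdisc c a r2); first by move=> [].
  have oK : open (~` mcdisc c a r2) by rewrite openC; exact: mcdisc_closed.
  apply: smC_congr (smC_cst oK 0) => // q nq.
  rewrite /chi; case: asboolP => // -[cq qr]; exfalso; apply: nq; split => //.
  exact: ltW.
- move=> p; rewrite /chi; case: asboolP => _; last by rewrite lexx ler01.
  by rewrite divr_ge0//= ?(ltW (AB0 _))// ler_pdivrMr// mul1r lerDl.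
- move=> p [cp pr]; rewrite /chi asboolT; last by split=> //; exact: le_lt_trans pr r12.
  have -> : B p = 0.
    apply: rho_le0; rewrite subr_le0 lerXn2r ?nnegrE ?normc_ge0//.
    exact: ltW.
  rewrite addr0 divff// gt_eqF//; have := AB0 p.
  by rewrite {1}/B rho_le0 ?addr0// subr_le0 lerXn2r ?nnegrE ?normc_ge0 ?(ltW r10).
- by move=> p np; rewrite /chi asboolF.
Qed.

End SmoothFunctions.

(** * Transporting zeros of functions *)

Lemma cvg_dnbhs_congr (S X : topologicalType) (p : S) (f g : S -> X) (l : X) :
  (\forall x \near p^', f x = g x) -> f @ p^' --> l -> g @ p^' --> l.
Proof.
move=> E; apply: cvg_trans; apply: near_eq_cvg.
by apply: filterS E.
Qed.

Lemma cvg_dnbhsM (R : realType) (S : topologicalType) (p : S) (f g : S -> R[i]) (a b : R[i]) :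
  f @ p^' --> a -> g @ p^' --> b -> (fun x => f x * g x) @ p^' --> a * b.
Proof. by move=> fa gb; exact: cvgM fa gb. Qed.

(** * Filling a puncture without creating zeros *)

Section Fill.
Variables (R : realType) (M : riemannSurface R) (f : M -> CP2 R).
Hypothesis fC : conformal_immersion f.
Local Notation C := R[i].
Implicit Types (W V : set M) (h g u v : M -> C) (p q x : M).

Lemma closed_pt p : closed [set p].
Proof. by apply: compact_closed; [exact: surface_hausdorff|exact: compact_set1]. Qed.

Lemma open_D1 W p : open W -> open (W `\ p).
Proof. by move=> oW; apply: openI => //; rewrite openC; exact: closed_pt. Qed.

Lemma open_C1 p : open (~` [set p]).
Proof. by rewrite openC; exact: closed_pt. Qed.

Lemma near_dnbhs p (P : set M) : (\forall x \near p, x <> p -> P x) -> \forall x \near p^', P x.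
Proof.
move=> H; rewrite near_withinE.
by apply: filterS H => x Hx xp; apply: Hx; apply/eqP.
Qed.

Lemma dnbhs_near p (P : set M) : (\forall x \near p^', P x) -> \forall x \near p, x <> p -> P x.
Proof.
by rewrite near_withinE; apply: filterS => x Hx /eqP xp; apply: Hx.
Qed.

Lemma cvg_dnbhs h p l : {for p, continuous h} -> h p = l -> h @ p^' --> l.
Proof. by move=> ch <-; apply: cvg_trans ch; apply: cvg_app; exact: cvg_within. Qed.

Lemma chart_inj (c : chart R M) x p : chart_dom c x -> chart_dom c p ->
  chart_map c x = chart_map c p -> x = p.
Proof. by move=> cx cp E; rewrite -(chart_mapK cx) E chart_mapK. Qed.

Lemma near_chart (c : chart R M) p : chart_dom c p ->
  \forall x \near p^', chart_dom c x /\ chart_map c x - chart_map c p != 0.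
Proof.
move=> cp; apply: near_dnbhs.
apply: filterS (open_nbhs_nbhs (conj (@chart_dom_open _ _ c) cp)) => x cx xp.
by split=> //; rewrite subr_eq0; apply/eqP => /(chart_inj cx cp).
Qed.

Lemma nbhs_other p (N : set M) : nbhs p N -> exists2 x, N x & x <> p.
Proof.
move=> Np; have [c ac cp] := atlas_cover p.
have [r r0 Hr] := chart_disc cp Np.
have [] := Hr (chart_map c p + r%:C).
  by rewrite addrAC subrr add0r normcR ger0_norm// ltW.
move=> [x cx xE] Nx; exists x; first by rewrite -(chart_mapK cx) xE.
move=> xp; move: xE; rewrite xp => /eqP; rewrite -subr_eq0 opprD addrA subrr add0r oppr_eq0.
by rewrite fmorph_eq0 gt_eqF.
Qed.

(** A surface has no isolated point, so limits along punctured neighbourhoods are unique. *)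
Lemma dnbhs_proper p : ProperFilter p^'.
Proof.
apply: Build_ProperFilter_ex => P /dnbhs_near/nbhs_other[x Px xp].
by exists x; exact: Px.
Qed.

(* Close to [p], [h / a] stays in a disc around 1 which avoids 0, so that [h] can
   be deformed to the constant [a] without vanishing. *)
Definition fillable h p : Prop := exists (a : C) (t : R), [/\ a != 0, t < 1 &
  \forall x \near p^', normc (h x / a - 1) <= t].

Lemma fillable_near h g p : (\forall x \near p^', h x = g x) -> fillable h p -> fillable g p.
Proof.
move=> E [a [t [a0 t1 H]]]; exists a, t; split => //.
by apply: filterS2 E H => x ->.
Qed.

Lemma fillable_mul h v p (b : C) : fillable h p -> b != 0 -> v @ p^' --> b ->
  fillable (fun x => h x * v x) p.
Proof.
move=> [a [t [a0 t1 H]]] b0 vb.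
pose t' := Num.max t 0; have t'0 : 0 <= t' by rewrite le_max lexx orbT.
have t'1 : t' < 1 by rewrite gt_max t1 ltr01.
(* This makes [|h v / (a b) - 1| <= t' (1 + e) + e <= t' + 2 e], and the last bound is
   [(1 + t') / 2]. *)
pose e := (1 - t') / 4; have e0 : 0 < e by rewrite divr_gt0// subr_gt0.
exists (a * b), (t' + 2 * e); split.
- by rewrite mulf_neq0.
- by rewrite /e; lra.
have vb1 : (fun x => v x / b) @ p^' --> (1 : C).
  by rewrite -(divff b0); exact: (cvgMr_tmp (b := b^-1) vb).
have H' := (cvg_complexP (dnbhs_filter p) _ _).1 vb1 _ e0.
move: H H'; apply: filterS2 => x Hx /ltW Hv.
have -> : h x * v x / (a * b) - 1 = (h x / a - 1) * (v x / b) + (v x / b - 1).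
  by rewrite invfM; ring.
apply: le_trans (le_normcD _ _) _; rewrite normcM.
have nv : normc (v x / b) <= 1 + e.
  rewrite -[v x / b](subrK 1); apply: le_trans (le_normcD _ _) _.
  by rewrite normc1; lra.
have Hx' : normc (h x / a - 1) <= t' by rewrite le_max Hx.
have := normc_ge0 (h x / a - 1); have := normc_ge0 (v x / b).
have e1 : e <= 1 by rewrite /e; lra.
by nra.
Qed.

Lemma fillable_cst1 p : fillable (fun=> 1) p.
Proof.
exists 1, 0; rewrite oner_neq0 ltr01; split=> //.
by apply: near_dnbhs; apply: nearW => x _; rewrite divr1 subrr normc0.
Qed.

Lemma fillable_cvg v p (b : C) : b != 0 -> v @ p^' --> b -> fillable v p.
Proof.
move=> b0 vb; apply: fillable_near (fillable_mul (fillable_cst1 p) b0 vb).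
by apply: near_dnbhs; apply: nearW => x _; rewrite mul1r.
Qed.

(** [g] is [a] near [p] and interpolates linearly to [h] inside a disc where [h / a] is within
    [t < 1] of 1. There [g / a] is at least as close to 1, so it cannot vanish. The value of [h] at
    [p] itself is overwritten. *)
Lemma fill h p W V : open W -> W p -> open V -> V p ->
  smC (W `\ p) h -> fillable h p ->
  exists g K, [/\ closed K, K p, K `<=` V `&` W, smC W g &
    (forall x, ~ K x -> g x = h x) /\ (forall x, K x -> g x != 0)].
Proof.
move=> oW Wp oV Vp Ch [a [t [a0 t1 H]]].
have [c ac cp] := atlas_cover p.
have nN : nbhs p (fun x => [/\ W x, V x & x <> p -> normc (h x / a - 1) <= t]).
  have n1 := open_nbhs_nbhs (conj oW Wp); have n2 := open_nbhs_nbhs (conj oV Vp).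
  by apply: filterS3 n1 n2 (dnbhs_near H) => x; split.
have [r r0 Hr] := chart_disc cp nN.
have Hd w : normc (w - chart_map c p) <= r -> (chart_map c @` chart_dom c) w.
  by move=> /Hr[].
have r20 : 0 < r / 2 by rewrite divr_gt0.
have r2r : r / 2 < r by rewrite ltr_pdivrMr// ltr_pMr// ltr1n.
have [chi [Cchi chi01 chi1 chi0]] := bump_disc fC ac r20 r2r Hd.
pose K := mcdisc c (chart_map c p) r.
have KN x : K x -> [/\ W x, V x & x <> p -> normc (h x / a - 1) <= t].
  by move=> [cx xr]; have [_] := Hr _ xr; rewrite chart_mapK.
pose g x := a + (1 - (chi x)%:C) * (h x - a).
exists g, K; split.
- exact: mcdisc_closed.
- by split=> //; rewrite subrr normc0 ltW.
- by move=> x /KN[].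
- apply: smC_local => x Wx; have [->|/eqP xp] := eqVneq x p.
    exists (mdisc c (chart_map c p) (r / 2)).
      by split=> //; rewrite subrr normc0.
    have oD := @mdisc_open _ _ c (chart_map c p) (r / 2).
    apply: smC_congr oD _ (smC_cst oD a) => y [cy yr].
    by rewrite /g chi1 ?subrr ?mul0r ?addr0//; split=> //; exact: ltW.
  exists (W `\ p) => //.
  have oWp := open_D1 p oW.
  have Cx := smC_sub (@subsetT _ (W `\ p)) Cchi.
  have C1 := smCM oWp (smCB oWp (smC_cst oWp 1) Cx) (smCB oWp Ch (smC_cst oWp a)).
  have C2 := smCD oWp (smC_cst oWp a) C1; exact: C2.
- split=> x Kx.
    rewrite /g chi0; last by move=> [cx /ltW xr]; apply: Kx.
    by rewrite subr0 mul1r addrC subrK.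
  have [xp|xp] := eqVneq x p.
    rewrite /g chi1 ?subrr ?mul0r ?addr0//; rewrite xp; split=> //.
    by rewrite subrr normc0 ltW.
  have [_ _ /(_ (elimN eqP xp)) hx] := KN x Kx.
  have gE : g x = a * (1 + (1 - (chi x)%:C) * (h x / a - 1)).
    by rewrite /g; field.
  rewrite gE mulf_neq0//; apply/negP; rewrite addrC addr_eq0 => /eqP E.
  have : normc ((1 - (chi x)%:C) * (h x / a - 1)) = 1.
    by rewrite E normcN normc1.
  have /andP[c0 c1] := chi01 x.
  rewrite normcM -rmorphB normcR ger0_norm ?subr_ge0// => E1.
  by have := normc_ge0 (h x / a - 1); nra.
Qed.

End Fill.

(** * Moving a zero inside a connected open set *)

Section Transport.
Variables (R : realType) (M : riemannSurface R) (f : M -> CP2 R).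
Hypothesis fC : conformal_immersion f.
Local Notation C := R[i].
Implicit Types (W V : set M) (h g u v : M -> C) (p q x : M) (c d : chart R M).

(** The limit is the derivative of the transition map. *)
Lemma chart_ratio_cvg c d p : @atlas R M c -> @atlas R M d ->
  chart_dom c p -> chart_dom d p -> exists l : C,
  (fun x => (chart_map d x - chart_map d p) / (chart_map c x - chart_map c p)) @ p^' --> l.
Proof.
move=> ac ad cp dp; have H := derivable_cderiv (atlas_holomorphic ac ad cp dp).
set tau := chart_map d \o chart_inv c in H; set l := 'D_1 tau _ in H.
exists l; apply/(cvg_complexP (dnbhs_filter p)) => e e0.
have e20 : 0 < e / 2 by rewrite divr_gt0.
have [r r0 Hr] := H _ e20.
have cc : \forall x \near p, normc (chart_map c x - chart_map c p) < r.
  exact: (continuous_complexP _ _).1 (chart_map_continuous cp) _ r0.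
have cc' : \forall x \near p^', normc (chart_map c x - chart_map c p) < r.
  by apply: near_dnbhs; apply: filterS cc.
move: cc' (near_chart cp); apply: filterS2 => x xr [cx x0].
have := Hr _ xr; rewrite [chart_map c p + _]addrC subrK /tau /= !chart_mapK// => Hx.
set z := chart_map c x - chart_map c p in x0 Hx *.
have nz : 0 < normc z by rewrite normc_gt0.
rewrite -(ltr_pM2r nz) -normcM mulrBl divfK//.
by apply: le_lt_trans Hx _; rewrite ltr_pM2r// ltr_pdivrMr// ltr_pMr// ltr1n.
Qed.

(** The ratio and its inverse both converge, and the product of the two limits is 1. *)
Lemma chart_ratio c d p : @atlas R M c -> @atlas R M d ->
  chart_dom c p -> chart_dom d p -> exists2 l : C, l != 0 &
  (fun x => (chart_map d x - chart_map d p) / (chart_map c x - chart_map c p)) @ p^' --> l.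
Proof.
move=> ac ad cp dp; have [l Hl] := chart_ratio_cvg ac ad cp dp.
have [l' Hl'] := chart_ratio_cvg ad ac dp cp.
exists l => //; apply/eqP => l0.
have H1 := cvg_dnbhsM Hl Hl'.
have H2 : (fun=> 1 : C) @ p^' --> l * l'.
  apply: cvg_dnbhs_congr H1; move: (near_chart cp) (near_chart dp).
  apply: filterS2 => x [_ xc] [_ xd] /=; by field; rewrite xc xd.
have PF := dnbhs_proper p.
have H3 : (fun=> 1 : C) @ p^' --> (1 : C) by exact: cvg_cst.
have E : l * l' = 1 by exact: (cvg_unique (@norm_hausdorff _ _) H2 H3).
by move/eqP: E; rewrite l0 mul0r eq_sym oner_eq0.
Qed.

Definition pole_at u p : Prop := exists c (b : C), [/\ @atlas R M c, chart_dom c p, b != 0 &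
  (fun x => u x * (chart_map c x - chart_map c p)) @ p^' --> b].

Definition zero_at u p : Prop := exists c (b : C), [/\ @atlas R M c, chart_dom c p, b != 0 &
  (fun x => u x / (chart_map c x - chart_map c p)) @ p^' --> b].

Lemma pole_at_mul u v p (b : C) : pole_at u p -> b != 0 -> v @ p^' --> b ->
  pole_at (fun x => u x * v x) p.
Proof.
move=> [c [a [ac cp a0 H]]] b0 vb; exists c, (a * b); split; [exact: ac|exact: cp|exact: mulf_neq0|].
have H1 := cvg_dnbhsM H vb; apply: cvg_dnbhs_congr H1.
by apply: near_dnbhs; apply: nearW => x _ /=; rewrite mulrAC.
Qed.

Lemma zero_at_mul u v p (b : C) : zero_at u p -> b != 0 -> v @ p^' --> b ->
  zero_at (fun x => u x * v x) p.
Proof.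
move=> [c [a [ac cp a0 H]]] b0 vb; exists c, (a * b); split; [exact: ac|exact: cp|exact: mulf_neq0|].
have H1 := cvg_dnbhsM H vb; apply: cvg_dnbhs_congr H1.
by apply: near_dnbhs; apply: nearW => x _ /=; rewrite mulrAC.
Qed.

Lemma pole_at_near u v p : (\forall x \near p^', u x = v x) -> pole_at u p -> pole_at v p.
Proof.
move=> E [c [a [ac cp a0 H]]]; exists c, a; split; [exact: ac|exact: cp|exact: a0|].
by apply: cvg_dnbhs_congr H; apply: filterS E => x ->.
Qed.

Lemma zero_at_near u v p : (\forall x \near p^', u x = v x) -> zero_at u p -> zero_at v p.
Proof.
move=> E [c [a [ac cp a0 H]]]; exists c, a; split; [exact: ac|exact: cp|exact: a0|].
by apply: cvg_dnbhs_congr H; apply: filterS E => x ->.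
Qed.

Lemma zero_mul_pole u v p : zero_at u p -> pole_at v p ->
  exists2 l : C, l != 0 & (fun x => u x * v x) @ p^' --> l.
Proof.
move=> [c [a [ac cp a0 Ha]]] [d [b [ad dp b0 Hb]]].
have [l l0 Hl] := chart_ratio ad ac dp cp.
exists (a * b * l); first by rewrite !mulf_neq0.
have H1 := cvg_dnbhsM (cvg_dnbhsM Ha Hb) Hl; apply: cvg_dnbhs_congr H1.
move: (near_chart cp) (near_chart dp); apply: filterS2 => x [_ xc] [_ xd] /=.
by field; rewrite xc xd.
Qed.

(** A multiplier that moves a simple zero from [q] to [q'] and changes nothing off [W]. Its value at
    [q] is arbitrary; a product with it is mended there by [fill]. *)
Definition transport W q q' u : Prop := [/\
  smC (~` [set q]) u, forall x, x <> q -> x <> q' -> u x != 0,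
  forall x, ~ W x -> u x = 1, pole_at u q & zero_at u q'].

(** Up to radius [2 s] about [q], hence also at [q'], [u] is the quotient [(z - q') / (z - q)].
    Farther out [|rt - 1| = s / |z - q| < 1 / 2], so that cutting [rt - 1] off cannot bring [u] to
    0. *)
Lemma transport_small W c (q q' : M) : @atlas R M c -> chart_dom c q -> chart_dom c q' ->
  q <> q' ->
  let s := normc (chart_map c q' - chart_map c q) in
  (forall w, normc (w - chart_map c q) <= 4 * s -> (chart_map c @` chart_dom c) w) ->
  mdisc c (chart_map c q) (4 * s) `<=` W ->
  exists u, transport W q q' u.
Proof.
move=> ac cq cq' qq' s Hd HW.
have ne : chart_map c q' - chart_map c q != 0.
  by rewrite subr_eq0; apply/eqP => /(chart_inj cq' cq) /esym.
have s0 : 0 < s by rewrite normc_gt0.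
have s20 : 0 < 2 * s by rewrite mulr_gt0.
have s24 : 2 * s < 4 * s by rewrite ltr_pM2r// ltr_nat.
have [chi [Cchi chi01 chi1 chi0]] := bump_disc fC ac s20 s24 Hd.
pose rt x := (chart_map c x - chart_map c q') / (chart_map c x - chart_map c q).
pose u x := 1 + (chi x)%:C * (rt x - 1).
have uE x : mcdisc c (chart_map c q) (2 * s) x -> u x = rt x.
  by move=> xd; rewrite /u chi1// mul1r addrC subrK.
have u1 x : ~ mdisc c (chart_map c q) (4 * s) x -> u x = 1.
  by move=> xd; rewrite /u chi0// mul0r addr0.
have rt1 x : x <> q -> chart_dom c x -> rt x - 1 =
    (chart_map c q - chart_map c q') / (chart_map c x - chart_map c q).
  move=> xq cx; have : chart_map c x - chart_map c q != 0.
    by rewrite subr_eq0; apply/eqP => /(chart_inj cx cq).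
  by move=> x0; rewrite /rt; field.
have near2 y : chart_dom c y -> normc (chart_map c y - chart_map c q) < 2 * s ->
    \forall x \near y^', u x = rt x.
  move=> cy ys; apply: near_dnbhs.
  have yD : mdisc c (chart_map c q) (2 * s) y by [].
  apply: filterS (open_nbhs_nbhs (conj (@mdisc_open _ _ c _ _) yD)) => x [cx xs] _.
  by apply: uE; split => //; exact: ltW.
exists u; split.
- apply: smC_local => x /= xq.
  have [cx|ncx] := pselect (chart_dom c x).
    have oD := open_D1 q (@chart_dom_open _ _ c).
    exists (chart_dom c `\ q) => //.
    have Cc := smC_sub (@subDsetl _ _ [set q]) (smC_chart fC ac).
    have CV : smC (chart_dom c `\ q) (fun x => (chart_map c x - chart_map c q)^-1).
      have := smCV oD _ (smCB oD Cc (smC_cst oD _)); apply.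
      by move=> y [cy yq]; rewrite subr_eq0; apply/eqP => /(chart_inj cy cq).
    have Crt := smCM oD (smCB oD Cc (smC_cst oD (chart_map c q'))) CV.
    have Cx := smC_sub (@subsetT _ (chart_dom c `\ q)) Cchi.
    have := smCD oD (smC_cst oD 1) (smCM oD Cx (smCB oD Crt (smC_cst oD 1))).
    exact.
  exists (~` mcdisc c (chart_map c q) (4 * s)); first by move=> [].
  have oK : open (~` mcdisc c (chart_map c q) (4 * s)) by rewrite openC; exact: mcdisc_closed.
  apply: smC_congr oK _ (smC_cst oK 1) => y ny; rewrite u1// => -[cy yr].
  by apply: ny; split => //; exact: ltW.
- move=> x xq xq'.
  have [xd|/u1->] := pselect (mdisc c (chart_map c q) (4 * s) x); last exact: oner_neq0.
  have [cx xr] := xd.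
  have x0 : chart_map c x - chart_map c q != 0.
    by rewrite subr_eq0; apply/eqP => /(chart_inj cx cq).
  have x0' : chart_map c x - chart_map c q' != 0.
    by rewrite subr_eq0; apply/eqP => /(chart_inj cx cq').
  have [xs|xs] := leP (normc (chart_map c x - chart_map c q)) (2 * s).
    by rewrite uE// /rt mulf_neq0// invr_eq0.
  apply/negP; rewrite /u addrC addr_eq0 => /eqP E.
  have : normc ((chi x)%:C * (rt x - 1)) = 1 by rewrite E normcN normc1.
  rewrite rt1// !normcM normcV normcB -/s normcR.
  have /andP[c0 c1] := chi01 x; rewrite ger0_norm// => E1.
  have n0 : 0 < normc (chart_map c x - chart_map c q) by rewrite normc_gt0.
  have : chi x * s = normc (chart_map c x - chart_map c q).
    by rewrite -[RHS]mul1r -E1; field; rewrite gt_eqF.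
  by nra.
- by move=> x xW; apply: u1 => /HW.
- exists c, (chart_map c q - chart_map c q'); split; [exact: ac|exact: cq| |].
    by rewrite -opprB oppr_eq0.
  have cv : (fun x => chart_map c x - chart_map c q') @ q^' --> chart_map c q - chart_map c q'.
    apply: cvg_dnbhs => //.
    have := continuousB (chart_map_continuous cq) (@cst_continuous _ _ (chart_map c q') q).
    exact.
  apply: cvg_dnbhs_congr cv; have qs : normc (chart_map c q - chart_map c q) < 2 * s.
    by rewrite subrr normc0.
  move: (near2 q cq qs) (near_chart cq); apply: filterS2 => x -> [_ x0].
  by rewrite /rt divfK.
- exists c, (chart_map c q' - chart_map c q)^-1; split; [exact: ac|exact: cq'| |].
    by rewrite invr_eq0.
  have cv : (fun x => (chart_map c x - chart_map c q)^-1) @ q'^' --> (chart_map c q' - chart_map c q)^-1.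
    apply: cvg_dnbhs => //.
    have cB := continuousB (chart_map_continuous cq') (@cst_continuous _ _ (chart_map c q) q').
    have cV := @continuousV _ _ (fun x : M => chart_map c x - chart_map c q) q' ne cB.
    exact: cV.
  apply: cvg_dnbhs_congr cv; have qs : normc (chart_map c q' - chart_map c q) < 2 * s.
    by rewrite -/s ltr_pMl// ltr1n.
  move: (near2 q' cq' qs) (near_chart cq'); apply: filterS2 => x -> [_ x0].
  by rewrite /rt mulrAC divff// mul1r.
Qed.

(** In [u v] the zero of [u] and the pole of [v] at [q'] cancel to a non-zero limit. [fill] then
    makes the product smooth and non-zero at [q'], changing it only on a set [K] inside [W] that
    avoids [q] and [q'']. *)
Lemma transport_trans W q q' q'' u v : open W -> W q' ->
  q <> q' -> q' <> q'' -> q <> q'' ->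
  transport W q q' u -> transport W q' q'' v -> exists w, transport W q q'' w.
Proof.
move=> oW Wq' n1 n2 n3 [Cu u0 u1 Pu Zu] [Cv v0 v1 Pv Zv].
have [l l0 Hl] := zero_mul_pole Zu Pv.
pose h x := u x * v x.
have oQ : open (~` [set q] : set M) := open_C1 q.
have oQ' : open (~` [set q'] : set M) := open_C1 q'.
have oD : open (~` [set q] `\ q') := open_D1 q' oQ.
have Ch : smC (~` [set q] `\ q') h.
  apply: (smCM oD); first by apply: smC_sub Cu => x [].
  by apply: smC_sub Cv => x [].
pose V := (W `\ q) `\ q''.
have oV : open V by do 2 apply: open_D1.
have Vq' : V q' by split => //; split => // /esym.
have Wq : (~` [set q]) q' by move=> /esym.
have [g [K [cK Kq' KV Cg [gE g0]]]] := fill fC oQ Wq oV Vq' Ch (fillable_cvg l0 Hl).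
have nK y : ~ K y -> \forall x \near y^', h x = g x.
  move=> Ky; apply: near_dnbhs.
  have oK : open (~` K) by rewrite openC.
  by apply: filterS (open_nbhs_nbhs (conj oK Ky)) => x Kx _; rewrite gE.
exists g; split => //.
- move=> x xq xq''; have [/g0//|Kx] := pselect (K x).
  rewrite gE// /h mulf_neq0//; first by apply: u0 => // xq'; apply: Kx; rewrite xq'.
  by apply: v0 => // xq'; apply: Kx; rewrite xq'.
- move=> x Wx; rewrite gE; first by rewrite /h u1// v1// mulr1.
  by move=> /KV[[[]]].
- have Kq : ~ K q by move=> /KV[[[_ []]]].
  apply: pole_at_near (nK q Kq) _; apply: (pole_at_mul Pu (v0 q n1 n3)).
  by apply: (cvg_dnbhs (smC_continuous oQ' Cv _) erefl).
- have Kq : ~ K q'' by move=> /KV[[_ []]].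
  have n3' : q'' <> q by move=> /esym.
  have n2' : q'' <> q' by move=> /esym.
  have H : zero_at (fun x => v x * u x) q''.
    apply: (zero_at_mul Zv (u0 q'' n3' n2')).
    by apply: (cvg_dnbhs (smC_continuous oQ Cu _) erefl).
  apply: zero_at_near (nK q'' Kq) _; apply: zero_at_near H.
  by apply: near_dnbhs; apply: nearW => x _; rewrite mulrC.
Qed.

Lemma transport_local W p : open W -> W p -> exists N : set M, [/\ open N, N p, N `<=` W &
  forall q q', N q -> N q' -> q <> q' -> exists u, transport W q q' u].
Proof.
move=> oW Wp; have [c ac cp] := atlas_cover p.
have [r r0 Hr] := chart_disc cp (open_nbhs_nbhs (conj oW Wp)).
(* Two points of this disc are at a distance [s < r / 5], and [4 s + r / 10 < r] leaves the room
   that [transport_small] asks for. *)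
exists (mdisc c (chart_map c p) (r / 10)); split.
- exact: mdisc_open.
- by split => //; rewrite subrr normc0 divr_gt0.
- move=> x [cx xr]; have [|_] := Hr (chart_map c x); last by rewrite chart_mapK.
  by lra.
move=> q q' [cq qr] [cq' qr'] qq'.
have sr : normc (chart_map c q' - chart_map c q) < r / 5.
  have := normc_triangle (chart_map c q') (chart_map c p) (chart_map c q).
  by rewrite [normc (chart_map c p - _)]normcB; lra.
have D w : normc (w - chart_map c q) <= 4 * normc (chart_map c q' - chart_map c q) ->
    normc (w - chart_map c p) <= r.
  by move=> wq; have := normc_triangle w (chart_map c q) (chart_map c p); lra.
apply: (transport_small ac cq cq' qq').
  by move=> w /D/Hr[].
by move=> x [cx /ltW/D/Hr[_]]; rewrite chart_mapK.
Qed.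

(** The points that the zero can reach form a subset open and closed in [W]. The starting point is
    listed apart, since the pole and the zero of a transport are distinct. *)
Lemma transport_connected W q q' : open W -> connected W -> W q -> W q' -> q <> q' ->
  exists u, transport W q q' u.
Proof.
move=> oW cW Wq Wq' qq'.
pose E := [set x | W x /\ (x = q \/ exists u, transport W q x u)].
suff EW : E = W.
  have : E q' by rewrite EW.
  by move=> [_ [/esym//|//]].
have step p : W p -> exists N : set M, [/\ open N, N p, N `<=` W &
    (exists2 x, N x & E x) -> N `<=` E].
  move=> Wp; have [N [oN Np NW HN]] := transport_local oW Wp.
  exists N; split => // -[x Nx [Wx Ex]] y Ny; split; first exact: NW.
  have [yq|yq] := pselect (y = q); first by left.
  (* [transport_trans] asks for three distinct points; each coincidence is settled by a transport
     already at hand. *)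
  right; case: Ex => [xq|[u Tu]].
    by apply: HN => //; [rewrite -xq|move=> /esym].
  have [xq|xq] := pselect (x = q).
    by apply: HN => //; [rewrite -xq|move=> /esym].
  have [xy|xy] := pselect (x = y); first by exists u; rewrite -xy.
  have [v Tv] := HN x y Nx Ny xy.
  by apply: (transport_trans oW Wx _ xy _ Tu Tv) => /esym.
apply: cW.
- by exists q; split => //; left.
- exists E; last by apply/seteqP; split=> [x Ex|x []//]; split => //; case: Ex.
  rewrite openE => x [Wx Ex]; have [N [oN Nx NW HN]] := step x Wx.
  apply: filterS (open_nbhs_nbhs (conj oN Nx)) => y Ny.
  by apply: HN => //; exists x.
- exists (~` (W `\` E)); last first.
    apply/seteqP; split=> [x Ex|x [Wx H]]; last by apply: contrapT => nE; exact: H.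
    by split; [case: Ex|move=> [_]; exact].
  rewrite closedC openE => x [Wx nEx]; have [N [oN Nx NW HN]] := step x Wx.
  apply: filterS (open_nbhs_nbhs (conj oN Nx)) => y Ny; split; first exact: NW.
  by move=> Ey; apply: nEx; apply: HN => //; exists y.
Qed.

End Transport.

(** * Exhaustion by compact sets *)

(** In the filter [F] a property is eventual if it holds for all [P]-sets containing some fixed one.
    Near-covering compactness says that eventually a [P]-set contains [K], so the fixed one does. *)
Lemma compact_induction (T : topologicalType) (P : set T -> Prop) (K : set T) :
  compact K -> P set0 -> (forall A B, P A -> P B -> P (A `|` B)) ->
  (forall A B, B `<=` A -> P A -> P B) ->
  (forall x, K x -> exists2 N, nbhs x N & P N) -> P K.
Proof.
move=> /compact_near_coveringP cK P0 PU PS PN.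
pose F : set_system (set T) := [set S | exists2 A, P A & forall B, P B -> A `<=` B -> S B].
have FF : Filter F.
  split=> [|S1 S2 [A1 P1 H1] [A2 P2 H2]|S1 S2 S12 [A PA H]].
  - by exists set0.
  - exists (A1 `|` A2); first exact: PU.
    by move=> B PB AB; split; [apply: H1|apply: H2] => // x Ax; apply: AB; [left|right].
  - by exists A => // B PB /(H _ PB)/S12.
have [A PA HA] : F (fun B => K `<=` (fun x => B x)).
  apply: (cK (set T) F (fun B x => B x) FF).
  move=> x /PN[N nN PN']; exists (N, [set B | N `<=` B]) => /=.
    by split=> //; exists N.
  by move=> [y B] /= [Ny NB]; exact: NB.
by apply: (PS A) => // x Kx; apply: (HA A PA _ x Kx).
Qed.

Section Exhaustion.
Variables (R : realType) (M : riemannSurface R).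
Hypothesis ncM : ~ compact [set: M].
Local Notation C := R[i].
Implicit Types (K L V W : set M) (p q x : M).

Lemma surface_nbhs p (N : set M) : nbhs p N -> exists D L : set M,
  [/\ open D, connected D, D p, compact L & D `<=` L /\ L `<=` N].
Proof.
move=> Np; have [c ac cp] := atlas_cover p.
have [r r0 Hr] := chart_disc cp Np.
have Hd w : normc (w - chart_map c p) <= r -> (chart_map c @` chart_dom c) w by move=> /Hr[].
exists (mdisc c (chart_map c p) r), (mcdisc c (chart_map c p) r); split.
- exact: mdisc_open.
- exact: mdisc_connected.
- by split => //; rewrite subrr normc0.
- exact: mcdisc_compact.
split=> x [cx xr]; first by split => //; exact: ltW.
by have [_] := Hr _ xr; rewrite chart_mapK.
Qed.

Lemma compact_nbhd K : compact K -> exists2 L, compact L & K `<=` L°.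
Proof.
move=> cK; apply: (compact_induction (P := fun A => exists2 L, compact L & A `<=` L°)) cK _ _ _ _.
- by exists set0; [exact: compact0|].
- move=> A B [L1 c1 A1] [L2 c2 B2]; exists (L1 `|` L2); first exact: compactU.
  by move=> x [/A1|/B2]; apply: filterS => y; [left|right].
- by move=> A B BA [L cL AL]; exists L => // x /BA/AL.
move=> x _; have [D [L [oD _ Dx cL [DL _]]]] := surface_nbhs (@filterT _ (nbhs x) _).
exists D; first exact: open_nbhs_nbhs.
by exists L => // y Dy; apply: filterS DL _; exact: open_nbhs_nbhs.
Qed.

Lemma component_open W p : open W -> open (connected_component W p).
Proof.
move=> oW; rewrite openE => x Hx.
have Wx := connected_component_sub Hx.
have [D [L [oD cD Dx _ [DL LW]]]] := surface_nbhs (open_nbhs_nbhs (conj oW Wx)).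
apply: filterS (open_nbhs_nbhs (conj oD Dx)) => y Dy.
apply: connected_component_trans Hx _.
by exists D => //; split=> // z /DL/LW.
Qed.

(** The union of those components of the complement that lie in no compact set; its complement is
    [K] with its holes filled. *)
Definition escaping K : set M :=
  [set p | ~ K p /\ forall L, compact L -> ~ connected_component (~` K) p `<=` L].

(** For a filled set [V] is a whole component of the complement. Stating it with a [V] that may
    depend on [L] keeps just what is needed to carry a zero from [p] out of [L]. *)
Definition full K : Prop := forall p, ~ K p -> forall L, compact L ->
  exists V, [/\ open V, connected V, V p, V `<=` ~` K & ~ V `<=` L].

Lemma component_escaping K p : escaping K p ->
  connected_component (~` K) p `<=` escaping K.
Proof.
move=> [Kp H] q pq; split; first exact: connected_component_sub pq.
by rewrite -(same_connected_component pq).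
Qed.

(** The point is that filling the holes preserves compactness. A relatively compact component with a
    point outside a compact neighbourhood [K1] either meets the frontier [B] of [K1], and by
    compactness of [B] all these lie in one compact set, or it avoids [K1]; in the latter case it is
    open and closed, hence the whole surface, against non-compactness. *)
Lemma hull_exists K : compact K -> exists2 L, compact L /\ full L & K `<=` L.
Proof.
move=> cK; have clK : closed K by apply: compact_closed => //; exact: surface_hausdorff.
have oK : open (~` K) by rewrite openC.
have Cself p : ~ K p -> connected_component (~` K) p p by move=> Kp; exact: connected_component_refl.
have oE : open (escaping K).
  rewrite openE => p Ep; have oC := @component_open _ p oK.
  apply: filterS (component_escaping Ep) _.
  by apply: open_nbhs_nbhs; split => //; apply: Cself; case: Ep.
exists (~` escaping K); last by move=> p Kp [].
split; last first.
  move=> p /contrapT Ep L cL; exists (connected_component (~` K) p); split.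
  - exact: component_open.
  - exact: component_connected.
  - by apply: Cself; case: Ep.
  - by move=> q /(component_escaping Ep) ? .
  - by case: Ep => _; apply.
have [K1 cK1 KK1] := compact_nbhd cK.
have clK1 : closed K1 by apply: compact_closed => //; exact: surface_hausdorff.
pose B := K1 `\` K1°.
have cB : compact B.
  apply: subclosed_compact cK1 _; last by move=> x [].
  by rewrite /B setDE; apply: closedI => //; apply: open_closedC; exact: open_interior.
have BK x : B x -> ~ K x by move=> [_ nx] /KK1.
pose P (A : set M) := exists2 L, compact L & forall b, A b -> ~ K b -> ~ escaping K b ->
  connected_component (~` K) b `<=` L.
have [L cL HL] : P B.
  apply: (compact_induction cB).
  - by exists set0; [exact: compact0|].
  - move=> A1 A2 [L1 c1 H1] [L2 c2 H2]; exists (L1 `|` L2); first exact: compactU.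
    move=> b [/H1 h|/H2 h] Kb Eb x /(h Kb Eb); [by left|by right].
  - by move=> A1 A2 A21 [L cL H]; exists L => // b /A21/H.
  move=> x /BK Kx; exists (connected_component (~` K) x).
    by apply: open_nbhs_nbhs; split; [exact: component_open|exact: Cself].
  have [Ex|nEx] := pselect (escaping K x).
    by exists set0; [exact: compact0|move=> b /(component_escaping Ex) Eb _ []].
  have [L cL HL] : exists2 L, compact L & connected_component (~` K) x `<=` L.
    by apply: contrapT => H; apply: nEx; split=> // L cL xL; apply: H; exists L.
  by exists L => // b /same_connected_component <-.
apply: (subclosed_compact _ (compactU cK1 cL)); first exact: open_closedC.
move=> p nEp; apply: contrapT => nKL.
have nK1 : ~ K1 p by move=> ?; apply: nKL; left.
have nL : ~ L p by move=> ?; apply: nKL; right.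
have Kp : ~ K p by move=> /KK1/interior_subset.
apply: nEp; split=> // K' cK' VK'; set V := connected_component (~` K) p in VK'.
have oV : open V by exact: component_open.
have cV : connected V by exact: component_connected.
have [[b [Vb Bb]]|nVB] := pselect (V `&` B !=set0).
  apply: nL; apply: (HL b Bb (BK _ Bb)); last first.
    by rewrite -(same_connected_component Vb); exact: Cself.
  by move=> [_ /(_ _ cK')]; rewrite -(same_connected_component Vb).
(* [V] misses the frontier, so it meets [K1] in a set that is open and closed in [V]; this set is
   not [V], since [p] is outside [K1]. *)
have VK1 x : V x -> ~ K1 x.
  move=> Vx K1x; have VI : V `&` K1 = V `&` K1°.
    apply/seteqP; split=> y [Vy y1]; split => //; last exact: interior_subset.
    by apply: contrapT => ny; apply: nVB; exists y.
  have VE : V `&` K1 = V.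
    apply: cV; first by exists x.
      by exists K1°; [exact: open_interior|].
    by exists K1.
  have Vp : V p by exact: Cself.
  by apply: nK1; move: Vp; rewrite -VE => -[].
have clV : closed V.
  rewrite -openC openE => x nVx; have [Kx|Kx] := pselect (K x).
    by apply: filterS (KK1 _ Kx) => y K1y /VK1.
  have oC := @component_open _ x oK.
  apply: filterS (open_nbhs_nbhs (conj oC (Cself _ Kx))) => y xy Vy; apply: nVx.
  apply: connected_component_trans Vy _; exact: connected_component_sym.
have VT : V = setT.
  apply: (@surface_connected R M); first by exists p; exact: Cself.
    by exists V => //; rewrite setTI.
  by exists V => //; rewrite setTI.
apply: ncM; rewrite -VT; apply: subclosed_compact clV cK' VK'.
Qed.

(** The set of index [n] contains the basic open set numbered [n], whenever that one lies in some
    compact set; such basic sets already cover the surface, which is locally compact. *)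
Lemma countable_compact_cover : exists2 E : nat -> set M,
  (forall n, compact (E n)) & forall p, exists n, E n p.
Proof.
have [B /countable_injP[e einj] [Bo Bb]] := @surface_second_countable R M.
have H n : exists L : set M, compact L /\
    forall b, B b -> e b = n -> (exists2 L', compact L' & b `<=` L') -> b `<=` L.
  have [[b [Bb' ebn [L cL bL]]]|nb] :=
      pselect (exists b, [/\ B b, e b = n & exists2 L', compact L' & b `<=` L']).
    exists L; split => // b' Bb'' eb' _.
    by rewrite (einj b' b) ?inE// eb'.
  by exists set0; split; [exact: compact0|move=> b b1 b2 b3; exfalso; apply: nb; exists b].
have [E HE] := choice H; exists E => [n|p]; first by case: (HE n).
have [D [L [oD _ Dp cL [DL _]]]] := surface_nbhs (@filterT _ (nbhs p) _).
have [b [Bb' bp] bD] := Bb p D (open_nbhs_nbhs (conj oD Dp)).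
exists (e b); have [_ h] := HE (e b); apply: (h b) => //.
by exists L => // x /bD/DL.
Qed.

Lemma full_exhaustion : exists K : nat -> set M, [/\
  forall n, compact (K n), forall n, full (K n),
  forall n, K n `<=` (K n.+1)° & forall p, exists n, K n p].
Proof.
have [E cE HE] := countable_compact_cover.
have step (n : nat) (K : {K : set M | compact K /\ full K}) :
    {L : {K : set M | compact K /\ full K} | sval K `<=` (sval L)° /\ E n `<=` sval L}.
  apply: cid; case: K => K [cK fK] /=.
  have [K1 cK1 KK1] := compact_nbhd cK.
  have [L [cL fL] K1L] := hull_exists (compactU cK1 (cE n)).
  exists (exist _ L (conj cL fL)); split=> [x /KK1|x Ex] /=.
    by apply: filterS => y K1y; apply: K1L; left.
  by apply: K1L; right.
have K0 : {K : set M | compact K /\ full K}.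
  by apply: cid; have [L ? _] := hull_exists (@compact0 M); exists L.
pose K := fix K n := if n is m.+1 then sval (step m (K m)) else K0.
exists (fun n => sval (K n)); split=> [n|n|n|p].
- by have [] := svalP (K n).
- by have [] := svalP (K n).
- by have [] := svalP (step n (K n)).
- by have [n En] := HE p; exists n.+1; have [_] := svalP (step n (K n)); exact.
Qed.

End Exhaustion.

(** * Generic linear forms *)

(** [Baire] is applied to such row vectors in [meager_neq_setT]. *)
HB.instance Definition _ (R : realType) (m n : nat) :=
  Complete.on 'M[R]_(m.+1, n.+1).

(** * Meager sets and images of Lipschitz maps *)

Section Meager.
Variable R : realType.

Definition cube n (a : 'rV[R]_n) (r : R) : set 'rV[R]_n :=
  [set x | forall i, `|x 0 i - a 0 i| < r].

Definition box m : set 'rV[R]_m := [set s | forall i, 0 <= s 0 i <= 1].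

(** Equivalent to the closure having empty interior, in a form suited to counting cubes. *)
Definition nowhere_dense n (T : set 'rV[R]_n) : Prop :=
  forall (a : 'rV[R]_n) (r : R), 0 < r -> exists b (e : R), [/\ 0 < e, cube b e `<=` cube a r &
    forall x, cube b e x -> ~ T x].

(* Pigeonhole: among k ^ n disjoint small cubes, two would meet the image of the
   same one of the (k c + 1) ^ m cells of the box. *)
Lemma lipschitz_nowhere_dense m n (psi : 'rV[R]_m -> 'rV[R]_n) (L : R) : (m < n)%N ->
  (forall (s t : 'rV[R]_m) (d : R), box s -> box t -> (forall i, `|s 0 i - t 0 i| <= d) ->
     forall k, `|psi s 0 k - psi t 0 k| <= L * d) ->
  nowhere_dense (psi @` @box m).
Proof.
move=> mn HL a r r0; apply: contrapT => Hno.
(* A cell of side [1 / N] has an image of width at most [L / N <= r / (2 k) = 2 e], whereas points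
   of different cubes, of half-side [e] and centred on a grid of step [4 e], differ by more than
   [2 e] in some coordinate. *)
have [c [c0 Hc]] : exists c : nat, (0 < c)%N /\ 2 * L / r <= c%:R.
  exists (Num.truncn (`|2 * L / r|)).+1; split => //.
  have /andP[_ /ltW h] := truncn_itv (normr_ge0 (2 * L / r)).
  exact: le_trans (ler_norm _) h.
(* As [k > (c + 1) ^ m], the [k ^ n >= k ^ (m + 1)] cubes outnumber the
   [(N + 1) ^ m <= (k (c + 1)) ^ m] cells. The extra cell on each axis is for the coordinate 1. *)
pose k := ((c.+1) ^ m).+1; pose N := (k * c)%N.
have k0 : 0 < (k%:R : R) by rewrite ltr0n.
have N0 : 0 < (N%:R : R) by rewrite ltr0n muln_gt0.
pose ctr (I : {ffun 'I_n -> 'I_k}) : 'rV[R]_n :=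
  \row_j (a 0 j - r / 2 + r / k%:R * (I j)%:R).
pose e := r / (4 * k%:R).
have e0 : 0 < e by rewrite divr_gt0// mulr_gt0.
have eE : 4 * e = r / k%:R by rewrite /e; field; rewrite gt_eqF.
have k1 : 1 <= (k%:R : R) by rewrite ler1n.
have er : 4 * e <= r by rewrite eE ler_pdivrMr// ler_peMr// ltW.
have sub I : cube (ctr I) e `<=` cube a r.
  move=> x Hx j; have := Hx j; rewrite mxE !ltr_norml => /andP[x1 x2].
  have I0 : 0 <= r / k%:R * (I j)%:R by rewrite mulr_ge0// ltW// divr_gt0.
  have I1 : r / k%:R * (I j)%:R <= r - 4 * e.
    have ij : (I j)%:R + 1 <= k%:R :> R by rewrite natr1 ler_nat.
    have rk : r / k%:R * k%:R = r by rewrite divfK// gt_eqF.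
    have rk0 : 0 < r / k%:R by rewrite divr_gt0.
    by rewrite eE; nra.
  by apply/andP; split; lra.
have meets I : exists s, box s /\ cube (ctr I) e (psi s).
  apply: contrapT => nI; apply: Hno; exists (ctr I), e; split => // x xI [s bs E].
  by apply: nI; exists s; rewrite E.
have [S HS] := choice meets.
pose cell I : {ffun 'I_m -> 'I_N.+1} := [ffun i => inord (Num.truncn (N%:R * S I 0 i))].
have : ~ injective cell.
  move=> /leq_card; rewrite !card_ffun !card_ord leqNgt => /negP; apply.
  apply: (@leq_trans (k ^ m.+1)); last exact: leq_pexp2l.
  rewrite expnSr; apply: (@leq_ltn_trans ((k * c.+1) ^ m)).
    case: (m) => // m'; rewrite leq_exp2r// /N mulnS -addn1 addnC leq_add2r.
    by [].
  by rewrite expnMn ltn_pmul2l// expn_gt0.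
apply => I I' EI; apply/ffunP => j; apply/eqP/negPn/negP => nIj.
have [bs Cs] := HS I; have [bs' Cs'] := HS I'.
have close i : `|S I 0 i - S I' 0 i| <= N%:R^-1.
  have := congr1 (fun g : {ffun 'I_m -> 'I_N.+1} => val (g i)) EI; rewrite !ffunE /=.
  have trb J : (forall i, 0 <= S J 0 i <= 1) ->
      (Num.truncn (N%:R * S J 0%R i)%R < N.+1)%N /\
      (Num.truncn (N%:R * S J 0 i))%:R <= N%:R * S J 0 i < (Num.truncn (N%:R * S J 0 i)).+1%:R.
    move=> /(_ i)/andP[s0 s1]; have h := truncn_itv (mulr_ge0 (ltW N0) s0).
    split => //; have /andP[h1 _] := h.
    by rewrite ltnS -(ler_nat R); apply: le_trans h1 _; rewrite ler_piMr// ltW.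
  have [l1 /andP[a1 a2]] := trb _ bs; have [l2 /andP[b1 b2]] := trb _ bs'.
  rewrite !inordK// => E; rewrite E in a1 a2.
  rewrite -[leRHS]mulr1 ler_pdivlMl// -[X in X * _](gtr0_norm N0) -normrM mulrBr.
  by rewrite ler_norml; move: a2 b2; rewrite -natr1 => a2 b2; apply/andP; split; lra.
have := HL _ _ _ bs bs' close j.
have LN : L / N%:R <= 2 * e.
  rewrite ler_pdivrMr// /N natrM.
  have -> : 2 * e * (k%:R * c%:R) = r * c%:R / 2 by rewrite /e; field; rewrite gt_eqF.
  by move: Hc; rewrite ler_pdivrMr//; lra.
have := Cs j; have := Cs' j; rewrite !mxE -eE !ltr_norml => /andP[u1 u2] /andP[v1 v2].
rewrite ler_norml => /andP[w1 w2].
have [lt|lt|E] := ltngtP (I j) (I' j).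
- have : (I j)%:R + 1 <= (I' j)%:R :> R by rewrite natr1 ler_nat.
  by nra.
- have : (I' j)%:R + 1 <= (I j)%:R :> R by rewrite natr1 ler_nat.
  by nra.
by move/eqP: nIj; apply; apply: val_inj.
Qed.

Definition meager n (S : set 'rV[R]_n) : Prop :=
  exists2 T : nat -> set 'rV[R]_n, (forall i, nowhere_dense (T i)) & S `<=` \bigcup_i T i.

Lemma meager_sub n (S S' : set 'rV[R]_n) : S `<=` S' -> meager S' -> meager S.
Proof. by move=> SS' [T HT ST]; exists T => // x /SS'/ST. Qed.

Lemma nowhere_dense0 n : nowhere_dense (set0 : set 'rV[R]_n).
Proof. by move=> a r r0; exists a, r; split => // x _ []. Qed.

Lemma nowhere_dense_meager n (T : set 'rV[R]_n) : nowhere_dense T -> meager T.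
Proof. by move=> HT; exists (fun=> T) => // x Tx; exists 0%N. Qed.

Lemma meager_bigcup (I : countType) n (S : I -> set 'rV[R]_n) :
  (forall i, meager (S i)) -> meager (\bigcup_i S i).
Proof.
move=> H; have H' i : exists T : nat -> set 'rV[R]_n,
    (forall i, nowhere_dense (T i)) /\ S i `<=` \bigcup_k T k.
  by have [T] := H i; exists T.
have [T HT] := choice H'.
exists (fun n => if unpickle n is Some (i, k) then T i k else set0).
  by move=> k; case: (unpickle k) => [[i l]|]; [have [] := HT i|exact: nowhere_dense0].
move=> x [i _ Sx]; have [_ /(_ x Sx)[k _ Tx]] := HT i.
by exists (pickle (i, k)) => //; rewrite pickleK.
Qed.

Lemma cube_nbhs n (a : 'rV[R]_n.+1) (A : set 'rV[R]_n.+1) :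
  nbhs a A <-> exists2 r : R, 0 < r & cube a r `<=` A.
Proof.
split=> [/nbhs_ballP[r /= r0 Hr]|[r r0 Hr]].
  exists r => // x Hx; apply: Hr; split=> // i j; rewrite (ord1 i).
  by rewrite /ball /= distrC; exact: Hx.
apply/nbhs_ballP; exists r => //= x [_ Hx]; apply: Hr => j.
by have := Hx 0 j; rewrite /ball /= distrC.
Qed.

Lemma meager_neq_setT n (S : set 'rV[R]_n.+1) : meager S -> exists x, ~ S x.
Proof.
move=> [T HT ST].
have H i : open (~` closure (T i)) /\ dense (~` closure (T i)).
  split; first by rewrite openC; exact: closed_closure.
  move=> O [a Oa] oO; have [r r0 Hr] := (cube_nbhs a O).1 (open_nbhs_nbhs (conj oO Oa)).
  have [b [e [e0 ba HbT]]] := HT i a r r0.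
  have bb : cube b e b by move=> k; rewrite subrr normr0.
  exists b; split; first by apply/Hr/ba.
  move=> /(_ (cube b e)) []; first by apply/cube_nbhs; exists e.
  by move=> y [Ty by_]; exact: HbT by_ Ty.
have setT0 : [set: 'rV[R]_n.+1] !=set0 by exists 0.
have [x [_ Hx]] := Baire H setT0 openT.
exists x => /ST[i _ Ti]; have := Hx i I; apply.
exact: subset_closure.
Qed.

End Meager.

Section Lipschitz.
Variables (R : realType) (m : nat).
Local Notation C := R[i].
Implicit Types (g h : 'rV[R]_m -> R) (s t : 'rV[R]_m).

(** The distance enters through a common bound [d] of the coordinate differences, which spares the
    maximum norm. *)
Definition lip g : Prop := exists2 L : R, 0 <= L & forall s t (d : R), box s -> box t ->
  (forall i, `|s 0 i - t 0 i| <= d) -> `|g s - g t| <= L * d.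

Lemma lip_bounded g : lip g -> exists2 B : R, 0 <= B & forall s, box s -> `|g s| <= B.
Proof.
move=> [L L0 H]; exists (`|g 0| + L); first by rewrite addr_ge0.
move=> s bs; have b0 : @box R m 0 by move=> i; rewrite mxE lexx ler01.
have h : `|g s - g 0| <= L * 1.
  apply: H => // i; rewrite mxE subr0; have /andP[s0 s1] := bs i.
  by rewrite ger0_norm.
have := ler_normD (g s - g 0) (g 0); rewrite subrK; lra.
Qed.

Lemma lip_cst (a : R) : lip (fun=> a).
Proof. by exists 0 => // s t d _ _ _; rewrite subrr normr0 mul0r. Qed.

Lemma lip_coord i : lip (fun s => s 0 i).
Proof. by exists 1 => // s t d _ _ H; rewrite mul1r. Qed.

Lemma lipD g h : lip g -> lip h -> lip (fun s => g s + h s).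
Proof.
move=> [L L0 H] [L' L'0 H']; exists (L + L'); first exact: addr_ge0.
move=> s t d bs bt st; rewrite opprD addrACA mulrDl.
by apply: le_trans (ler_normD _ _) _; apply: lerD; [exact: H|exact: H'].
Qed.

Lemma lipN g : lip g -> lip (fun s => - g s).
Proof.
move=> [L L0 H]; exists L => // s t d bs bt st.
by rewrite -opprD normrN; exact: H.
Qed.

Lemma lipM g h : lip g -> lip h -> lip (fun s => g s * h s).
Proof.
move=> Hg Hh; have [B B0 HB] := lip_bounded Hg; have [B' B'0 HB'] := lip_bounded Hh.
move: Hg Hh => [L L0 H] [L' L'0 H']; exists (B * L' + L * B').
  by rewrite addr_ge0 ?mulr_ge0.
move=> s t d bs bt st.
have -> : g s * h s - g t * h t = g s * (h s - h t) + (g s - g t) * h t by ring.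
apply: le_trans (ler_normD _ _) _; rewrite !normrM mulrDl -mulrA [L * B' * d]mulrAC.
by apply: lerD; apply: ler_pM => //; [exact: HB|exact: H'|exact: H|exact: HB'].
Qed.

Definition clip (h : 'rV[R]_m -> C) : Prop :=
  lip (fun s => complex.Re (h s)) /\ lip (fun s => complex.Im (h s)).

Lemma lip_congr g h : (forall s, g s = h s) -> lip g -> lip h.
Proof. by move=> E [L L0 H]; exists L => // s t d bs bt st; rewrite -!E; exact: H. Qed.

Lemma clipD (g h : 'rV[R]_m -> C) : clip g -> clip h -> clip (fun s => g s + h s).
Proof.
move=> [gR gI] [hR hI]; split.
  by apply: lip_congr (lipD gR hR) => s; rewrite raddfD.
by apply: lip_congr (lipD gI hI) => s; rewrite raddfD.
Qed.

Lemma clipN (h : 'rV[R]_m -> C) : clip h -> clip (fun s => - h s).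
Proof.
move=> [hR hI]; split.
  by apply: lip_congr (lipN hR) => s; rewrite raddfN.
by apply: lip_congr (lipN hI) => s; rewrite raddfN.
Qed.

Lemma clipM (g h : 'rV[R]_m -> C) : clip g -> clip h -> clip (fun s => g s * h s).
Proof.
move=> [gR gI] [hR hI]; split.
  apply: lip_congr (lipD (lipM gR hR) (lipN (lipM gI hI))) => s.
  by case: (g s) (h s) => [a b] [c d].
apply: lip_congr (lipD (lipM gR hI) (lipM gI hR)) => s.
by case: (g s) (h s) => [a b] [c d].
Qed.

Lemma clip_comp (u : C -> C) (z : 'rV[R]_m -> C) (c : C) (r K : R) : clip z -> 0 <= K ->
  (forall s, box s -> normc (z s - c) <= r) ->
  (forall w w', normc (w - c) <= r -> normc (w' - c) <= r ->
     normc (u w' - u w) <= K * normc (w' - w)) ->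
  clip (fun s => u (z s)).
Proof.
move=> [[L L0 H] [L' L'0 H']] K0 zr Hu.
have P s t (d : R) : box s -> box t -> (forall i, `|s 0 i - t 0 i| <= d) ->
    normc (u (z s) - u (z t)) <= K * (L + L') * d.
  move=> bs bt st; apply: le_trans (Hu _ _ (zr _ bt) (zr _ bs)) _.
  rewrite -mulrA ler_wpM2l//; apply: le_trans (normc_le_ReIm _) _.
  by rewrite !raddfB mulrDl; apply: lerD; [exact: H|exact: H'].
have KL : 0 <= K * (L + L') by rewrite mulr_ge0 ?addr_ge0.
split; exists (K * (L + L')) => // s t d bs bt st.
  rewrite -raddfB; apply: le_trans (ler_Re_normc _) _; exact: P.
rewrite -raddfB; apply: le_trans (ler_Im_normc _) _; exact: P.
Qed.

Lemma lip_nowhere_dense n (psi : 'rV[R]_m -> 'rV[R]_n) : (0 < m < n)%N ->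
  (forall k, lip (fun s => psi s 0 k)) -> nowhere_dense (psi @` @box R m).
Proof.
move=> /andP[m0 mn] H; have H' k : exists L : R, 0 <= L /\ forall s t (d : R), box s -> box t ->
    (forall i, `|s 0 i - t 0 i| <= d) -> `|psi s 0 k - psi t 0 k| <= L * d.
  by have [L] := H k; exists L.
have [L HL] := choice H'.
apply: (@lipschitz_nowhere_dense R m n psi (\sum_k L k)) => // s t d bs bt st k.
have d0 : 0 <= d by apply: le_trans (st (Ordinal m0)).
have [L0 Hk] := HL k.
have sub : L k <= \sum_k L k.
  by rewrite (bigD1 k)//= lerDl sumr_ge0// => i _; case: (HL i).
by apply: le_trans (Hk s t d bs bt st) _; rewrite ler_wpM2r.
Qed.

End Lipschitz.

Lemma fin_radius (R : realType) (I : finType) (P : I -> R -> Prop) :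
  (forall i r r', P i r -> 0 < r' -> r' <= r -> P i r') ->
  (forall i, exists2 r, 0 < r & P i r) -> exists2 r, 0 < r & forall i, P i r.
Proof.
move=> mono H; have H' i : exists r, 0 < r /\ P i r by have [r] := H i; exists r.
have [r Hr] := choice H'.
have s0 : 0 <= \sum_i (r i)^-1 by rewrite sumr_ge0// => i _; rewrite invr_ge0 ltW//; case: (Hr i).
have p0 : 0 < 1 + \sum_i (r i)^-1 by rewrite ltr_pwDl.
(* A positive number below every [r i], meaningful for an empty [I] as well. *)
exists (1 + \sum_i (r i)^-1)^-1; first by rewrite invr_gt0.
move=> i; have [ri0 Pi] := Hr i; apply: mono Pi _ _; first by rewrite invr_gt0.
rewrite -[leRHS]invrK lef_pV2 ?posrE ?invr_gt0//.
rewrite (bigD1 i)//= addrCA lerDl addr_ge0// sumr_ge0// => k _.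
by rewrite invr_ge0 ltW//; case: (Hr k).
Qed.

(** * Cross products in C^3 *)

Section Cross.
Variable R : realType.
Local Notation C := R[i].

Definition o0 : 'I_3 := @Ordinal 3 0 isT.
Definition o1 : 'I_3 := @Ordinal 3 1 isT.
Definition o2 : 'I_3 := @Ordinal 3 2 isT.

(** The cyclic shift of the coordinates, which gives all components of the cross product the same
    formula. *)
Definition rot3 (k : 'I_3) : 'I_3 :=
  match val k with 0 => o1 | 1 => o2 | _ => o0 end.

Lemma ord3P (k : 'I_3) : [\/ k = o0, k = o1 | k = o2].
Proof.
case: k => [[|[|[|k]]] ik] //.
- by apply: Or31; apply: val_inj.
- by apply: Or32; apply: val_inj.
- by apply: Or33; apply: val_inj.
Qed.

Lemma sum3 (g : 'I_3 -> C) : \sum_k g k = g o0 + g o1 + g o2.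
Proof.
rewrite !big_ord_recl big_ord0 addr0 addrA.
by congr (g _ + g _ + g _); apply: val_inj.
Qed.

(** Bilinear, without the conjugation of [dotmx]: [A] stands for a linear form. *)
Definition dotl (A v : 'rV[C]_3) : C := \sum_k A 0 k * v 0 k.

Definition crossk (u v : 'I_3 -> C) (k : 'I_3) : C :=
  u (rot3 k) * v (rot3 (rot3 k)) - u (rot3 (rot3 k)) * v (rot3 k).

(* [A x (u x w) = (A . w) u - (A . u) w] *)
Lemma orthogonal_cross (A u w : 'rV[C]_3) (j : 'I_3) : u 0 j = 1 -> w 0 j = 0 -> w != 0 ->
  dotl A u = 0 -> dotl A w = 0 ->
  exists l : C, forall k, A 0 k = l * crossk (fun k => u 0 k) (fun k => w 0 k) k.
Proof.
move=> uj wj w0; rewrite /dotl !sum3 /crossk.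
have wn0 : ~~ [&& w 0 o0 == 0, w 0 o1 == 0 & w 0 o2 == 0].
  apply: contra w0 => /and3P[/eqP e0 /eqP e1 /eqP e2].
  by apply/eqP/rowP => k; rewrite mxE; case: (ord3P k) => ->.
move=> Hu Hw.
set a0 := A 0 o0 in Hu Hw *; set a1 := A 0 o1 in Hu Hw *; set a2 := A 0 o2 in Hu Hw *.
set u0 := u 0 o0 in Hu *; set u1 := u 0 o1 in Hu *; set u2 := u 0 o2 in Hu *.
set v0 := w 0 o0 in Hw wn0 *; set v1 := w 0 o1 in Hw wn0 *; set v2 := w 0 o2 in Hw wn0 *.
pose x0 := u1 * v2 - u2 * v1; pose x1 := u2 * v0 - u0 * v2; pose x2 := u0 * v1 - u1 * v0.
have E01 : a0 * x1 = a1 * x0.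
  have : u2 * (a0 * v0 + a1 * v1 + a2 * v2) - v2 * (a0 * u0 + a1 * u1 + a2 * u2) = 0.
    by rewrite Hu Hw !mulr0 subrr.
  by move=> E; apply/eqP; rewrite -subr_eq0 -E; apply/eqP; rewrite /x0 /x1; ring.
have E12 : a1 * x2 = a2 * x1.
  have : u0 * (a0 * v0 + a1 * v1 + a2 * v2) - v0 * (a0 * u0 + a1 * u1 + a2 * u2) = 0.
    by rewrite Hu Hw !mulr0 subrr.
  by move=> E; apply/eqP; rewrite -subr_eq0 -E; apply/eqP; rewrite /x1 /x2; ring.
have E20 : a2 * x0 = a0 * x2.
  have : u1 * (a0 * v0 + a1 * v1 + a2 * v2) - v1 * (a0 * u0 + a1 * u1 + a2 * u2) = 0.
    by rewrite Hu Hw !mulr0 subrr.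
  by move=> E; apply/eqP; rewrite -subr_eq0 -E; apply/eqP; rewrite /x0 /x2; ring.
(* As [u] has j-th coordinate 1 and [w] has 0 there, two components of the cross product are, up to
   sign, the other two coordinates of [w]. *)
have xn0 : [|| x0 != 0, x1 != 0 | x2 != 0].
  move: wn0; rewrite /x0 /x1 /x2 !negb_and.
  case: (ord3P j) uj wj => ->; rewrite -/u0 -/u1 -/u2 -/v0 -/v1 -/v2 => -> ->.
  - rewrite eqxx /= !mulr0 !mul1r sub0r subr0 oppr_eq0.
    by move=> /orP[->|->]; rewrite ?orbT.
  - rewrite eqxx /= !mulr0 !mul1r sub0r subr0 oppr_eq0.
    by move=> /orP[->|->]; rewrite ?orbT.
  - rewrite eqxx /= !mulr0 !mul1r sub0r subr0 oppr_eq0 orbF.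
    by move=> /orP[->|->]; rewrite ?orbT.
have K l : a0 = l * x0 -> a1 = l * x1 -> a2 = l * x2 ->
  exists l, forall k, A 0 k = l * (u 0 (rot3 k) * w 0 (rot3 (rot3 k)) -
      u 0 (rot3 (rot3 k)) * w 0 (rot3 k)).
  by move=> e0 e1 e2; exists l => k; case: (ord3P k) => ->.
case/or3P: xn0 => xn0.
- by apply: (K (a0 / x0)); rewrite mulrAC; apply/eqP; rewrite eq_sym ?mulfK ?eqxx// ?E01 -?E20 ?mulfK.
- by apply: (K (a1 / x1)); rewrite mulrAC; apply/eqP; rewrite eq_sym -?E01 ?E12 ?mulfK.
- by apply: (K (a2 / x2)); rewrite mulrAC; apply/eqP; rewrite eq_sym ?E20 -?E12 ?mulfK.
Qed.

End Cross.

(** * Linear forms without degenerate zeros *)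

Section Generic.
Variables (R : realType) (M : riemannSurface R) (f : M -> CP2 R).
Hypothesis fC : conformal_immersion f.
Local Notation C := R[i].

Definition toC (x : 'rV[R]_(3 + 3)) : 'rV[C]_3 :=
  \row_k (x 0 (lshift 3 k) +i* x 0 (rshift 3 k)).

Lemma CC1_lipschitz (U : set C) (h : C -> C) (c : C) : open U -> CC 1 U h -> U c ->
  exists2 r : R, 0 < r & exists2 L : R, 0 <= L & forall z w,
    normc (z - c) <= r -> normc (w - c) <= r -> normc (h w - h z) <= L * normc (w - z).
Proof.
move=> oU [hR hI] Uc.
have [r1 [L1 [r10 L10 H1]]] := Ck1_lipschitz oU hR Uc.
have [r2 [L2 [r20 L20 H2]]] := Ck1_lipschitz oU hI Uc.
exists (Num.min r1 r2); first by rewrite lt_min r10.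
exists (L1 + L2); first exact: addr_ge0.
move=> z w; rewrite !le_min => /andP[z1 z2] /andP[w1 w2].
apply: le_trans (normc_le_ReIm _) _; rewrite !raddfB mulrDl.
by apply: lerD; [exact: H1|exact: H2].
Qed.

Lemma real_diff_lin m (U : set C) (F : C -> 'rV[C]_m) (z v : C) : open U -> U z -> vCC 1 U F ->
  real_diff F z v = (complex.Re v)%:C *: real_diff F z 1 + (complex.Im v)%:C *: real_diff F z 'i.
Proof.
move=> oU Uz CF; have := real_diff_comp v oU oU CF Uz Uz (cderiv_id z) (fun w _ => erefl).
by rewrite mul1r.
Qed.

Lemma unit_param (r x : R) : 0 < r -> `|x| <= r -> exists2 y, 0 <= y <= 1 & r * (2 * y - 1) = x.
Proof.
move=> r0; rewrite ler_norml => /andP[x1 x2]; exists ((x / r + 1) / 2).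
  have : -1 <= x / r by rewrite ler_pdivlMr// mulN1r.
  have : x / r <= 1 by rewrite ler_pdivrMr// mul1r.
  by move=> h1 h2; apply/andP; split; lra.
by field; rewrite gt_eqF.
Qed.

Lemma dotlZ (A v : 'rV[C]_3) (a : C) : dotl A (a *: v) = a * dotl A v.
Proof. by rewrite /dotl mulr_sumr; apply: eq_bigr => k _; rewrite mxE mulrCA. Qed.

(** Only the real direction of [v] matters, so [v] is rescaled to make its larger coordinate 1 and
    the other one some [t] in [-1, 1]; [b] records which is which. This leaves one parameter with
    compact range for the direction. *)
Lemma cross_select (D : C -> 'rV[C]_3) (A u : 'rV[C]_3) (v : C) :
  (forall w k, D w 0 k = (complex.Re w)%:C * D 1 0 k + (complex.Im w)%:C * D 'i 0 k) ->
  v != 0 -> dotl A (D v) = 0 ->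
  (forall w, w != 0 -> dotl A (D w) = 0 -> exists l : C, forall k,
     A 0 k = l * crossk (fun k => u 0 k) (fun k => D w 0 k) k) ->
  exists (l : C) (b : bool) (t : R), `|t| <= 1 /\ forall k, A 0 k = l *
    crossk (fun k => u 0 k) (fun k => if b then D 1 0 k + t%:C * D 'i 0 k
                                      else t%:C * D 1 0 k + D 'i 0 k) k.
Proof.
move=> linE v0 A2 key.
have scal (a : R) (w : C) : dotl A (D (a%:C * w)) = a%:C * dotl A (D w).
  have Rw : complex.Re (a%:C * w) = a * complex.Re w by case: (w) => w1 w2 /=; ring.
  have Iw : complex.Im (a%:C * w) = a * complex.Im w by case: (w) => w1 w2 /=; ring.
  rewrite -dotlZ; congr dotl; apply/rowP => k.
  by rewrite mxE (linE (a%:C * w)) (linE w) Rw Iw !rmorphM mulrDr !mulrA.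
have [h|h] := leP `|complex.Im v| `|complex.Re v|.
  have Rv0 : complex.Re v != 0.
    apply: contra v0 => /eqP E; rewrite E normr0 normr_le0 in h.
    by rewrite eq_complex E (eqP h) /= !eqxx.
  pose t := complex.Im v / complex.Re v.
  have [w [Rw Iw w0 Aw]] : exists w : C, [/\ complex.Re w = 1, complex.Im w = t, w != 0 &
      dotl A (D w) = 0].
    exists ((complex.Re v)^-1%:C * v); split.
    - by case: (v) Rv0 => a b /= a0; rewrite mul0r subr0 mulVf.
    - by rewrite /t; case: (v) => a b /=; rewrite mul0r addr0 mulrC.
    - by rewrite mulf_neq0// fmorph_eq0 invr_eq0.
    - by rewrite scal A2 mulr0.
  have [l Hl] := key w w0 Aw; exists l, true, t; split.
    by rewrite normrM normfV ler_pdivrMr ?normr_gt0// mul1r.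
  move=> k; rewrite Hl /crossk; have L k' := linE w k'.
  by rewrite !L Rw Iw !mul1r.
have Iv0 : complex.Im v != 0.
  by apply: contraTneq h => ->; rewrite normr0 -leNgt.
pose t := complex.Re v / complex.Im v.
have [w [Rw Iw w0 Aw]] : exists w : C, [/\ complex.Re w = t, complex.Im w = 1, w != 0 &
    dotl A (D w) = 0].
  exists ((complex.Im v)^-1%:C * v); split.
  - by rewrite /t; case: (v) => a b /=; rewrite mul0r subr0 mulrC.
  - by case: (v) Iv0 => a b /= a0; rewrite mul0r addr0 mulVf.
  - by rewrite mulf_neq0// fmorph_eq0 invr_eq0.
  - by rewrite scal A2 mulr0.
have [l Hl] := key w w0 Aw; exists l, false, t; split.
  by rewrite normrM normfV ler_pdivrMr ?normr_gt0// mul1r ltW.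
move=> k; rewrite Hl /crossk; have L k' := linE w k'.
by rewrite !L Rw Iw !mul1r.
Qed.

(** The form vanishes on the line [f p], and the real differential at [p] of its restriction to the
    lines has a kernel. *)
Definition degenerate (c : chart R M) j (p : M) (A : 'rV[C]_3) : Prop :=
  dotl A (affine_coord j (f p)) = 0 /\
  exists2 v : C, v != 0 & dotl A (diff_to_CP2 f c j p v) = 0.

Lemma degenerate_cross c j p A : charts_at f p c j -> degenerate c j p A ->
  exists (l : C) (b : bool) (t : R), `|t| <= 1 /\ forall k, A 0 k = l *
    crossk (fun k => affine_coord j (f p) 0 k) (fun k =>
      if b then diff_to_CP2 f c j p 1 0 k + t%:C * diff_to_CP2 f c j p 'i 0 k
      else t%:C * diff_to_CP2 f c j p 1 0 k + diff_to_CP2 f c j p 'i 0 k) k.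
Proof.
move=> ch; have [ac cp jp] := ch; move=> [A1 [v v0 A2]].
pose U := chart_map c @` (f @^-1` affine_dom j `&` chart_dom c).
have oU : open U by apply: chart_image_open; exact: (open_affine fC).
have Uz : U (chart_map c p) by exists p.
have CF n : vCC n U (affine_coord j \o f \o chart_inv c) := smooth_affine fC j n ac.
have lin w := real_diff_lin w oU Uz (CF 1%N).
have [_ /(_ p c j ch) Dinj _] := fC.
(* The j-th coordinate of [affine_coord j] is constantly 1. Together with the 0 obtained here, this
   is the normalisation required by [orthogonal_cross]. *)
have Dj w : diff_to_CP2 f c j p w 0 j = 0.
  have cst1 (g : C -> R) (a : R) : (forall z, U z -> g z = a) ->
      real_dir_derive g w (chart_map c p) = 0.
    move=> ga; rewrite /real_dir_derive derive1E.
    have E : \forall t \near (0 : R), cst a t = (g \o real_line (chart_map c p) w) t.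
      by apply: filterS (near_real_line w oU Uz) => t /ga.
    by have [_] := near_eq_is_derive E (is_derive_cst a (0 : R) (1 : R)).
  rewrite /diff_to_CP2 /real_diff mxE (cst1 _ 1) ?(cst1 _ 0)//.
    by move=> _ [q [jq cq] <-]; rewrite /= chart_mapK// affine_coordE.
  by move=> _ [q [jq cq] <-]; rewrite /= chart_mapK// affine_coordE.
have key (w : C) : w != 0 -> dotl A (diff_to_CP2 f c j p w) = 0 -> exists l : C, forall k,
    A 0 k = l * crossk (fun k => affine_coord j (f p) 0 k) (fun k => diff_to_CP2 f c j p w 0 k) k.
  move=> w0 Aw; apply: (orthogonal_cross _ (Dj w) _ A1 Aw); first exact: affine_coordE.
  by apply: contra w0 => /eqP/Dinj ->.
have linE w k : diff_to_CP2 f c j p w 0 k = (complex.Re w)%:C * diff_to_CP2 f c j p 1 0 k +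
    (complex.Im w)%:C * diff_to_CP2 f c j p 'i 0 k.
  have /= := lin w; rewrite /diff_to_CP2.
  by move: (real_diff _ _ 1) (real_diff _ _ 'i) => D1 Di ->; rewrite !mxE.
exact: (cross_select linE v0 A2 key).
Qed.

(** By [degenerate_cross] the degenerate forms are covered by countably many images [psi (b, n)] of
    the box of dimension 5. These maps are polynomial in the coordinates of [f] and its first
    derivatives, hence Lipschitz over a small disc, and their images in R^6 are nowhere dense. *)
Lemma degenerate_meager (p : M) : exists (c : chart R M) (j : 'I_3) (N : set M), [/\ nbhs p N,
  forall q, N q -> charts_at f q c j &
  meager [set x | exists2 q, N q & degenerate c j q (toC x)]].
Proof.
have [c ac cp] := atlas_cover p; have [j jp] := affine_dom_ex (f p).
pose U := chart_map c @` (f @^-1` affine_dom j `&` chart_dom c).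
have oU : open U by apply: chart_image_open; exact: (open_affine fC).
set z0 := chart_map c p; have Uz : U z0 by exists p.
pose F : C -> 'rV[C]_3 := affine_coord j \o f \o chart_inv c.
have CF n : vCC n U F := smooth_affine fC j n ac.
pose h (i : 'I_3 * 'I_3) : C -> C := fun z =>
  if val i.1 is 0 then F z 0 i.2 else
  if val i.1 is 1 then real_diff F z 1 0 i.2 else real_diff F z 'i 0 i.2.
have v1 : (1 : C) = 1 \/ (1 : C) = 'i by left.
have vi : ('i : C) = 1 \/ ('i : C) = 'i by right.
have Ch i : CC 1 U (h i).
  case: i => i k; case: (ord3P i) => ->; rewrite /h /=.
  - exact: CF.
  - exact: (vCC_real_diff oU v1 (CF 2%N)).
  - exact: (vCC_real_diff oU vi (CF 2%N)).
have [r r0 Hr] : exists2 r : R, 0 < r & forall i, (forall z, normc (z - z0) < r -> U z) /\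
    exists2 L : R, 0 <= L & forall z w,
    normc (z - z0) <= r -> normc (w - z0) <= r -> normc (h i w - h i z) <= L * normc (w - z).
  apply: fin_radius => [i r r' [H1 [L L0 H]] r'0 r'r|i].
    split=> [z zr|]; first by apply: H1; exact: lt_le_trans r'r.
    by exists L => // z w zr wr; apply: H; exact: le_trans r'r.
  have [r r0 [L L0 H]] := CC1_lipschitz oU (Ch i) Uz.
  have [r' r'0 H'] := open_complexP oU Uz.
  exists (Num.min r r'); first by rewrite lt_min r0.
  split=> [z|]; first by rewrite lt_min => /andP[_]; exact: H'.
  exists L => // z w; rewrite !le_min => /andP[zr _] /andP[wr _]; exact: H.
(* The parameters [k0] and [k1] sweep the square of half-side [e] about [z0]. It contains the disc
   of radius [e] and lies in the disc of radius [2 e = r], where the Lipschitz bounds hold. *)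
have [e e0 rE] : exists2 e : R, 0 < e & r = 2 * e.
  by exists (r / 2); [rewrite divr_gt0|field].
pose k0 : 'I_5 := @Ordinal 5 0 isT. pose k1 : 'I_5 := @Ordinal 5 1 isT.
pose k2 : 'I_5 := @Ordinal 5 2 isT. pose k3 : 'I_5 := @Ordinal 5 3 isT.
pose k4 : 'I_5 := @Ordinal 5 4 isT.
pose z (s : 'rV[R]_5) : C := z0 + ((e * (2 * s 0 k0 - 1)) +i* (e * (2 * s 0 k1 - 1))).
(* The factor [l] ranges over all of C, which is exhausted by the squares of half-side [n + 1]; this
   is where a countable union is needed. *)
pose lam (n : nat) (s : 'rV[R]_5) : C :=
  (n.+1%:R * (2 * s 0 k2 - 1)) +i* (n.+1%:R * (2 * s 0 k3 - 1)).
pose t (s : 'rV[R]_5) : R := 2 * s 0 k4 - 1.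
pose w (b : bool) s k : C :=
  if b then h (o1, k) (z s) + (t s)%:C * h (o2, k) (z s)
  else (t s)%:C * h (o1, k) (z s) + h (o2, k) (z s).
pose Psi (bn : bool * nat) s k : C :=
  lam bn.2 s * crossk (fun k => h (o0, k) (z s)) (w bn.1 s) k.
pose psi bn (s : 'rV[R]_5) : 'rV[R]_(3 + 3) :=
  \row_i match fintype.split i with inl k => complex.Re (Psi bn s k)
                          | inr k => complex.Im (Psi bn s k) end.
have lipa (a : R) i : lip (fun s : 'rV[R]_5 => a * (2 * s 0 i - 1)).
  apply: lipM; first exact: lip_cst.
  apply: lipD; last exact: lip_cst.
  by apply: lipM; [exact: lip_cst|exact: lip_coord].
have clz : clip z.
  split.
    by apply: lip_congr (lipD (lip_cst _ (complex.Re z0)) (lipa e k0)) => s; rewrite /z raddfD.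
  by apply: lip_congr (lipD (lip_cst _ (complex.Im z0)) (lipa e k1)) => s; rewrite /z raddfD.
have zr s : box s -> normc (z s - z0) <= r.
  move=> bs; rewrite /z addrAC subrr add0r.
  apply: le_trans (normc_le_ReIm _) _ => /=; rewrite !normrM (gtr0_norm e0).
  have B i : `|2 * s 0 i - 1| <= 1.
    by have /andP[] := bs i; rewrite ler_norml => b1 b2; apply/andP; split; lra.
  by have := B k0; have := B k1; rewrite rE; nra.
have clh i : clip (fun s => h i (z s)).
  have [_ [L L0 HL]] := Hr i.
  exact: clip_comp clz L0 zr HL.
have cll n : clip (lam n) by split => /=; exact: lipa.
have clt : clip (fun s => (t s)%:C).
  split => /=; last exact: lip_cst.
  by apply: lip_congr (lipa 1 k4) => s; rewrite mul1r.
have clw b k : clip (fun s => w b s k).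
  rewrite /w; case: b.
    have H := clipD (clh (o1, k)) (clipM clt (clh (o2, k))); exact: H.
  have H := clipD (clipM clt (clh (o1, k))) (clh (o2, k)); exact: H.
have clP bn k : clip (fun s => Psi bn s k).
  have H := clipM (cll bn.2) (clipD
    (clipM (clh (o0, rot3 k)) (clw bn.1 (rot3 (rot3 k))))
    (clipN (clipM (clh (o0, rot3 (rot3 k))) (clw bn.1 (rot3 k))))).
  exact: H.
have nd bn : nowhere_dense (psi bn @` @box R 5).
  apply: lip_nowhere_dense => // i.
  rewrite /psi; under eq_fun do rewrite mxE.
  by case: (fintype.split i) => k; have [] := clP bn k.
exists c, j, (mdisc c z0 (Num.min e r)).
have m0 : 0 < Num.min e r by rewrite lt_min e0.
have charts q : mdisc c z0 (Num.min e r) q -> charts_at f q c j.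
  move=> [cq]; rewrite lt_min => /andP[_ qr]; split => //.
  have [/(_ _ qr) [q' [jq' cq'] E] _] := Hr (o0, o0).
  by have <- : q' = q by exact: chart_inj E.
split => //.
  by apply: open_nbhs_nbhs; split; [exact: mdisc_open|split => //; rewrite subrr normc0].
apply: meager_sub (meager_bigcup (fun bn => nowhere_dense_meager (nd bn))).
move=> x [q Nq] /(degenerate_cross (charts q Nq))[l [b [t0 [t01 Hx]]]].
have [cq] := Nq; rewrite lt_min => /andP[qe _].
have [n Hn] : exists n : nat, normc l <= n.+1%:R.
  exists (Num.truncn (normc l)); have /andP[_ /ltW] := truncn_itv (normc_ge0 l); exact.
have [y0 y01 E0] := unit_param e0 (le_trans (ler_Re_normc _) (ltW qe)).
have [y1 y11 E1] := unit_param e0 (le_trans (ler_Im_normc _) (ltW qe)).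
have n0 : 0 < (n.+1%:R : R) by rewrite ltr0n.
have [y2 y21 E2] := unit_param n0 (le_trans (ler_Re_normc _) Hn).
have [y3 y31 E3] := unit_param n0 (le_trans (ler_Im_normc _) Hn).
have [y4 y41 E4] := unit_param ltr01 t01.
exists (b, n) => //; pose s : 'rV[R]_5 := \row_i nth 0 [:: y0; y1; y2; y3; y4] i.
exists s.
  move=> [i i5']; rewrite mxE /=; move: i i5' => [|[|[|[|[|i]]]]] //.
have zs : z s = chart_map c q.
  by rewrite /z !mxE /= E0 E1; case: (chart_map c q) (z0) => [a1 b1] [a2 b2] /=; simpc; congr (_ +i* _); ring.
have ls : lam n s = l by rewrite /lam !mxE /= E2 E3; case: (l).
have ts : t s = t0 by rewrite /t mxE /= -E4 mul1r.
have PE k : Psi (b, n) s k = toC x 0 k.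
  by rewrite Hx /Psi /= ls /crossk /w zs ts /h /= /F /= chart_mapK.
apply/rowP => i; rewrite /psi mxE.
case: (fintype.splitP i) => k ik.
  by rewrite PE mxE /=; congr (x _ _); apply: val_inj.
by rewrite PE mxE /=; congr (x _ _); apply: val_inj.
Qed.

(** Countably many basic open sets suffice to cover the surface by the neighbourhoods of
    [degenerate_meager], so the forms degenerate somewhere are meager and Baire's theorem leaves one
    out. *)
Lemma generic_coeff : exists A : 'rV[C]_3, forall p : M, exists c j,
  charts_at f p c j /\ ~ degenerate c j p A.
Proof.
have [B /countable_injP[e einj] [Bo Bb]] := @surface_second_countable R M.
have H n : exists x : set 'rV[R]_(3 + 3), meager x /\ forall b, B b -> e b = n ->
    (exists c j N, [/\ b `<=` N, forall q, N q -> charts_at f q c j &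
      meager [set x | exists2 q, N q & degenerate c j q (toC x)]]) ->
    exists c j, forall q, b q -> charts_at f q c j /\
      forall y, degenerate c j q (toC y) -> x y.
  have [[b [b1 b2 [c [j [N [b3 b4 b5]]]]]]|nb] := pselect (exists b, [/\ B b, e b = n &
    (exists c j N, [/\ b `<=` N, forall q, N q -> charts_at f q c j &
      meager [set x | exists2 q, N q & degenerate c j q (toC x)]])]).
    exists [set x | exists2 q, N q & degenerate c j q (toC x)]; split => // b' b1' b2' _.
    have -> : b' = b by apply: einj; rewrite ?inE// b2' b2.
    by exists c, j => q /b3 Nq; split; [exact: b4|move=> y dy; exists q].
  exists set0; split; first by exists (fun=> set0) => // i; exact: nowhere_dense0.
  by move=> b b1 b2 b3; exfalso; apply: nb; exists b.
have [S HS] := choice H.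
have [x Hx] := meager_neq_setT (@meager_bigcup R nat _ S (fun n => proj1 (HS n))).
exists (toC x) => p; have [c [j [N [Np N1 N2]]]] := degenerate_meager p.
have [b [b1 bp] bN] := Bb p N Np.
have [_ /(_ b b1 erefl)[]] := HS (e b); first by exists c, j, N.
move=> c' [j' /(_ p bp)[ch dg]]; exists c', j'; split => // /dg Sx.
by apply: Hx; exists (e b).
Qed.

End Generic.

(** * Sections of the tautological line *)

Section Sections.
Variables (R : realType) (M : riemannSurface R) (f : M -> CP2 R).
Hypothesis fC : conformal_immersion f.
Local Notation C := R[i].
Implicit Types (W V K L : set M) (h u : M -> C) (s : M -> 'rV[C]_3) (p q x : M).

(** [b] is the orientation of a zero: [true] for one like [z], [false] for one like its
    conjugate. *)
Definition cj (b : bool) (z : C) : C := if b then z else conjc z.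

Lemma cj_eq0 b z : (cj b z == 0) = (z == 0).
Proof. by case: b => //=; rewrite conjc_eq0. Qed.

Lemma cjM b z w : cj b (z * w) = cj b z * cj b w.
Proof. by case: b => //=; rewrite rmorphM. Qed.

Lemma cj_cvg b h p (l : C) : h @ p^' --> l -> (fun x => cj b (h x)) @ p^' --> cj b l.
Proof.
move=> hl; case: b; first exact: hl.
have H := cvg_comp _ _ hl (@continuous_conjc R l); exact: H.
Qed.

Lemma smC_cj b W h : open W -> smC W h -> smC W (fun x => cj b (h x)).
Proof. by move=> oW Ch; case: b => //=; exact: smC_conj. Qed.

Lemma fillable_conj h p : fillable h p -> fillable (fun x => conjc (h x)) p.
Proof.
move=> [a [t [a0 t1 H]]]; exists (conjc a), t; split; [by rewrite conjc_eq0|exact: t1|].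
apply: filterS H => x Hx.
by rewrite -conjc_inv -rmorphM -(rmorph1 (@conjc R)) -rmorphB normc_conj.
Qed.

Lemma fillable_neq0 h p : fillable h p -> \forall x \near p^', h x != 0.
Proof.
move=> [a [t [a0 t1 H]]]; apply: filterS H => x; apply: contraTneq => ->.
by rewrite mul0r sub0r normcN normc1 -ltNge.
Qed.

Definition goodzero h p : Prop := exists (b : bool) (c : chart R M),
  [/\ @atlas R M c, chart_dom c p &
      fillable (fun x => h x / cj b (chart_map c x - chart_map c p)) p].

(** By [section_affine] this coordinate is the coefficient of [s] in the local frame
    [affine_coord j]. *)
Definition goodpt s p : Prop := exists2 j : 'I_3, affine_dom j (f p) &
  goodzero (fun x => s x 0 j) p.

Definition good_section s : Prop := [/\ forall p, s p \in val (f p),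
  forall k, smC setT (fun p => s p 0 k) & forall p, s p = 0 -> goodpt s p].

Lemma goodpt_isolated s p : goodpt s p -> \forall x \near p^', s x != 0.
Proof.
move=> [j _ [b [c [ac cp /fillable_neq0]]]]; apply: filterS => x.
by apply: contraNneq => ->; rewrite mxE mul0r.
Qed.

Lemma neq0_near s p : (forall k, smC setT (fun p => s p 0 k)) -> s p != 0 ->
  \forall x \near p, s x != 0.
Proof.
move=> Cs s0; have [k sk] : exists k, s p 0 k != 0.
  apply: contrapT => H; move/eqP: s0; apply; apply/rowP => k; rewrite mxE.
  by apply/eqP/negPn/negP => sk; apply: H; exists k.
have cs := smC_continuous openT (Cs k) (I : [set: M] p).
have n0 : 0 < normc (s p 0 k) by rewrite normc_gt0.
apply: filterS ((continuous_complexP _ _).1 cs _ n0) => x.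
by apply: contraTneq => ->; rewrite mxE sub0r normcN ltxx.
Qed.

(** Good zeros are isolated, so every point has a neighbourhood containing at most one zero. *)
Lemma zeros_finite s K : good_section s -> compact K -> exists l : seq M,
  forall x, K x -> s x = 0 -> x \in l.
Proof.
move=> [_ Cs gs] cK.
apply: (compact_induction (P := fun A => exists l : seq M, forall x, A x -> s x = 0 -> x \in l) cK).
- by exists [::].
- move=> A B [l1 H1] [l2 H2]; exists (l1 ++ l2) => x AB sx; rewrite mem_cat.
  by case: AB => [/H1->//|/H2->//]; rewrite orbT.
- by move=> A B BA [l H]; exists l => x /BA; exact: H.
move=> x _; have [sx|sx] := eqVneq (s x) 0.
  have H := dnbhs_near (goodpt_isolated (gs x sx)).
  exists [set y | y <> x -> s y != 0] => //; exists [:: x] => y /= Hy sy.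
  by rewrite inE; apply/negPn/negP => /eqP /Hy; rewrite sy eqxx.
exists [set y | s y != 0]; first exact: neq0_near.
by exists [::] => y /= /negP H sy; exfalso; apply: H; rewrite sy.
Qed.

(** A zero of the section and the pole of a transport come with charts of their own; the ratio of
    charts lets both be read in the same one. *)
Lemma pole_at_chart u p c : @atlas R M c -> chart_dom c p -> pole_at u p ->
  exists2 b : C, b != 0 & (fun x => u x * (chart_map c x - chart_map c p)) @ p^' --> b.
Proof.
move=> ac cp [d [a [ad dp a0 H]]]; have [l l0 Hl] := chart_ratio ad ac dp cp.
exists (a * l); first exact: mulf_neq0.
have H1 := cvg_dnbhsM H Hl; apply: cvg_dnbhs_congr H1.
by apply: filterS (near_chart dp) => x [_ x0] /=; field.
Qed.

Lemma section_affine s p j : s p \in val (f p) -> affine_dom j (f p) ->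
  s p = s p 0 j *: affine_coord j (f p).
Proof. by move=> sp fp; exact: mem_line_affine. Qed.

Lemma smC_affine j k : smC (f @^-1` affine_dom j) (fun p => affine_coord j (f p) 0 k).
Proof. by move=> c ac n; exact: (smooth_affine fC j n ac k). Qed.

(** The section is multiplied by a transport, conjugated if the zero at [q] has the opposite
    orientation. The pole then cancels the zero up to a fillable function; the new zero at [q']
    inherits the orientation, and the other zeros are multiplied by a non-zero limit, so they remain
    good. *)
Lemma push s W q q' : good_section s -> open W -> connected W -> W q -> W q' ->
  s q = 0 -> s q' != 0 -> exists s', [/\ good_section s',
    forall x, ~ W x -> s' x = s x &
    forall x, s' x = 0 -> x = q' \/ (s x = 0 /\ x <> q)].
Proof.
move=> [ms Cs gs] oW cW Wq Wq' sq sq'.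
have qq' : q <> q' by move=> E; rewrite -E sq eqxx in sq'.
have [u [Cu u0 u1 Pu Zu]] := transport_connected fC oW cW Wq Wq' qq'.
have [j fq [b [c [ac cq Fq]]]] := gs q sq.
pose U x := cj b (u x); pose X := f @^-1` affine_dom j.
have oX : open X := open_affine fC j.
have oXq : open (X `\ q) := open_D1 q oX.
have oq : open (~` [set q] : set M) := open_C1 q.
have CU : smC (~` [set q]) U := smC_cj b oq Cu.
pose h x := s x 0 j * U x.
have Ch : smC (X `\ q) h.
  apply: (smCM oXq); first exact: smC_sub (Cs j).
  by apply: smC_sub CU => x [].
have Fh : fillable h q.
  have [a a0 Ha] := pole_at_chart ac cq Pu.
  have a0' : cj b a != 0 by rewrite cj_eq0.
  apply: (fillable_near _ (fillable_mul Fq a0' (cj_cvg Ha))).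
  apply: filterS (near_chart cq) => x [_ x0].
  have : cj b (chart_map c x - chart_map c q) != 0 by rewrite cj_eq0.
  by rewrite cjM /h /U; move: (cj b (u x)) (cj b _) => y z z0; field.
have [g [K [cK Kq KWX Cg [gE g0]]]] := fill fC oX fq oW Wq Ch Fh.
(* The definitions agree on the part of [X] outside [K], where [g] is the coefficient of [U s] in
   the frame; so [s'] is smooth on both [X] and the complement of [K], which cover the surface. *)
pose s' x := if `[< K x >] then g x *: affine_coord j (f x) else U x *: s x.
have s'X x : X x -> s' x = g x *: affine_coord j (f x).
  move=> Xx; rewrite /s'; case: asboolP => // nK.
  by rewrite gE// /h {1}(section_affine (ms x) Xx) scalerA mulrC.
have s'K x : ~ K x -> s' x = U x *: s x by move=> nK; rewrite /s' asboolF.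
have oK : open (~` K) by rewrite openC.
have Kneq x : ~ K x -> x <> q by move=> nK xq; apply: nK; rewrite xq.
have nearK x : ~ K x -> \forall y \near x^', U y *: s y = s' y.
  move=> nK; apply: near_dnbhs; apply: filterS (open_nbhs_nbhs (conj oK nK)) => y Ky _.
  by rewrite s'K.
have Uneq0 x : x <> q -> x <> q' -> U x != 0 by move=> n1 n2; rewrite cj_eq0 u0.
have zero x : s' x = 0 -> ~ K x /\ (x = q' \/ (s x = 0 /\ x <> q)).
  have [Kx|nK] := pselect (K x).
    have [_ Xx] := KWX x Kx.
    move/eqP; rewrite (s'X x Xx) scaler_eq0 (negbTE (g0 x Kx)) /=.
    by rewrite (negbTE (affine_coord_neq0 Xx)).
  move/eqP; rewrite s'K// scaler_eq0 => /orP H; split=> //.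
  have [xq'|xq'] := pselect (x = q'); first by left.
  right; split; last exact: Kneq.
  by case: H => [|/eqP//]; rewrite (negbTE (Uneq0 x (Kneq x nK) xq')).
exists s'; split; last by move=> x /zero[].
- split.
  + move=> x; rewrite /s'; case: asboolP => _; last by rewrite memvZ.
    by rewrite memvZ// affine_coord_mem.
  + move=> k; apply: smC_local => x _; have [Xx|nX] := pselect (X x).
      exists X => //; have H := smCM oX Cg (smC_affine j k).
      by apply: (smC_congr oX _ H) => y Xy; rewrite s'X// [RHS]mxE.
    have nK : ~ K x by move=> /KWX[].
    exists (~` K) => //.
    have sub : ~` K `<=` ~` [set q] by move=> y /Kneq.
    have H := smCM oK (smC_sub sub CU) (smC_sub (@subsetT _ (~` K)) (Cs k)).
    by apply: (smC_congr oK _ H) => y nKy; rewrite s'K// mxE.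
  + move=> x s'x; have [nK [xq'|[sx xq]]] := zero x s'x.
      rewrite {x}xq' in s'x nK *; have [j' fq'] := affine_dom_ex (f q').
      exists j' => //; have [d [a [ad dq' a0 Ha]]] := Zu.
      exists b, d; split => //.
      have sj : s q' 0 j' != 0.
        by apply: contra sq' => /eqP E; rewrite (section_affine (ms q') fq') E scale0r.
      have cs := cvg_dnbhs (smC_continuous openT (Cs j') (I : [set: M] q')) erefl.
      have H := cvg_dnbhsM (cj_cvg (b := b) Ha) cs.
      have l0 : cj b a * s q' 0 j' != 0 by rewrite mulf_neq0// cj_eq0.
      apply: (fillable_near _ (fillable_cvg l0 H)).
      move: (nearK q' nK) (near_chart dq'); apply: filterS2 => y <- [_ y0].
      have y0' : cj b (chart_map d y - chart_map d q') != 0 by rewrite cj_eq0.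
      have -> : cj b (u y / (chart_map d y - chart_map d q')) =
          U y / cj b (chart_map d y - chart_map d q').
        apply: (mulIf y0'); rewrite -cjM divfK//.
        by rewrite divfK.
      by rewrite mxE mulrAC.
    have [xq'|xq'] := pselect (x = q'); first by rewrite xq' in sx; rewrite sx eqxx in sq'.
    have [j' fx [b' [d [ad dx Fx]]]] := gs x sx.
    exists j' => //; exists b', d; split => //.
    have cU := cvg_dnbhs (smC_continuous oq CU xq) erefl.
    apply: (fillable_near _ (fillable_mul Fx (Uneq0 x xq xq') cU)).
    apply: filterS (nearK x nK) => y <-.
    by rewrite mxE mulrAC [s y 0 j' * U y]mulrC.
- move=> x nW; rewrite s'K; last by move=> /KWX[].
  rewrite /U u1// (_ : cj b 1 = 1) ?scale1r//.
  by case: (b); rewrite /cj ?conjc1.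
Qed.

(** Induction on a list containing the zeros in [L]. Fullness of [K] provides a connected open set,
    disjoint from [K], along which the first zero is pushed out of [L]. *)
Lemma clear_zeros K L s : full K -> compact L -> good_section s ->
  (forall x, K x -> s x != 0) -> exists s', [/\ good_section s',
    forall x, K x -> s' x = s x & forall x, L x -> s' x != 0].
Proof.
move=> fK cL gs sK; have [l Hl] := zeros_finite gs cL.
have clL : closed L by apply: compact_closed => //; exact: surface_hausdorff.
elim: l s gs sK Hl => [|q l IH] s gs sK Hl.
  exists s; split => // x Lx; apply/eqP => sx; by have := Hl x Lx sx.
have [[sq Lq]|nq] := pselect (s q = 0 /\ L q); last first.
  apply: IH => // x Lx sx; have := Hl x Lx sx; rewrite inE => /predU1P[xq|//].
  by exfalso; apply: nq; rewrite -xq.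
have nKq : ~ K q by move=> /sK; rewrite sq eqxx.
have [V [oV cV Vq VK VL]] := fK q nKq L cL.
have [y [Vy Ly]] : exists y, V y /\ ~ L y.
  apply: contrapT => H; apply: VL => y Vy; apply: contrapT => Ly; apply: H; by exists y.
have oVL : open (V `&` ~` L) by apply: openI => //; rewrite openC.
(* [push] wants a target where [s] does not vanish. If [y] is itself a zero, it is isolated and a
   nearby point serves. *)
have [q' [Vq' Lq'] sq'] : exists2 q', V q' /\ ~ L q' & s q' != 0.
  have [sy|sy] := eqVneq (s y) 0; last by exists y.
  have [_ _ gz] := gs; have H := goodpt_isolated (gz y sy).
  have H2 : \forall x \near y^', V x /\ ~ L x.
    by apply: near_dnbhs; apply: filterS (open_nbhs_nbhs (conj oVL (conj Vy Ly))) => x.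
  have PF := dnbhs_proper y.
  have [x [sx Vx]] := filter_ex (filterI H H2).
  by exists x.
have [s1 [gs1 E1 Z1]] := push gs oV cV Vq Vq' sq sq'.
have KE x : K x -> s1 x = s x by move=> Kx; apply: E1 => /VK; exact.
have [||s' [gs' E' Z']] := IH s1 gs1.
- by move=> x Kx; rewrite KE// sK.
- move=> x Lx /Z1[xq'|[sx xq]]; first by rewrite xq' in Lx.
  by have := Hl x Lx sx; rewrite inE => /predU1P[].
by exists s'; split => // x Kx; rewrite E'// KE.
Qed.

End Sections.

(** * A section with good zeros, removal of its zeros, and the lift *)

Section Lift.
Variables (R : realType) (M : riemannSurface R) (f : M -> CP2 R).
Hypothesis fC : conformal_immersion f.
Local Notation C := R[i].

(** If [|a| = |b|] were non-zero, a square root [z] of [- b / a] would have modulus 1, and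
    [z (a z + b conj z) = a z^2 + b = 0]. *)
Lemma normc_neq_nondegenerate (a b : C) :
  (forall z : C, z != 0 -> a * z + b * conjc z != 0) -> normc a != normc b.
Proof.
move=> H; apply/negP => /eqP ab.
have [a0|a0] := eqVneq a 0.
  have /eqP b0 : b == 0 by rewrite -normc_eq0 -ab a0 normc0.
  by have := H 1 (oner_neq0 _); rewrite a0 b0 !mul0r addr0 eqxx.
have [z z2] : exists z, z ^+ 2 = - b / a by exists (sqrtc (- b / a)); exact: sqr_sqrtc.
have nz : normc z = 1.
  have : normc z ^+ 2 = 1.
    by rewrite expr2 -normcM -expr2 z2 normcM normcN normcV -ab divff// normc_eq0.
  by move=> /eqP; rewrite -[X in _ == X](expr1n R 2) eqrXn2 ?normc_ge0// => /eqP.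
have zz : z * conjc z = 1 by rewrite -sqr_normc normcC nz expr1n.
have z0 : z != 0 by rewrite -normc_gt0 nz.
have := H z z0; rewrite -(inj_eq (mulfI z0)) mulr0 mulrDr.
have -> : z * (a * z) = a * z ^+ 2 by ring.
by rewrite [z * (b * _)]mulrCA zz mulr1 z2 [a * _]mulrC divfK// addNr eqxx.
Qed.

(** The larger of [|a|] and [|b|] decides the orientation. Divided by its leading term, [h] is
    within [(|b'| + e) / |a'|] of 1, and taking half the gap between the moduli for [e] keeps this
    below 1. *)
Lemma goodzero_linear (h : M -> C) (c : chart R M) (a b : C) (p : M) :
  @atlas R M c -> chart_dom c p -> normc a != normc b ->
  (forall e : R, 0 < e -> \forall x \near p^',
     normc (h x - (a * (chart_map c x - chart_map c p) +
                   b * conjc (chart_map c x - chart_map c p)))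
       <= e * normc (chart_map c x - chart_map c p)) ->
  goodzero h p.
Proof.
move=> ac cp ab H.
have fill_of (s : bool) (a' b' : C) : normc b' < normc a' ->
    (forall z, a * z + b * conjc z = a' * cj s z + b' * conjc (cj s z)) -> goodzero h p.
  move=> ba E; exists s, c; split => //.
  have na : 0 < normc a' by apply: le_lt_trans ba; exact: normc_ge0.
  have a0 : a' != 0 by rewrite -normc_gt0.
  pose e := (normc a' - normc b') / 2; have e0 : 0 < e by rewrite divr_gt0// subr_gt0.
  exists a', ((normc b' + e) / normc a'); split => //.
    by rewrite ltr_pdivrMr// mul1r /e; lra.
  move: (H e e0) (near_chart cp); apply: filterS2 => x Hx [_ x0].
  set z := chart_map c x - chart_map c p in Hx x0 *.
  have sz0 : cj s z != 0 by rewrite cj_eq0.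
  have nz : normc (cj s z) = normc z by case: (s) => //=; rewrite normc_conj.
  have nz0 : 0 < normc z by rewrite normc_gt0.
  rewrite ler_pdivlMr// -(ler_pM2r nz0) -{1}nz -!normcM.
  have -> : (h x / cj s z / a' - 1) * a' * cj s z =
      (h x - (a * z + b * conjc z)) + b' * conjc (cj s z).
    by rewrite E; move: (conjc (cj s z)) => zz; field; rewrite a0 sz0.
  apply: le_trans (le_normcD _ _) _; rewrite normcM normc_conj nz mulrDl addrC.
  by rewrite lerD2l.
have [lt|le] := ltP (normc b) (normc a).
  by apply: (fill_of true a b).
have lt : normc a < normc b by rewrite lt_neqAle ab.
apply: (fill_of false b a) => // z.
by rewrite /= conjcK addrC.
Qed.

Lemma goodzero_mul (h v : M -> C) p (l : C) : goodzero h p -> l != 0 -> v @ p^' --> l ->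
  goodzero (fun x => h x * v x) p.
Proof.
move=> [b [c [ac cp Fh]]] l0 Hl; exists b, c; split => //.
apply: (fillable_near _ (fillable_mul Fh l0 Hl)).
by apply: near_dnbhs; apply: nearW => x _; rewrite mulrAC.
Qed.

Lemma goodzero_conj (h : M -> C) p : goodzero h p -> goodzero (fun x => conjc (h x)) p.
Proof.
move=> [b [c [ac cp Fh]]]; exists (~~ b), c; split => //.
apply: (fillable_near _ (fillable_conj Fh)).
apply: near_dnbhs; apply: nearW => x _; rewrite rmorphM /= conjc_inv; congr (_ * _^-1).
by case: (b) => //=; rewrite conjcK.
Qed.

Lemma goodzero_near (h g : M -> C) p : (\forall x \near p^', h x = g x) ->
  goodzero h p -> goodzero g p.
Proof.
move=> E [b [c [ac cp Fh]]]; exists b, c; split => //.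
by apply: (fillable_near _ Fh); apply: filterS E => x ->.
Qed.

Lemma CC1_diff (U : set C) (h : C -> C) (c : C) (e : R) : open U -> CC 1 U h -> U c -> 0 < e ->
  exists2 r : R, 0 < r & forall z, normc z < r ->
    normc (h (c + z) - h c - ((complex.Re z)%:C * cpd 1 h c + (complex.Im z)%:C * cpd 'i h c))
      <= e * normc z.
Proof.
move=> oU [hR hI] Uc e0; have e20 : 0 < e / 2 by rewrite divr_gt0.
have [r1 r10 H1] := Ck1_diff oU hR Uc e20.
have [r2 r20 H2] := Ck1_diff oU hI Uc e20.
exists (Num.min r1 r2); first by rewrite lt_min r10.
move=> z; rewrite lt_min => /andP[/H1 h1 /H2 h2].
apply: le_trans (normc_le_ReIm _) _; rewrite [e]splitr mulrDl; apply: lerD.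
  apply: le_trans h1; rewrite le_eqVlt; apply/orP; left; apply/eqP; congr `|_|.
  rewrite !raddfB raddfD /cpd /=; ring.
apply: le_trans h2; rewrite le_eqVlt; apply/orP; left; apply/eqP; congr `|_|.
rewrite !raddfB raddfD /cpd /=; ring.
Qed.

Lemma normc_sum (I : finType) (h : I -> C) : normc (\sum_i h i) <= \sum_i normc (h i).
Proof.
elim/big_ind2: _ => // [|x1 x2 y1 y2 H1 H2]; first by rewrite normc0.
by apply: le_trans (le_normcD _ _) _; exact: lerD.
Qed.

Lemma dotmxZ n (a : C) (v : 'rV[C]_n) : dotmx (a *: v) (a *: v) = a * conjc a * dotmx v v.
Proof.
rewrite !dotmxsum mulr_sumr; apply: eq_bigr => k _.
by rewrite !mxE rmorphM mulrACA.
Qed.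

Lemma goodzero_nondegenerate (A : 'rV[C]_3) p c j : charts_at f p c j ->
  ~ degenerate f c j p A -> dotl A (affine_coord j (f p)) = 0 ->
  goodzero (fun x => dotl A (affine_coord j (f x))) p.
Proof.
move=> ch nd A0; have [ac cp jp] := ch.
pose U := chart_map c @` (f @^-1` affine_dom j `&` chart_dom c).
have oU : open U by apply: chart_image_open; exact: (open_affine fC).
have Uz : U (chart_map c p) by exists p.
pose F := affine_coord j \o f \o chart_inv c.
have CF n : vCC n U F := smooth_affine fC j n ac.
pose g z := dotl A (F z).
have Cg : CC 1 U g.
  apply: CC_sum => // k; have H := CCM oU (CC_cst 1 (A 0 k) oU) (CF 1%N k); exact: H.
set z0 := chart_map c p in Uz *.
pose X := dotl A (real_diff F z0 1); pose Y := dotl A (real_diff F z0 'i).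
have XY (v : C) : dotl A (diff_to_CP2 f c j p v) = (complex.Re v)%:C * X + (complex.Im v)%:C * Y.
  have /= := real_diff_lin v oU Uz (CF 1%N); rewrite /diff_to_CP2 /X /Y.
  move: (real_diff _ _ 1) (real_diff _ _ 'i) => D1 Di ->.
  by rewrite /dotl !mulr_sumr -big_split /=; apply: eq_bigr => k _; rewrite !mxE; ring.
(* The Wirtinger derivatives: the real-linear map with values [X] at 1 and [Y] at ['i] is
   [a z + b conj z]. *)
pose a := (X - 'i * Y) / 2; pose b := (X + 'i * Y) / 2.
have abE (z : C) : a * z + b * conjc z = (complex.Re z)%:C * X + (complex.Im z)%:C * Y.
  have I2 : 'i * 'i = -1 :> C by rewrite -expr2 sqr_i.
  have -> : conjc z = (complex.Re z)%:C - 'i * (complex.Im z)%:C.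
    by case: (z) => x y; simpc.
  have E (J X' Y' x y : C) : J * J = -1 ->
      (X' - J * Y') / 2 * (x + J * y) + (X' + J * Y') / 2 * (x - J * y) = x * X' + y * Y'.
    move=> J2; transitivity (x * X' - J * J * (y * Y')); first by field.
    by rewrite J2; ring.
  by rewrite {1}[z]complexE /a /b; exact: E.
apply: (goodzero_linear (a := a) (b := b) ac cp).
  apply: normc_neq_nondegenerate => z z0'; rewrite abE -XY.
  by apply/negP => /eqP E; apply: nd; split => //; exists z.
move=> e e0; pose S := \sum_k normc (A 0 k).
have S0 : 0 <= S by rewrite sumr_ge0// => k _; exact: normc_ge0.
(* The coordinate errors are summed with the weights [|A_k|], whose total is [S]; the 1 guards the
   division. *)
have eS : 0 < e / (S + 1) by rewrite divr_gt0// ltr_wpDl.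
have [r r0 Hr] : exists2 r : R, 0 < r & forall k z, normc z < r ->
    normc (F (z0 + z) 0 k - F z0 0 k - ((complex.Re z)%:C * real_diff F z0 1 0 k +
      (complex.Im z)%:C * real_diff F z0 'i 0 k)) <= e / (S + 1) * normc z.
  apply: fin_radius => [k r r' H r'0 r'r z zr|k]; first by apply: H; exact: lt_le_trans r'r.
  have [r r0 H] := CC1_diff oU (CF 1%N k) Uz eS.
  have E v : real_diff F z0 v 0 k = cpd v (fun z => F z 0 k) z0 by rewrite /real_diff mxE.
  exists r => [|z zr]; first exact: r0.
  move: (E 1) (E 'i); move: (real_diff F z0 1) (real_diff F z0 'i) => D1 Di -> ->.
  exact: H.
have cc : \forall x \near p^', normc (chart_map c x - z0) < r.
  apply: near_dnbhs; apply: filterS ((continuous_complexP _ _).1 (chart_map_continuous cp) _ r0).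
  by move=> x.
move: cc (near_chart cp); apply: filterS2 => x xr [cx _].
rewrite abE; set z := chart_map c x - z0 in xr *.
have FE : affine_coord j (f x) = F (z0 + z) by rewrite /F /z addrC subrK /= chart_mapK.
have F0 : affine_coord j (f p) = F z0 by rewrite /F /= chart_mapK.
rewrite F0 in A0; rewrite FE -[dotl A (F _)]subr0 -A0.
have -> : dotl A (F (z0 + z)) - dotl A (F z0) -
    ((complex.Re z)%:C * X + (complex.Im z)%:C * Y) =
    \sum_k A 0 k * (F (z0 + z) 0 k - F z0 0 k - ((complex.Re z)%:C * real_diff F z0 1 0 k +
      (complex.Im z)%:C * real_diff F z0 'i 0 k)).
  rewrite /X /Y /dotl; move: (real_diff _ _ 1) (real_diff _ _ 'i) (F _) (F _) => D1 Di G1 G2.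
  rewrite !mulr_sumr -big_split -!sumrB /=; apply: eq_bigr => k _; ring.
apply: le_trans (normc_sum _) _.
apply: (@le_trans _ _ (\sum_k normc (A 0 k) * (e / (S + 1) * normc z))).
  apply: ler_sum => k _; rewrite normcM ler_wpM2l ?normc_ge0//; exact: Hr.
rewrite -mulr_suml -/S mulrA ler_wpM2r ?normc_ge0// mulrCA.
by rewrite ler_piMr ?(ltW e0)// ler_pdivrMr ?ltr_wpDl// mul1r lerDl.
Qed.

(** The Hermitian product turns the form [A], a section of the dual line, into a section of the line
    itself, at the cost of a conjugation that reverses the orientation of the zeros. *)
Lemma initial_section : exists s, good_section f s.
Proof.
have [A HA] := generic_coeff fC.
(* Homogeneous of degree 0: scaling the vector by [mu] produces the factors [conj mu],
   [1 / (mu conj mu)] and [mu]. So the choice made by [line_vector] cancels, and [affine_coord j]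
   may be substituted to see smoothness. *)
pose s (p : M) := (conjc (dotl A (line_vector (f p))) /
  dotmx (line_vector (f p)) (line_vector (f p))) *: line_vector (f p).
pose co j (p : M) := conjc (dotl A (affine_coord j (f p))) *
  (dotmx (affine_coord j (f p)) (affine_coord j (f p)))^-1.
have aff_neq0 j p : affine_dom j (f p) -> dotmx (affine_coord j (f p)) (affine_coord j (f p)) != 0.
  by move=> jp; exact/dotmx_neq0/affine_coord_neq0.
have sE j p : affine_dom j (f p) -> s p = co j p *: affine_coord j (f p).
  move=> jp; have l0 : line_vector (f p) 0 j != 0 := jp.
  have lE : line_vector (f p) = line_vector (f p) 0 j *: affine_coord j (f p).
    by rewrite /affine_coord scalerA divff// scale1r.
  have conjM (x y : C) : conjc (x * y) = conjc x * conjc y by rewrite rmorphM.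
  have := aff_neq0 j p jp; rewrite /s /co lE dotlZ dotmxZ conjM scalerA.
  move: (line_vector _ 0 j) l0 (dotl A _) (dotmx _ _) => mu mu0 x y y0; congr (_ *: _).
  have mu0' : conjc mu != 0 by rewrite conjc_eq0.
  by move: (conjc mu) (conjc x) mu0' => mu' x' mu0'; field; rewrite mu0 mu0' y0.
have CV j : smC (f @^-1` affine_dom j)
    (fun p => (dotmx (affine_coord j (f p)) (affine_coord j (f p)))^-1).
  have oX := open_affine fC j; apply: (smCV oX); first exact: aff_neq0.
  apply: (smC_congr oX (h := fun p => \sum_k affine_coord j (f p) 0 k *
     conjc (affine_coord j (f p) 0 k))).
    by move=> p _; rewrite dotmxsum.
  apply: (smC_sum oX) => k.
  have H := smCM oX (smC_affine fC j k) (smC_conj oX (smC_affine fC j k)); exact: H.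
have CA j : smC (f @^-1` affine_dom j) (fun p => dotl A (affine_coord j (f p))).
  have oX := open_affine fC j; apply: (smC_sum oX) => k.
  have H := smCM oX (smC_cst oX (A 0 k)) (smC_affine fC j k); exact: H.
exists s; split.
- by move=> p; rewrite /s memvZ// line_vector_mem.
- move=> k; apply: smC_local => p _; have [j jp] := affine_dom_ex (f p).
  exists (f @^-1` affine_dom j) => //; have oX := open_affine fC j.
  have H := smCM oX (smCM oX (smC_conj oX (CA j)) (CV j)) (smC_affine fC j k).
  by apply: (smC_congr oX _ H) => q jq; rewrite (sE j q jq) [RHS]mxE.
- move=> p sp; have [c [j [ch nd]]] := HA p; have [ac cp jp] := ch.
  exists j => //; have oX := open_affine fC j.
  have dA0 : dotl A (affine_coord j (f p)) = 0.
    move/eqP: sp; rewrite (sE j p jp) scaler_eq0 (negbTE (affine_coord_neq0 jp)) orbF.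
    by rewrite /co mulf_eq0 invr_eq0 (negbTE (aff_neq0 j p jp)) orbF conjc_eq0 => /eqP.
  have G := goodzero_conj (goodzero_nondegenerate ch nd dA0).
  have l0 : (dotmx (affine_coord j (f p)) (affine_coord j (f p)))^-1 != 0.
    by rewrite invr_eq0 aff_neq0.
  have cV := cvg_dnbhs (smC_continuous oX (CV j) jp) erefl.
  apply: goodzero_near (goodzero_mul G l0 cV).
  apply: near_dnbhs; apply: filterS (open_nbhs_nbhs (conj oX jp)) => x jx _.
  by rewrite (sE j x jx) [RHS]mxE affine_coordE// mulr1.
Qed.

Hypothesis ncM : ~ compact [set: M].

Lemma nowhere_zero_section : exists s : M -> 'rV[C]_3, [/\ forall p, s p \in val (f p),
  forall k, smC setT (fun p => s p 0 k) & forall p, s p != 0].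
Proof.
have [K [cK fK KK KT]] := full_exhaustion ncM.
have Kmono m n : (m <= n)%N -> K m `<=` K n.
  move=> /subnK <-; elim: (n - m)%N => [//|k IH] x /IH Kx; rewrite addSn.
  by apply: interior_subset; exact: KK.
(* Lets the first round of clearing start from the empty set: the connected surface itself is a
   suitable [V], as it lies in no compact set. *)
have f0 : full (set0 : set M).
  move=> p _ L cL; exists setT; split.
  - exact: openT.
  - exact: surface_connected.
  - by [].
  - by move=> x _ [].
  move=> TL; apply: ncM; suff <- : L = setT by [].
  by apply/seteqP; split.
pose T n := {s : M -> 'rV[C]_3 | good_section f s /\ forall x, K n x -> s x != 0}.
have S0 : T 0%N.
  apply: cid; have [s gs] := initial_section.
  have [s' [gs' _ Z]] := clear_zeros fC f0 (cK 0%N) gs (fun x (h : set0 x) => False_rect _ h).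
  by exists s'.
have step n (s : T n) : {s' : T n.+1 | forall x, K n x -> sval s' x = sval s x}.
  apply: cid; case: s => s [gs sK] /=.
  have [s' [gs' E Z]] := clear_zeros fC (fK n) (cK n.+1) gs sK.
  by exists (exist _ s' (conj gs' Z)).
pose S := fix S n : T n := if n is m.+1 then sval (step m (S m)) else S0.
have SS n x : K n x -> sval (S n.+1) x = sval (S n) x by exact: (svalP (step n (S n))).
have Sle m n x : (m <= n)%N -> K m x -> sval (S n) x = sval (S m) x.
  move=> mn Kx; rewrite -(subnK mn); elim: (n - m)%N => [//|k IH].
  by rewrite addSn SS//; apply: (Kmono m) => //; exact: leq_addl.
(* The sequence of sections is stationary on each [K n]; the limit takes at [p] the value reached as
   soon as [p] is absorbed. *)
pose N p := sval (cid (KT p)); have KN p : K (N p) p := svalP (cid (KT p)).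
pose s p := sval (S (N p)) p.
have sE n p : K n p -> s p = sval (S n) p.
  move=> Kp; rewrite /s; case/orP: (leq_total n (N p)) => h; first by rewrite (Sle n).
  by rewrite (Sle (N p) n).
exists s; split.
- by move=> p; rewrite /s; have [[ms _ _] _] := svalP (S (N p)); exact: ms.
(* [K (N p)] need not be a neighbourhood of [p], but the next set of the exhaustion is. *)
- move=> k; apply: smC_local => p _; exists (K (N p).+1)°; first exact: KK.
  have [[_ Cs _] _] := svalP (S (N p).+1).
  apply: smC_congr (smC_sub (@subsetT _ _) (Cs k)); first exact: open_interior.
  by move=> q /interior_subset/sE ->.
- by move=> p; rewrite /s; have [_ sn] := svalP (S (N p)); exact: sn.
Qed.

Lemma global_lift : exists2 g : M -> sphere5 R,
  smooth_to_sphere5 g & forall p : M, f p = hopf (g p).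
Proof.
have [s [ms Cs s0]] := nowhere_zero_section.
pose u (p : M) : R := \sum_k normc (s p 0 k) ^+ 2.
have uE p : dotmx (s p) (s p) = (u p)%:C.
  rewrite dotmxsum /u rmorph_sum; apply: eq_bigr => k _.
  by rewrite -sqr_normc normcC rmorphXn.
have u0 p : 0 < u p.
  have up : 0 <= u p by apply: sumr_ge0 => k _; exact: sqr_ge0.
  by have := dotmx_neq0 (s0 p); rewrite uE fmorph_eq0 lt_def => ->.
pose r (p : M) : C := (Num.sqrt (u p))%:C.
have r0 p : r p != 0 by rewrite fmorph_eq0 sqrtr_eq0 -ltNge.
have rr p : r p * r p = (u p)%:C by rewrite -rmorphM -expr2 sqr_sqrtr// ltW.
have un p : dotmx ((r p)^-1 *: s p) ((r p)^-1 *: s p) == 1.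
  have -> : dotmx ((r p)^-1 *: s p) ((r p)^-1 *: s p) = (r p)^-1 * (r p)^-1 * dotmx (s p) (s p).
    by rewrite dotmxZ conjc_inv conjc_real.
  by rewrite uE -rr mulrACA mulVf// mulr1.
have g0 p : (r p)^-1 *: s p != 0 by rewrite scaler_eq0 invr_eq0 negb_or r0 s0.
exists (fun p => Sub ((r p)^-1 *: s p) (un p)).
  have Cu : smC setT (fun p => (u p)%:C).
    apply: (@smC_congr _ _ _ (fun p => \sum_k (normc (s p 0 k) ^+ 2)%:C)); first exact: openT.
      by move=> p _; rewrite /u rmorph_sum.
    apply: (smC_sum openT) => k; have H := smC_normc2 openT (Cs k); exact: H.
  have Cr : smC setT (fun p => (r p)^-1).
    have H := smCV openT _ (smC_sqrt openT _ Cu); apply: H => p _; [exact: r0|exact: u0].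
  move=> c ac k n; have H := smCM openT Cr (Cs k) ac n.
  apply: (CC_congr _ _ H); first exact: (chart_image_open openT).
  by move=> z _; rewrite /= mxE.
move=> p; apply: val_inj; rewrite /hopf SubK SubK.
apply: CP2_line => //; exact: memvZ.
Qed.

End Lift.

Theorem theoremA2 (R : realType) (M : riemannSurface R)
    (M_noncompact : ~ compact [set: M])
    (f : M -> CP2 R) (f_conformal : conformal_immersion f)
    (f_no_complex_point : forall p : M, ~ complex_point f p) :
  exists2 g : M -> sphere5 R,
    smooth_to_sphere5 g & forall p : M, f p = hopf (g p).
Proof. exact: global_lift f_conformal M_noncompact. Qed.
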